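(* Let $R=k[x_1,\ldots,x_n]/(x_1\cdots x_n)$ and let $M = \bigoplus_{I \subseteq [n]} R/\left( \prod_{i \in I} x_i \right)$. Then $\operatorname{End}_R(M)$ is a noncommutative resolution (NCR) of $R$ with global dimension $n$. Furthermore, let $K \subseteq [n]$ and let $$M' = \bigoplus_{I \subseteq [n],\, I \neq K} R/\Big( \prod_{i \in I} x_i \Big).$$ Then $\operatorname{End}_R(M')$ is a NCR of $R$ of global dimension $\leq 2n-1$.
   Context: $k$ is a field and $[n]=\{1,\dots,n\}$. A finitely generated $R$-module $N$ gives a NCR of $R$, and $\operatorname{End}_R(N)$ is called a NCR of $R$, if $\operatorname{supp} N =\operatorname{supp} R\,(=\operatorname{Spec} R)$ and $\operatorname{End}_R(N)$ has finite global dimension. The empty product is $1$, so the summand for $I=\emptyset$ is zero.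
   Formalization: The formal theorem assumes n ≥ 2: for n = 1 one has R = k, M = 0 ⊕ k and End_R(M) = k of global dimension 0, not 1, and for K = {1} M' = 0 is not a NCR; for n = 0 the ring R is zero and 2n−1 is negative. *)

(* Defs.v *)
From HB Require Import structures.
From mathcomp Require Import all_boot all_algebra boolp.
From mathcomp.multinomials Require Import mpoly.

Set Implicit Arguments.
Unset Strict Implicit.
Unset Printing Implicit Defensive.

Import GRing.Theory.
Local Open Scope ring_scope.
Local Open Scope quotient_scope.

Section PrincipalQuotient.
Variables (A : comPzRingType) (f : A).

(* Membership in the ideal (f); f = 1 is allowed, and then A/(f) = 0. *)
Definition principal : {pred A} := fun a => `[< exists r, a = r * f >].

Lemma principalP a : reflect (exists r, a = r * f) (a \in principal).
Proof. exact: asboolP. Qed.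

Lemma principal_zmod_closed : zmod_closed principal.
Proof.
split=> [|a b /principalP[r ->] /principalP[s ->]]; apply/principalP.
  by exists 0; rewrite mul0r.
by exists (r - s); rewrite mulrBl.
Qed.

HB.instance Definition _ :=
  GRing.isZmodClosed.Build A principal principal_zmod_closed.

Lemma principalMl a b : b \in principal -> a * b \in principal.
Proof.
by case/principalP=> r ->; apply/principalP; exists (a * r); rewrite mulrA.
Qed.

Definition pquot := Quotient.quot (principal : zmodClosed A).

HB.instance Definition _ := Choice.on pquot.
HB.instance Definition _ := GRing.Zmodule.on pquot.

Definition pquot_pi (a : A) : pquot := \pi a.

Lemma pquot_piK (x : pquot) : pquot_pi (repr x) = x.
Proof. exact: reprK. Qed.

Lemma pquot_piE a b : (pquot_pi a = pquot_pi b) <-> (a - b \in principal).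
Proof.
rewrite /pquot_pi (Quotient.idealrBE (principal : zmodClosed A)).
by split=> [->|/eqP].
Qed.

Lemma pquot_piD a b : pquot_pi (a + b) = pquot_pi a + pquot_pi b.
Proof. exact: Quotient.pi_add. Qed.

Definition pquot_one : pquot := pquot_pi 1.
Definition pquot_mul (x y : pquot) : pquot := pquot_pi (repr x * repr y).
Definition pquot_scale (a : A) (x : pquot) : pquot := pquot_pi (a * repr x).

Lemma pquot_scaleE a b : pquot_scale a (pquot_pi b) = pquot_pi (a * b).
Proof.
by apply/pquot_piE; rewrite -mulrBr principalMl//; apply/pquot_piE/pquot_piK.
Qed.

Lemma pquot_mulE a b :
  pquot_mul (pquot_pi a) (pquot_pi b) = pquot_pi (a * b).
Proof.
rewrite [LHS]pquot_scaleE mulrC -[LHS]pquot_scaleE pquot_piK.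
by rewrite pquot_scaleE mulrC.
Qed.

Lemma pquot_mulA : associative pquot_mul.
Proof.
move=> x y z; rewrite -[x]pquot_piK -[y]pquot_piK -[z]pquot_piK.
by rewrite !pquot_mulE mulrA.
Qed.

Lemma pquot_mulC : commutative pquot_mul.
Proof. by move=> x y; rewrite /pquot_mul mulrC. Qed.

Lemma pquot_mul1 : left_id pquot_one pquot_mul.
Proof. by move=> x; rewrite -[x]pquot_piK pquot_mulE mul1r. Qed.

Lemma pquot_mulDl : left_distributive pquot_mul +%R.
Proof.
move=> x y z; rewrite -[x]pquot_piK -[y]pquot_piK -[z]pquot_piK.
by rewrite -pquot_piD !pquot_mulE mulrDl pquot_piD.
Qed.

HB.instance Definition _ := GRing.Zmodule_isComPzRing.Build pquot
  pquot_mulA pquot_mulC pquot_mul1 pquot_mulDl.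

Lemma pquot_scaleA a b x :
  pquot_scale a (pquot_scale b x) = pquot_scale (a * b) x.
Proof. by rewrite -[x]pquot_piK !pquot_scaleE mulrA. Qed.

Lemma pquot_scale1 : left_id 1 pquot_scale.
Proof. by move=> x; rewrite -[x]pquot_piK pquot_scaleE mul1r. Qed.

Lemma pquot_scaleDr : right_distributive pquot_scale +%R.
Proof.
move=> a x y; rewrite -[x]pquot_piK -[y]pquot_piK.
by rewrite -pquot_piD !pquot_scaleE mulrDr pquot_piD.
Qed.

Lemma pquot_scaleDl x : {morph pquot_scale^~ x : a b / a + b}.
Proof.
by move=> a b; rewrite -[x]pquot_piK !pquot_scaleE mulrDl pquot_piD.
Qed.

HB.instance Definition _ := GRing.Zmodule_isLmodule.Build A pquot
  pquot_scaleA pquot_scale1 pquot_scaleDr pquot_scaleDl.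

End PrincipalQuotient.

Section DirectSum.
Variables (A : pzRingType) (I : finType) (N : I -> lmodType A).

(* The index set is finite, so the direct sum is the full product. *)
Definition dirsum := {dffun forall i, N i}.
HB.instance Definition _ := Choice.on dirsum.

Implicit Types u v w : dirsum.

Definition dirsum_zero : dirsum := [ffun i => 0 : N i].
Definition dirsum_opp u : dirsum := [ffun i => - u i : N i].
Definition dirsum_add u v : dirsum := [ffun i => u i + v i : N i].
Definition dirsum_scale a u : dirsum := [ffun i => a *: u i : N i].

Lemma dirsum_addA : associative dirsum_add.
Proof. by move=> u v w; apply/ffunP=> i; rewrite !ffunE addrA. Qed.

Lemma dirsum_addC : commutative dirsum_add.
Proof. by move=> u v; apply/ffunP=> i; rewrite !ffunE addrC. Qed.

Lemma dirsum_add0 : left_id dirsum_zero dirsum_add.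
Proof. by move=> u; apply/ffunP=> i; rewrite !ffunE add0r. Qed.

Lemma dirsum_addN : left_inverse dirsum_zero dirsum_opp dirsum_add.
Proof. by move=> u; apply/ffunP=> i; rewrite !ffunE addNr. Qed.

HB.instance Definition _ := GRing.isZmodule.Build dirsum
  dirsum_addA dirsum_addC dirsum_add0 dirsum_addN.

Lemma dirsum_scaleA a b u :
  dirsum_scale a (dirsum_scale b u) = dirsum_scale (a * b) u.
Proof. by apply/ffunP=> i; rewrite !ffunE scalerA. Qed.

Lemma dirsum_scale1 : left_id 1 dirsum_scale.
Proof. by move=> u; apply/ffunP=> i; rewrite !ffunE scale1r. Qed.

Lemma dirsum_scaleDr : right_distributive dirsum_scale +%R.
Proof. by move=> a u v; apply/ffunP=> i; rewrite !ffunE scalerDr. Qed.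

Lemma dirsum_scaleDl u : {morph dirsum_scale^~ u : a b / a + b}.
Proof. by move=> a b; apply/ffunP=> i; rewrite !ffunE scalerDl. Qed.

HB.instance Definition _ := GRing.Zmodule_isLmodule.Build A dirsum
  dirsum_scaleA dirsum_scale1 dirsum_scaleDr dirsum_scaleDl.

End DirectSum.

Section EndomorphismRing.
Variables (A : comPzRingType) (N : lmodType A).

Definition End := {linear N -> N}.
HB.instance Definition _ := gen_eqMixin End.
HB.instance Definition _ := gen_choiceMixin End.

Implicit Types f g h : End.

Lemma EndP f g : f =1 g -> f = g.
Proof.
case: f g => [f [[fD] [fZ]]] [g [[gD] [gZ]]] /= /funext fg; subst g.
by rewrite (Prop_irrelevance fD gD) (Prop_irrelevance fZ gZ).
Qed.

Definition End_zero : End := \0.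
Definition End_opp f : End := \- f.
Definition End_add f g : End := f \+ g.
Definition End_one : End := idfun.
Definition End_mul f g : End := f \o g.

Lemma End_addA : associative End_add.
Proof. by move=> f g h; apply: EndP => x /=; rewrite addrA. Qed.

Lemma End_addC : commutative End_add.
Proof. by move=> f g; apply: EndP => x /=; rewrite addrC. Qed.

Lemma End_add0 : left_id End_zero End_add.
Proof. by move=> f; apply: EndP => x /=; rewrite add0r. Qed.

Lemma End_addN : left_inverse End_zero End_opp End_add.
Proof. by move=> f; apply: EndP => x /=; rewrite addNr. Qed.

HB.instance Definition _ := GRing.isZmodule.Build End
  End_addA End_addC End_add0 End_addN.

Lemma End_mulA : associative End_mul.
Proof. by move=> f g h; apply: EndP. Qed.

Lemma End_mul1 : left_id End_one End_mul.
Proof. by move=> f; apply: EndP. Qed.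

Lemma End_mulr1 : right_id End_one End_mul.
Proof. by move=> f; apply: EndP. Qed.

Lemma End_mulDl : left_distributive End_mul +%R.
Proof. by move=> f g h; apply: EndP. Qed.

Lemma End_mulDr : right_distributive End_mul +%R.
Proof. by move=> f g h; apply: EndP => x /=; rewrite raddfD. Qed.

HB.instance Definition _ := GRing.Zmodule_isPzRing.Build End
  End_mulA End_mul1 End_mulr1 End_mulDl End_mulDr.

End EndomorphismRing.

Section GlobalDimension.
Variable A : pzRingType.

Definition projective (P : lmodType A) : Prop :=
  forall (X Y : lmodType A) (g : {linear X -> Y}) (f : {linear P -> Y}),
    (forall y, exists x, g x = y) ->
    exists h : {linear P -> X}, forall p, g (h p) = f p.

(* There is a projective resolution 0 -> P_d -> ... -> P_0 -> V -> 0. *)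
Definition pd_le (V : lmodType A) (d : nat) : Prop :=
  exists (P : nat -> lmodType A)
         (del : forall i, {linear P i.+1 -> P i})
         (eps : {linear P 0 -> V}),
    [/\ forall i, projective (P i),
        forall i, (d < i)%N -> forall x : P i, x = 0,
        forall v, exists x, eps x = v,
        forall x, eps x = 0 <-> exists y, del 0 y = x
      & forall i (x : P i.+1), del i x = 0 <-> exists y, del i.+1 y = x].

(* Left global dimension; for a two-sided noetherian ring it agrees with the
   right one. *)
Definition gldim_le (d : nat) : Prop := forall V : lmodType A, pd_le V d.

Definition gldim_eq (d : nat) : Prop :=
  gldim_le d /\ forall e, gldim_le e -> (d <= e)%N.

End GlobalDimension.

Section NoncommutativeResolution.
Variable A : comPzRingType.

Definition prime_ideal (p : A -> Prop) : Prop :=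
  [/\ p 0, forall a b, p a -> p b -> p (a + b), forall a b, p b -> p (a * b),
      ~ p 1 & forall a b, p (a * b) -> p a \/ p b].

(* Equality of the fractions x.1 / x.2 and y.1 / y.2 in the localization N_p,
   for denominators outside p. *)
Definition frac_eq (N : lmodType A) (p : A -> Prop) (x y : N * A) : Prop :=
  exists u, ~ p u /\ u *: (y.2 *: x.1 - x.2 *: y.1) = 0.

Definition supp (N : lmodType A) (p : A -> Prop) : Prop :=
  prime_ideal p /\
  exists (m : N) (s : A), ~ p s /\ ~ frac_eq p (m, s) (0, 1).

Definition fin_gen (N : lmodType A) : Prop :=
  exists (r : nat) (g : 'I_r -> N),
    forall x, exists c : 'I_r -> A, x = \sum_(i < r) c i *: g i.

Definition is_NCR (N : lmodType A) : Prop :=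
  [/\ fin_gen N, forall p, supp N p <-> supp A^o p
    & exists d, gldim_le (End N) d].

End NoncommutativeResolution.

Section NormalCrossing.
Variables (k : fieldType) (n : nat).

Definition ncR : comPzRingType :=
  pquot (\prod_(i < n) 'X_i : {mpoly k[n]}).

Definition ncx (i : 'I_n) : ncR := pquot_pi _ 'X_i.

Definition ncN (I : {set 'I_n}) : lmodType ncR :=
  pquot (\prod_(i in I) ncx i).

(* For n = 1 this is 0 (+) k, whose endomorphism ring k has global dimension 0,
   and leaving out the summand [set: 'I_1] gives 0; hence the main statement
   assumes 1 < n. *)
Definition ncM : lmodType ncR := dirsum ncN.

Definition ncM' (K : {set 'I_n}) : lmodType ncR :=
  dirsum (fun I : {I : {set 'I_n} | I != K} => ncN (val I)).

End NormalCrossing.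

(* Main.v *)
(* Write x_i = a_i^2 and give a_i the degree {i}.  A left End(M)-module is then
   a k[a_1, ..., a_n]-module X graded by the subsets of [n] (the summand of M
   with annihilator generated by x_I accounts for the degree I), subject to the
   condition that the degree set0 part vanishes.  Graded modules have
   projective resolutions of length n, built from the sequences
   0 -> k[t] (x) X -> k[t] (x) X -> X -> 0 with t of degree {i}, the first map
   being t - a_i up to a shift.  Killing what is generated in degree set0 keeps
   a short exact sequence exact when the products of the a_i are injective on
   the degree set0 part of its last term; hence the upper bound n.  The simple
   module of degree {i} has a minimal (Koszul) resolution of length n, and a
   splitting of its last map would contradict minimality.
   For M', the ring End(M') is a corner e End(M) e; a module is coinduced to
   End(M), resolved there in length n, and cut down by e.  Only the projective
   of degree K can fail to stay projective.  Starting from k in degree K, which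
   e kills, it is obtained by adjoining the variables one at a time: k[t] (x) Y
   is an extension of Y by a copy of k[t] (x) Y generated in a degree that
   differs from K at i, and the Koszul resolution of that copy in the remaining
   variables never returns to K.  This gives projective dimension at most
   n - 1, and 2n - 1 in total. *)

(* For i not in I, multiplication by x_i and the projection between R/(x_I) and R/(x_i x_I) compose
   to x_i in both orders; this is the origin of x_i = a_i^2. Every map R/(x_J) -> R/(x_I) is a
   multiple of a product of such maps, and the only relations beyond commutativity come from
   factoring through the zero summand R/(1); hence the condition on degree set0. The obstacle is
   that killing what degree set0 generates is only right exact. Resolutions of reduced modules
   survive, because each syzygy lies in a projective, where the a_i are injective. For M' the same
   obstacle dictates the order of the variables: if K is nonempty, some n0 in K is adjoined last, so
   every object that has to be resolved lives in degrees containing n0, and degree set0 does not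
   occur. If K is empty, the omitted summand is zero. A general projective is only a retract of the
   free objects treated this way. Closure of projective dimension under retracts is therefore
   needed, and it rests on enough projectives over the corner. *)
From HB Require Import structures.
From mathcomp Require Import boolp classical_sets functions.
From mathcomp Require Import all_boot all_algebra.
From mathcomp.multinomials Require Import ssrcomplements mpoly.
Require Import Defs.

Set Implicit Arguments.
Unset Strict Implicit.
Unset Printing Implicit Defensive.

Import GRing.Theory.
Local Open Scope ring_scope.
Local Open Scope quotient_scope.

(** * Projective dimension in a concrete abelian category *)

(* Homs are predicates on the underlying functions.  The same arguments are
   used for modules over a ring and for graded representations, which are not
   literally modules over a ring here. *)
Record concat := Concat {
  ob : Type;
  car :> ob -> zmodType;
  hom : forall X Y : ob, (car X -> car Y) -> Prop;
  homD : forall X Y (f : car X -> car Y), hom f -> forall x y, f (x + y) = f x + f y;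
  hom_id : forall X, @hom X X id;
  hom_comp : forall X Y Z (f : car X -> car Y) (g : car Y -> car Z),
    hom f -> hom g -> @hom X Z (g \o f);
  hom_add : forall X Y (f g : car X -> car Y),
    hom f -> hom g -> @hom X Y (fun x => f x + g x);
  hom_opp : forall X Y (f : car X -> car Y), hom f -> @hom X Y (fun x => - f x);
  hom_cancel : forall X Y Z (f : car X -> car Y) (g : car Y -> car Z),
    hom g -> injective g -> @hom X Z (g \o f) -> hom f;
  hom_cancelr : forall X Y Z (f : car X -> car Y) (g : car Y -> car Z),
    hom f -> (forall y, exists x, f x = y) -> @hom X Z (g \o f) -> hom g;
  kernel_ex : forall X Y (f : car X -> car Y), hom f ->
    exists (K : ob) (i : car K -> car X),
      [/\ hom i, injective i & forall x, f x = 0 <-> exists z, i z = x];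
  biprod_ex : forall X Y : ob, exists (S : ob)
    (i1 : car X -> car S) (i2 : car Y -> car S)
    (p1 : car S -> car X) (p2 : car S -> car Y),
    [/\ hom i1, hom i2, hom p1 & hom p2] /\
    [/\ cancel i1 p1, cancel i2 p2, forall y, p1 (i2 y) = 0,
        forall x, p2 (i1 x) = 0 & forall s, i1 (p1 s) + i2 (p2 s) = s]
}.

Section ProjectiveDimension.
Variable C : concat.
Implicit Types X Y Z P K A B : ob C.

Definition surj (T U : Type) (f : T -> U) := forall y, exists x, f x = y.

Definition proj P := forall X Y (g : C X -> C Y) (f : C P -> C Y),
  hom g -> hom f -> surj g -> exists h : C P -> C X, hom h /\ forall p, g (h p) = f p.

Record ses K P X (i : C K -> C P) (p : C P -> C X) : Prop := Ses {
  ses_homl : hom i;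
  ses_homr : hom p;
  ses_inj : injective i;
  ses_surj : surj p;
  ses_ker : forall x, p x = 0 <-> exists z, i z = x }.

(** Some first syzygy is asked for, not every one; that any projective presentation will do is
    [PD_syzygy], which needs enough projectives. *)
Fixpoint PD d X : Prop :=
  if d is d'.+1 then
    exists K P (i : C K -> C P) (p : C P -> C X), [/\ ses i p, proj P & PD d' K]
  else proj X.

Lemma hom0 X Y (f : C X -> C Y) : hom f -> f 0 = 0.
Proof. by move=> hf; apply: (addrI (f 0)); rewrite -(homD hf) !addr0. Qed.

Lemma homN X Y (f : C X -> C Y) : hom f -> forall x, f (- x) = - f x.
Proof.
by move=> hf x; apply: (addrI (f x)); rewrite -(homD hf) !subrr (hom0 hf).
Qed.

Lemma homB X Y (f : C X -> C Y) : hom f -> forall x y, f (x - y) = f x - f y.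
Proof. by move=> hf x y; rewrite (homD hf) (homN hf). Qed.

Lemma hom_inj X Y (f : C X -> C Y) :
  hom f -> (forall x, f x = 0 -> x = 0) -> injective f.
Proof.
move=> hf f0 x y e; apply: subr0_eq; apply: f0.
by rewrite (homB hf) e subrr.
Qed.

(** Preimages under [i] are picked by choice; injectivity of [i] and [hom_cancel] turn the resulting
    function into a hom. *)
Lemma hom_factor X Y Z (f : C Z -> C Y) (i : C X -> C Y) :
  hom f -> hom i -> injective i -> (forall z, exists x, i x = f z) ->
  exists h : C Z -> C X, hom h /\ forall z, i (h z) = f z.
Proof.
move=> hf hi inj_i /choice[h ih]; exists h; split=> //.
by apply: (@hom_cancel C _ _ _ h i) => //; have -> : i \o h = f by apply/funext.
Qed.

Lemma kernel_ses X Y (f : C X -> C Y) :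
  hom f -> surj f -> exists K (i : C K -> C X), ses i f.
Proof. by move=> hf sf; have [K [i [hi inj_i ki]]] := kernel_ex hf; exists K, i. Qed.

Lemma ses0 K P X (i : C K -> C P) (p : C P -> C X) : ses i p -> forall z, p (i z) = 0.
Proof. by move=> s z; apply/(ses_ker s); exists z. Qed.

Lemma proj_retract P X (i : C X -> C P) (r : C P -> C X) :
  proj P -> hom i -> hom r -> cancel i r -> proj X.
Proof.
move=> pP hi hr ri Y Z g f hg hf sg.
have [h [hh gh]] := pP _ _ g (f \o r) hg (hom_comp hr hf) sg.
exists (h \o i); split; first exact: hom_comp.
by move=> x /=; rewrite gh /= ri.
Qed.

Lemma proj_section P X (p : C X -> C P) :
  proj P -> hom p -> surj p -> exists s : C P -> C X, hom s /\ cancel s p.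
Proof. by move=> pP hp sp; apply: (pP X P p id) => //; exact: hom_id. Qed.

Lemma proj_ext A B P (i : C A -> C B) (p : C B -> C P) :
  ses i p -> proj A -> proj P -> proj B.
Proof.
move=> s pA pP Z Y g f hg hf sg.
have [t [ht pt]] := proj_section pP (ses_homr s) (ses_surj s).
have hq : hom (fun b => b - t (p b)).
  by apply: hom_add; [exact: hom_id|apply: hom_opp; exact: hom_comp (ses_homr s) ht].
have [r [hr ir]] : exists r : C B -> C A, hom r /\ forall b, i (r b) = b - t (p b).
  apply: hom_factor hq (ses_homl s) (ses_inj s) _ => b.
  by apply/(ses_ker s); rewrite (homB (ses_homr s)) pt subrr.
have [h1 [hh1 e1]] := pA _ _ g (f \o i) hg (hom_comp (ses_homl s) hf) sg.
have [h2 [hh2 e2]] := pP _ _ g (f \o t) hg (hom_comp ht hf) sg.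
exists (fun b => h1 (r b) + h2 (p b)); split.
  by apply: hom_add; [exact: hom_comp hr hh1|exact: hom_comp (ses_homr s) hh2].
move=> b; rewrite (homD hg) e1 e2 /= ir -(homD hf).
by rewrite subrK.
Qed.

Lemma proj_biprod A B : proj A -> proj B ->
  exists (S : ob C) (i1 : C A -> C S) (i2 : C B -> C S) (p1 : C S -> C A) (p2 : C S -> C B),
    [/\ [/\ hom i1, hom i2, hom p1 & hom p2],
    [/\ cancel i1 p1, cancel i2 p2, forall y, p1 (i2 y) = 0,
        forall x, p2 (i1 x) = 0 & forall s, i1 (p1 s) + i2 (p2 s) = s] & proj S].
Proof.
move=> pA pB; have [S [i1 [i2 [p1 [p2 [[h1 h2 h3 h4] [c1 c2 e1 e2 es]]]]]]] := biprod_ex A B.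
exists S, i1, i2, p1, p2; split=> //; apply: (@proj_ext _ _ _ i1 p2) => //; split=> //.
- exact: can_inj c1.
- by move=> y; exists (i2 y).
move=> x; split=> [x0|[z <-]//].
by exists (p1 x); rewrite -[RHS]es x0 (hom0 h2) addr0.
Qed.

Lemma zero_ob X : exists K, forall x : C K, x = 0.
Proof.
have [K [i [hi inj_i ki]]] := kernel_ex (hom_id X); exists K => x; apply: inj_i.
by rewrite (hom0 hi); apply/ki; exists x.
Qed.

Lemma hom_zero X Y : @hom C X Y (fun=> 0).
Proof.
have [K [i1 [i2 [p1 [p2 [[h1 h2 h3 h4] [_ _ e1 _ _]]]]]]] := biprod_ex Y X.
by have -> : (fun=> 0) = p1 \o i2; [apply/funext=> x /=; rewrite e1|exact: hom_comp].
Qed.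

Lemma proj_zero P : (forall x : C P, x = 0) -> proj P.
Proof.
move=> P0 X Y g f hg hf sg; exists (fun=> 0); split; first exact: hom_zero.
by move=> p; rewrite (P0 p) (hom0 hg) (hom0 hf).
Qed.

Lemma PD_S d X : PD d X -> PD d.+1 X.
Proof.
elim: d X => [|d IH] X /= => [pX|[K [P [i [p [s pP /IH dK]]]]]]; last by exists K, P, i, p.
have [K K0] := zero_ob X; exists K, X, (fun=> 0), id; split=> //; last exact: proj_zero.
split=> //; [exact: hom_zero|exact: hom_id| | |].
- by move=> x y _; rewrite (K0 x) (K0 y).
- by move=> y; exists y.
by move=> x; split=> [->|[]//]; exists 0.
Qed.

Lemma PD_leq d e X : (d <= e)%N -> PD d X -> PD e X.
Proof. by move=> /subnK<-; elim: (e - d)%N => // m IH /IH; rewrite addSn => /PD_S. Qed.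

Lemma PD_iso d X Y (f : C X -> C Y) (g : C Y -> C X) :
  hom f -> hom g -> cancel f g -> cancel g f -> PD d X -> PD d Y.
Proof.
case: d => [|d] hf hg fg gf /=; first by move=> pX; apply: proj_retract pX hg hf gf.
move=> [K [P [i [p [s pP dK]]]]]; exists K, P, i, (f \o p); split=> //.
split; [exact: ses_homl s|exact: hom_comp (ses_homr s) hf|exact: ses_inj s| |].
  by move=> y; have [x ex] := ses_surj s (g y); exists x; rewrite /= ex gf.
move=> x /=; rewrite -(ses_ker s); split=> [e|->]; last exact: hom0.
by rewrite -(fg (p x)) e (hom0 hg).
Qed.

(** Horseshoe lemma: projectives over A and X add up to one over B, and its kernel is an extension
    of the two kernels. *)
Lemma PD_ext d A B X (i : C A -> C B) (p : C B -> C X) :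
  ses i p -> PD d A -> PD d X -> PD d B.
Proof.
elim: d A B X i p => [|d IH] A B X i p s /=; first exact: proj_ext s.
move=> [KA [PA [iA [pA [sA pPA dA]]]]] [KX [PX [iX [pX [sX pPX dX]]]]].
have [l [hl pl]] := pPX _ _ p pX (ses_homr s) (ses_homr sX) (ses_surj s).
have [S [i1 [i2 [p1 [p2 [[h1 h2 h3 h4] [c1 c2 e1 e2 es] pS]]]]]] := proj_biprod pPA pPX.
pose q u := i (pA (p1 u)) + l (p2 u).
have hq : hom q.
  apply: hom_add; last exact: hom_comp h4 hl.
  exact: hom_comp h3 (hom_comp (ses_homr sA) (ses_homl s)).
have pq u : p (q u) = pX (p2 u).
  by rewrite /q (homD (ses_homr s)) (ses0 s) add0r pl.
have sq : surj q.
  move=> b; have [x ex] := ses_surj sX (p b).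
  have : p (b - l x) = 0 by rewrite (homB (ses_homr s)) pl ex subrr.
  move=> /(ses_ker s)[a ea]; have [y ey] := ses_surj sA a.
  exists (i1 y + i2 x); rewrite /q (homD h3) (homD h4) c1 c2 e1 e2 addr0 add0r ey ea.
  by rewrite subrK.
have [E [j sE]] := kernel_ses hq sq.
exists E, S, j, q; split=> //.
have [u [hu ju]] : exists u : C KA -> C E, hom u /\ forall z, j (u z) = i1 (iA z).
  apply: hom_factor (hom_comp (ses_homl sA) h1) (ses_homl sE) (ses_inj sE) _ => z.
  apply/(ses_ker sE); rewrite /q /= c1 e2 (ses0 sA) (hom0 hl) (hom0 (ses_homl s)).
  by rewrite addr0.
have [v [hv jv]] : exists v : C E -> C KX, hom v /\ forall z, iX (v z) = p2 (j z).
  apply: hom_factor (hom_comp (ses_homl sE) h4) (ses_homl sX) (ses_inj sX) _ => z.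
  by apply/(ses_ker sX); rewrite -pq /= (ses0 sE) (hom0 (ses_homr s)).
apply: (IH _ _ _ u v) => //; split=> //.
- by move=> x y e; apply: (ses_inj sA); apply: (can_inj c1); rewrite -!ju e.
- move=> z; have : p (l (iX z)) = 0 by rewrite pl (ses0 sX).
  move=> /(ses_ker s)[a ea]; have [y ey] := ses_surj sA a.
  have : q (i1 (- y) + i2 (iX z)) = 0.
    rewrite /q (homD h3) (homD h4) c1 c2 e1 e2 addr0 add0r.
    by rewrite (homN (ses_homr sA)) (homN (ses_homl s)) ey ea addNr.
  move=> /(ses_ker sE)[w ew]; exists w; apply: (ses_inj sX).
  by rewrite jv ew (homD h4) e2 c2 add0r.
move=> x; split=> [vx|[z <-]]; last first.
  by apply: (ses_inj sX); rewrite jv ju e2 (hom0 (ses_homl sX)).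
have p20 : p2 (j x) = 0 by rewrite -jv vx (hom0 (ses_homl sX)).
have : pA (p1 (j x)) = 0.
  apply: (ses_inj s); rewrite (hom0 (ses_homl s)).
  by have := ses0 sE x; rewrite /q p20 (hom0 hl) addr0.
move=> /(ses_ker sA)[z ez]; exists z; apply: (ses_inj sE).
by rewrite ju ez -[RHS]es p20 (hom0 h2) addr0.
Qed.

(** Compose a projective presentation of B with [p]: the kernel E is an extension of A by the syzygy
    of B, so [PD_ext] applies to E. *)
Lemma PD_coker d A B X (i : C A -> C B) (p : C B -> C X) :
  ses i p -> PD d A -> PD d.+1 B -> PD d.+1 X.
Proof.
move=> s dA [L [P [j [q [sq pP dL]]]]].
have hpq : hom (p \o q) by exact: hom_comp (ses_homr sq) (ses_homr s).
have spq : surj (p \o q).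
  move=> x; have [b eb] := ses_surj s x; have [y ey] := ses_surj sq b.
  by exists y; rewrite /= ey.
have [E [e sE]] := kernel_ses hpq spq.
exists E, P, e, (p \o q); split=> //.
have [u [hu ju]] : exists u : C L -> C E, hom u /\ forall z, e (u z) = j z.
  apply: hom_factor (ses_homl sq) (ses_homl sE) (ses_inj sE) _ => z.
  by apply/(ses_ker sE); rewrite /= (ses0 sq) (hom0 (ses_homr s)).
have [v [hv jv]] : exists v : C E -> C A, hom v /\ forall z, i (v z) = q (e z).
  apply: hom_factor (hom_comp (ses_homl sE) (ses_homr sq)) (ses_homl s) (ses_inj s) _.
  by move=> z; apply/(ses_ker s); exact: (ses0 sE).
apply: (PD_ext (i := u) (p := v)) => //; split=> //.
- by move=> x y euv; apply: (ses_inj sq); rewrite -!ju euv.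
- move=> a; have [y ey] := ses_surj sq (i a).
  have : (p \o q) y = 0 by rewrite /= ey (ses0 s).
  by move=> /(ses_ker sE)[w ew]; exists w; apply: (ses_inj s); rewrite jv ew.
move=> x; split=> [vx|[z <-]].
  have : q (e x) = 0 by rewrite -jv vx (hom0 (ses_homl s)).
  by move=> /(ses_ker sq)[z ez]; exists z; apply: (ses_inj sE); rewrite ju.
by apply: (ses_inj s); rewrite jv ju (ses0 sq) (hom0 (ses_homl s)).
Qed.

Section EnoughProjectives.
Hypothesis enough : forall X, exists P (p : C P -> C X), [/\ proj P, hom p & surj p].

(** Two statements feed each other: independence of the syzygy in dimension d uses retracts in
    dimension d, and retracts in dimension d + 1 use that independence. *)
Let retract d := forall A X (i : C A -> C X) (r : C X -> C A),
  hom i -> hom r -> cancel i r -> PD d X -> PD d A.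

(* Schanuel's argument: both kernels are related to the fibre product. *)
Let retract_syzygy d : retract d -> forall K P X (i : C K -> C P) (p : C P -> C X),
  ses i p -> proj P -> PD d.+1 X -> PD d K.
Proof.
move=> Rd K P X i p s pP [K' [P' [i' [p' [s' pP' dK']]]]].
have [S [i1 [i2 [p1 [p2 [[h1 h2 h3 h4] [c1 c2 e1 e2 es]]]]]]] := biprod_ex P P'.
have hq : hom (fun u => p (p1 u) - p' (p2 u)).
  apply: hom_add; first exact: hom_comp h3 (ses_homr s).
  by apply: hom_opp; exact: hom_comp h4 (ses_homr s').
have [E [j [hj inj_j kj]]] := kernel_ex hq.
have qj z : p (p1 (j z)) = p' (p2 (j z)) by apply/subr0_eq/kj; exists z.
(* The fibre product E maps onto P with kernel K', so it is an extension of a projective by K'. *)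
have dE : PD d E.
  have [u [hu ju]] : exists u : C K' -> C E, hom u /\ forall z, j (u z) = i2 (i' z).
    apply: hom_factor (hom_comp (ses_homl s') h2) hj inj_j _ => z; apply/kj => /=.
    by rewrite e1 c2 (ses0 s') (hom0 (ses_homr s)) subrr.
  apply: (PD_ext (i := u) (p := p1 \o j)) dK' _; last exact: (@PD_leq 0 d).
  split=> //; first exact: hom_comp hj h3.
  - by move=> x y e; apply: (ses_inj s'); apply: (can_inj c2); rewrite -!ju e.
  - move=> x; have [y ey] := ses_surj s' (p x).
    have /kj[z ez] : p (p1 (i1 x + i2 y)) - p' (p2 (i1 x + i2 y)) = 0.
      by rewrite (homD h3) (homD h4) c1 c2 e1 e2 addr0 add0r ey subrr.
    by exists z; rewrite /= ez (homD h3) c1 e1 addr0.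
  move=> x; split=> [/= ux|[z <-] /=]; last by rewrite ju e1.
  have /(ses_ker s')[z ez] : p' (p2 (j x)) = 0 by rewrite -qj ux (hom0 (ses_homr s)).
  by exists z; apply: inj_j; rewrite ju ez -[RHS]es ux (hom0 h1) add0r.
(* E also maps onto the projective P', with kernel K; the section [t] makes K a retract of E. *)
have [t [ht t2]] : exists t : C P' -> C E, hom t /\ cancel t (p2 \o j).
  apply: proj_section pP' (hom_comp hj h4) _ => y.
  have [x ex] := ses_surj s (p' y).
  have /kj[z ez] : p (p1 (i1 x + i2 y)) - p' (p2 (i1 x + i2 y)) = 0.
    by rewrite (homD h3) (homD h4) c1 c2 e1 e2 addr0 add0r ex subrr.
  by exists z; rewrite /= ez (homD h4) c2 e2 add0r.
have [u [hu ju]] : exists u : C K -> C E, hom u /\ forall z, j (u z) = i1 (i z).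
  apply: hom_factor (hom_comp (ses_homl s) h1) hj inj_j _ => z; apply/kj => /=.
  by rewrite e2 c1 (ses0 s) (hom0 (ses_homr s')) subrr.
have hw : hom (fun z => p1 (j (z - t (p2 (j z))))).
  apply: (hom_comp (g := p1 \o j)); last exact: hom_comp hj h3.
  apply: hom_add; first exact: hom_id.
  by apply: hom_opp; exact: hom_comp (hom_comp hj h4) ht.
have [r [hr ir]] : exists r : C E -> C K, hom r /\
    forall z, i (r z) = p1 (j (z - t (p2 (j z)))).
  apply: hom_factor hw (ses_homl s) (ses_inj s) _ => z; apply/(ses_ker s).
  rewrite qj (homB hj) (homB h4); move: (t2 (p2 (j z))) => /= ->.
  by rewrite subrr (hom0 (ses_homr s')).
apply: Rd hu hr _ dE => z; apply: (ses_inj s); rewrite ir ju e2.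
by rewrite (hom0 ht) subr0 ju c1.
Qed.

(** With B the kernel of [r], the sum of projectives over A and B covers X; the syzygy of A is then
    a retract of the syzygy of X, one dimension lower. *)
Lemma PD_retract d A X (i : C A -> C X) (r : C X -> C A) :
  hom i -> hom r -> cancel i r -> PD d X -> PD d A.
Proof.
elim: d A X i r => [|d IH] A X i r hi hr ri dX; first exact: proj_retract dX hi hr ri.
have [B [b [hb inj_b kb]]] := kernel_ex hr.
have [Q [q [pQ hq sq]]] := enough A; have [Q' [q' [pQ' hq' sq']]] := enough B.
have [S [i1 [i2 [p1 [p2 [[h1 h2 h3 h4] [c1 c2 e1 e2 es] pS]]]]]] := proj_biprod pQ pQ'.
pose m u := i (q (p1 u)) + b (q' (p2 u)).
have hm : hom m.
  by apply: hom_add; [exact: hom_comp h3 (hom_comp hq hi)|exact: hom_comp h4 (hom_comp hq' hb)].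
have rb z : r (b z) = 0 by apply/kb; exists z.
have sm : surj m.
  move=> x; have /kb[z ez] : r (x - i (r x)) = 0 by rewrite (homB hr) ri subrr.
  have [y ey] := sq (r x); have [y' ey'] := sq' z; exists (i1 y + i2 y').
  by rewrite /m (homD h3) (homD h4) c1 c2 e1 e2 addr0 add0r ey ey' ez addrC subrK.
have [E [e sE]] := kernel_ses hm sm.
have dE : PD d E by apply: retract_syzygy sE pS dX.
have [L [l sL]] := kernel_ses hq sq; exists L, Q, l, q; split=> //.
have [u [hu ju]] : exists u : C L -> C E, hom u /\ forall z, e (u z) = i1 (l z).
  apply: hom_factor (hom_comp (ses_homl sL) h1) (ses_homl sE) (ses_inj sE) _ => z.
  apply/(ses_ker sE); rewrite /m /= c1 e2 (ses0 sL) (hom0 hi) (hom0 hq') (hom0 hb).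
  by rewrite addr0.
have [v [hv jv]] : exists v : C E -> C L, hom v /\ forall z, l (v z) = p1 (e z).
  apply: hom_factor (hom_comp (ses_homl sE) h3) (ses_homl sL) (ses_inj sL) _ => z.
  apply/(ses_ker sL); have := congr1 r (ses0 sE z).
  by rewrite /m (homD hr) ri rb addr0 (hom0 hr).
apply: IH hu hv _ dE => z; apply: (ses_inj sL).
by rewrite jv ju c1.
Qed.

Lemma PD_syzygy d K P X (i : C K -> C P) (p : C P -> C X) :
  ses i p -> proj P -> PD d.+1 X -> PD d K.
Proof. exact/retract_syzygy/PD_retract. Qed.

End EnoughProjectives.
End ProjectiveDimension.

(** * Submodules, quotients and the category of modules *)

Section Submodule.
Variables (A : pzRingType) (X : lmodType A).

Record subm := Subm {
  subm_mem :> X -> Prop;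
  subm0 : subm_mem 0;
  submL : forall a x y, subm_mem x -> subm_mem y -> subm_mem (a *: x + y) }.

Variable N : subm.

Lemma submD x y : N x -> N y -> N (x + y).
Proof. by move=> Nx Ny; rewrite -[x]scale1r; apply: submL. Qed.

Lemma submZ a x : N x -> N (a *: x).
Proof. by move=> Nx; rewrite -[_ *: _]addr0; apply: submL => //; apply: subm0. Qed.

Lemma submN x : N x -> N (- x).
Proof. by rewrite -scaleN1r; apply: submZ. Qed.

Lemma submB x y : N x -> N y -> N (x - y).
Proof. by move=> Nx Ny; apply: submD => //; apply: submN. Qed.

Lemma subm_sum (I : Type) (r : seq I) (P : pred I) (F : I -> X) :
  (forall i, P i -> N (F i)) -> N (\sum_(i <- r | P i) F i).
Proof. by move=> NF; apply: big_ind => //; [apply: subm0|apply: submD]. Qed.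

Definition smem : {pred X} := fun x => `[< N x >].

Lemma smemP x : reflect (N x) (x \in smem).
Proof. exact: asboolP. Qed.

Lemma smem_closed : submod_closed smem.
Proof.
split; first by apply/smemP/subm0.
by move=> a x y /smemP Nx /smemP Ny; apply/smemP/submL.
Qed.

HB.instance Definition _ := GRing.isSubmodClosed.Build A X smem smem_closed.

Record smod := SMod { smval : X; smvalP : smval \in smem }.
HB.instance Definition _ := [isSub for smval].
HB.instance Definition _ := [Choice of smod by <:].
HB.instance Definition _ := [SubChoice_isSubLmodule of smod by <:].

Definition smk x (Nx : N x) : smod := SMod (introT (smemP x) Nx).

Lemma smval_mem (z : smod) : N (smval z).
Proof. exact/smemP/smvalP. Qed.

Lemma smval_inj : injective smval.
Proof. exact: val_inj. Qed.

Lemma smvalL a x y : smval (a *: x + y) = a *: smval x + smval y.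
Proof. by []. Qed.

Definition lquot := Quotient.quot (smem : zmodClosed X).
HB.instance Definition _ := Choice.on lquot.
HB.instance Definition _ := GRing.Zmodule.on lquot.

Definition lpi (x : X) : lquot := \pi x.

Lemma lpiK (q : lquot) : lpi (repr q) = q.
Proof. exact: reprK. Qed.

Lemma lpiE x y : lpi x = lpi y <-> N (x - y).
Proof.
rewrite /lpi; split=> [/eqP|Nxy]; last apply/eqP;
  rewrite -(Quotient.idealrBE (smem : zmodClosed X)).
  by move=> ?; apply/smemP.
exact/smemP.
Qed.

Lemma lpiD x y : lpi (x + y) = lpi x + lpi y.
Proof. exact: Quotient.pi_add. Qed.

Definition lquot_scale a (q : lquot) : lquot := lpi (a *: repr q).

Lemma lquot_scaleE a x : lquot_scale a (lpi x) = lpi (a *: x).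
Proof. by apply/lpiE; rewrite -scalerBr; apply/submZ/lpiE/lpiK. Qed.

Lemma lquot_scaleA a b q : lquot_scale a (lquot_scale b q) = lquot_scale (a * b) q.
Proof. by rewrite -[q]lpiK !lquot_scaleE scalerA. Qed.

Lemma lquot_scale1 : left_id 1 lquot_scale.
Proof. by move=> q; rewrite -[q]lpiK lquot_scaleE scale1r. Qed.

Lemma lquot_scaleDr : right_distributive lquot_scale +%R.
Proof.
move=> a p q; rewrite -[p]lpiK -[q]lpiK.
by rewrite -lpiD !lquot_scaleE scalerDr lpiD.
Qed.

Lemma lquot_scaleDl q : {morph lquot_scale^~ q : a b / a + b}.
Proof. by move=> a b; rewrite -[q]lpiK !lquot_scaleE scalerDl lpiD. Qed.

HB.instance Definition _ := GRing.Zmodule_isLmodule.Build A lquot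
  lquot_scaleA lquot_scale1 lquot_scaleDr lquot_scaleDl.

Lemma lpiZ a x : lpi (a *: x) = a *: lpi x.
Proof. by rewrite -[LHS]lquot_scaleE. Qed.

Lemma lpi0 x : lpi x = 0 <-> N x.
Proof. by rewrite -(_ : lpi 0 = 0) ?lpiE ?subr0 //; apply: raddf0. Qed.

End Submodule.

Section RestrictScalars.
Variables (k A : pzRingType) (rho : {rmorphism k -> A}) (X : lmodType A).

(* The dummy argument rho lets canonical structures recover the scalar action. *)
Definition restr : Type := (fun _ : {rmorphism k -> A} => X : Type) rho.
HB.instance Definition _ := GRing.Zmodule.copy restr X.

Definition restr_scale (a : k) (x : restr) : restr := rho a *: (x : X).

Lemma restr_scaleA a b x : restr_scale a (restr_scale b x) = restr_scale (a * b) x.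
Proof. by rewrite /restr_scale scalerA rmorphM. Qed.

Lemma restr_scale1 : left_id 1 restr_scale.
Proof. by move=> x; rewrite /restr_scale rmorph1 scale1r. Qed.

Lemma restr_scaleDr : right_distributive restr_scale +%R.
Proof. by move=> a x y; rewrite /restr_scale scalerDr. Qed.

Lemma restr_scaleDl x : {morph restr_scale^~ x : a b / a + b}.
Proof. by move=> a b; rewrite /restr_scale rmorphD scalerDl. Qed.

HB.instance Definition _ := GRing.Zmodule_isLmodule.Build k restr
  restr_scaleA restr_scale1 restr_scaleDr restr_scaleDl.

End RestrictScalars.

Section LinearMaps.
Variable A : pzRingType.
Implicit Types X Y Z : lmodType A.

Definition islin X Y (f : X -> Y) := forall a x y, f (a *: x + y) = a *: f x + f y.

Section Packed.
Variables (X Y : lmodType A) (f : X -> Y) (hf : islin f).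
Definition lin_fun : X -> Y := f.
Let lin_fun_linear : linear lin_fun. Proof. exact: hf. Qed.
HB.instance Definition _ :=
  GRing.isLinear.Build A X Y *:%R lin_fun lin_fun_linear.
Definition lin_of : {linear X -> Y} := lin_fun.
Lemma lin_ofE x : lin_of x = f x. Proof. by []. Qed.
End Packed.

Lemma islinD X Y (f : X -> Y) : islin f -> forall x y, f (x + y) = f x + f y.
Proof. by move=> hf x y; rewrite -[x in LHS]scale1r hf scale1r. Qed.

Lemma islin0 X Y (f : X -> Y) : islin f -> f 0 = 0.
Proof. by move=> hf; rewrite -(lin_ofE hf) linear0. Qed.

Lemma islinZ X Y (f : X -> Y) : islin f -> forall a x, f (a *: x) = a *: f x.
Proof. by move=> hf a x; rewrite -[a *: x]addr0 hf (islin0 hf) addr0. Qed.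

Lemma islinN X Y (f : X -> Y) : islin f -> forall x, f (- x) = - f x.
Proof. by move=> hf x; rewrite -scaleN1r (islinZ hf) scaleN1r. Qed.

Lemma islinB X Y (f : X -> Y) : islin f -> forall x y, f (x - y) = f x - f y.
Proof. by move=> hf x y; rewrite (islinD hf) (islinN hf). Qed.

Lemma islin_sum X Y (f : X -> Y) : islin f ->
  forall (I : Type) (r : seq I) (P : pred I) F,
    f (\sum_(i <- r | P i) F i) = \sum_(i <- r | P i) f (F i).
Proof. by move=> hf I r P F; rewrite -(lin_ofE hf) linear_sum. Qed.

Lemma islinP X Y (f : {linear X -> Y}) : islin f.
Proof. by move=> a x y; rewrite linearP. Qed.

Lemma islin_id X : @islin X X id.
Proof. by []. Qed.

Lemma islin_comp X Y Z (f : X -> Y) (g : Y -> Z) :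
  islin f -> islin g -> islin (g \o f).
Proof. by move=> hf hg a x y /=; rewrite hf hg. Qed.

Lemma islin_add X Y (f g : X -> Y) :
  islin f -> islin g -> islin (fun x => f x + g x).
Proof. by move=> hf hg a x y /=; rewrite hf hg scalerDr addrACA. Qed.

Lemma islin_opp X Y (f : X -> Y) : islin f -> islin (fun x => - f x).
Proof. by move=> hf a x y /=; rewrite hf opprD scalerN. Qed.

Lemma islin_cancel X Y Z (f : X -> Y) (g : Y -> Z) :
  islin g -> injective g -> islin (g \o f) -> islin f.
Proof. by move=> hg gI hgf a x y; apply: gI; rewrite hg; apply: hgf. Qed.

Lemma islin_cancelr X Y Z (f : X -> Y) (g : Y -> Z) :
  islin f -> (forall y, exists x, f x = y) -> islin (g \o f) -> islin g.
Proof.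
move=> hf fs hgf a x y; have [x' <-] := fs x; have [y' <-] := fs y.
by rewrite -hf; apply: hgf.
Qed.

Definition lker X Y (f : X -> Y) (hf : islin f) : subm X.
Proof.
by exists (fun x => f x = 0); [apply: islin0|move=> a x y ex ey; rewrite hf ex ey scaler0 addr0].
Defined.

Lemma lmod_kernel X Y (f : X -> Y) : islin f ->
  exists (K : lmodType A) (i : K -> X),
    [/\ islin i, injective i & forall x, f x = 0 <-> exists z, i z = x].
Proof.
move=> hf; exists (smod (lker hf)), (@smval _ _ (lker hf)); split=> //; first exact: smval_inj.
move=> x; split=> [fx|[z <-]]; last exact: (smval_mem z).
by exists (@smk _ _ (lker hf) x fx).
Qed.

Lemma lmod_biprod X Y : exists (S : lmodType A)
    (i1 : X -> S) (i2 : Y -> S) (p1 : S -> X) (p2 : S -> Y),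
    [/\ islin i1, islin i2, islin p1 & islin p2] /\
    [/\ cancel i1 p1, cancel i2 p2, forall y, p1 (i2 y) = 0,
        forall x, p2 (i1 x) = 0 & forall s, i1 (p1 s) + i2 (p2 s) = s].
Proof.
exists (X * Y)%type, (fun x => (x, 0)), (fun y => (0, y)), fst, snd; split; split=> //.
- by move=> a x y; congr pair; rewrite /= ?scaler0 ?addr0.
- by move=> a x y; congr pair; rewrite /= ?scaler0 ?addr0.
by case=> x y; congr pair; rewrite ?addr0 ?add0r.
Qed.

Definition lmodcat : concat :=
  @Concat (lmodType A) (fun X => X) islin islinD islin_id islin_comp islin_add islin_opp
    islin_cancel islin_cancelr lmod_kernel lmod_biprod.

Lemma projectiveE X : proj (X : ob lmodcat) <-> projective X.
Proof.
split=> pX Y Z g f => [|hg hf] sg.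
  have [h [hh gh]] := pX Y Z g f (islinP g) (islinP f) sg.
  by exists (lin_of hh).
have [h gh] := pX Y Z (lin_of hg) (lin_of hf) sg.
by exists h; split=> //; apply: islinP.
Qed.

Lemma PD_pd_le d X : PD d (X : ob lmodcat) -> pd_le X d.
Proof.
elim: d X => [|d IH] X.
  (* ['rV[A]_0] is the zero module that pads the resolution. *)
  move=> pX; pose P i : lmodType A := if i is 0%N then X else 'rV[A]_0.
  have P0 i (x : P i.+1) : x = 0 by apply/rowP; case.
  exists P, (fun i => \0), idfun; split.
  - case=> [|i]; first exact/projectiveE.
    by apply/projectiveE/proj_zero => x; apply: P0.
  - by case=> // i _; apply: P0.
  - by move=> v; exists v.
  - by move=> x; split=> [/= ->|[_ <-]//]; exists 0.
  by move=> i x; split=> [_|_]; [exists 0; rewrite (P0 _ x)|].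
move=> [K [Q [i [p [s pQ /IH [P [del [eps [pP P0 es e0 ed]]]]]]]]].
pose P' j : lmodType A := if j is j'.+1 then P j' else Q.
(* Splicing: the first differential is the augmentation of the resolution of K followed by the
   inclusion of K into Q. *)
pose del' j : {linear P' j.+1 -> P' j} :=
  match j with 0%N => lin_of (islin_comp (islinP eps) (ses_homl s)) | j'.+1 => del j' end.
exists P', del', (@lin_of Q X p (ses_homr s)); split.
- by case=> [|j]; [exact/projectiveE|exact: pP].
- by case=> // j jd; apply: P0.
- exact: ses_surj s.
- move=> x; rewrite lin_ofE (ses_ker s); split=> [[z <-]|[y <-]].
    by have [y <-] := es z; exists y.
  by exists (eps y).
case=> [|j] x; last exact: ed.
rewrite -e0 /=; split=> [ex|ex]; last by have := congr1 i ex; rewrite (hom0 (ses_homl s)).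
by apply: (ses_inj s); rewrite (hom0 (ses_homl s)).
Qed.

Lemma pd_le_PD d X : pd_le X d -> PD d (X : ob lmodcat).
Proof.
elim: d X => [|d IH] X [P [del [eps [pP P0 es e0 ed]]]].
  (* Here [P 1] is zero, so exactness at [P 0] makes [eps] an isomorphism. *)
  have inj : injective eps.
    move=> x y /eqP; rewrite -subr_eq0 -linearB => /eqP/e0[z].
    by rewrite (P0 1%N isT z) linear0 => /esym/eqP; rewrite subr_eq0 => /eqP.
  have [r rK] := choice es.
  have hr : islin r by apply: (islin_cancel (islinP eps) inj) => a x y /=; rewrite !rK.
  have pp : proj (P 0%N : ob lmodcat) by apply/projectiveE.
  by apply: (proj_retract (C := lmodcat) pp hr (islinP eps)).
have [K [i sK]] := kernel_ses (C := lmodcat) (islinP eps) es.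
exists K, (P 0%N), i, eps; split=> //; first exact/projectiveE.
have [q [hq iq]] : exists q : P 1%N -> K, islin q /\ forall z, i (q z) = del 0%N z.
  apply: (hom_factor (C := lmodcat) (islinP _) (ses_homl sK) (ses_inj sK)) => z.
  by apply/(ses_ker sK)/e0; exists z.
apply: IH; exists (fun j => P j.+1), (fun j => del j.+1), (lin_of hq); split=> //.
- by move=> j jd; apply: P0.
- move=> v; have /e0[y ey] : eps (i v) = 0 by apply: (ses0 sK).
  by exists y; apply: (ses_inj sK); rewrite lin_ofE iq.
move=> x; rewrite -ed lin_ofE -iq; split=> [-> |e]; first exact: hom0 (ses_homl sK).
by apply: (ses_inj sK); rewrite e (hom0 (ses_homl sK)).
Qed.

End LinearMaps.

(** * Lifting linear maps over a field *)

Section LinearLifting.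
Variables (k : fieldType) (U Z Y : lmodType k) (f : U -> Y) (g : Z -> Y).
Hypotheses (hf : islin f) (hg : islin g) (fg : forall u, exists z, g z = f u).
Local Open Scope classical_set_scope.

(* Adding 0 keeps the union of the empty chain a partial lift. *)
Let with0 (G : set (U * Z)) (x : U * Z) := G x \/ x = 0.

Let partial_lift (G : set (U * Z)) :=
  [/\ forall a x y, with0 G x -> with0 G y -> with0 G (a *: x + y),
      forall z, with0 G (0, z) -> z = 0 & forall x, with0 G x -> g x.2 = f x.1].

(** Zorn's lemma on graphs of partial lifts takes the place of a basis of U; a maximal graph is
    total because one more vector can always be added. *)
Lemma linear_lifting : exists h : U -> Z, islin h /\ forall u, g (h u) = f u.
Proof.
have [F FP Ftot|A [[AL A0 Ag] Amax]] := @Zorn_bigcup (U * Z)%type partial_lift.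
  have F0 x : with0 (\bigcup_(X in F) X) x -> x = 0 \/ exists2 X, F X & with0 X x.
    by case=> [[X FX Xx]|]; [right; exists X => //; left|left].
  have Fw X x : F X -> with0 X x -> with0 (\bigcup_(X in F) X) x.
    by move=> FX [Xx|->]; [left; exists X|right].
  split=> [a x y /F0 Hx /F0 Hy|z /F0|x /F0].
  - case: Hx Hy => [->|[X FX Xx]] [->|[X' FX' Xy]].
    + by right; rewrite scaler0 addr0.
    + by rewrite scaler0 add0r; apply: Fw Xy.
    + by have [XL _ _] := FP _ FX; apply: (Fw X) => //; apply: XL => //; right.
    have [s|s] := Ftot _ _ FX FX'.
      have [XL _ _] := FP _ FX'; apply: (Fw X') => //; apply: XL => //.
      by case: Xx => [/s ?|->]; [left|right].
    have [XL _ _] := FP _ FX; apply: (Fw X) => //; apply: XL => //.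
    by case: Xy => [/s ?|->]; [left|right].
  - by case=> [/(congr1 snd)//|[X FX Xz]]; have [_ X0 _] := FP _ FX; apply: X0.
  case=> [->|[X FX Xx]]; first by rewrite /= (islin0 hf) (islin0 hg).
  by have [_ _ Xg] := FP _ FX; apply: Xg.
have AZ a x : with0 A x -> with0 A (a *: x).
  by move=> Ax; rewrite -[_ *: _]addr0; apply: AL => //; right.
have Atot u : exists z, with0 A (u, z).
  apply: contrapT => /forallNP nu; have [z gz] := fg u.
  (* The graph enlarged by the line through (u, z), where z is any preimage of [f u]. *)
  pose B x := exists c a, with0 A a /\ x = c *: (u, z) + a.
  have BA x : with0 B x -> B x.
    by case=> // ->; exists 0, 0; split; [right|rewrite scale0r addr0].
  apply: (Amax B); last split.
  - split=> [x Ax|sBA]; first by exists 0, x; split; [left|rewrite scale0r add0r].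
    apply: (nu z); left; apply: sBA.
    by exists 1, 0; split; [right|rewrite scale1r addr0].
  - move=> a x y /BA[c [w [Aw ->]]] /BA[d [v [Av ->]]]; left.
    exists (a * c + d), (a *: w + v); split; first exact: AL.
    by rewrite scalerDr scalerA scalerDl addrACA.
  - move=> z' /BA[c [[w v] [Aw [ew ->]]]].
    have [c0|c0] := eqVneq c 0.
      by move: ew Aw; rewrite c0 !scale0r !add0r => <- /A0.
    (* A nonzero c would express u by a vector already in the domain. *)
    case: (nu (- c^-1 *: v)); suff -> : u = - c^-1 *: w by apply: (AZ _ (w, v)).
    apply/eqP; rewrite -subr_eq0 scaleNr opprK; apply/eqP.
    by rewrite -[u]scale1r -(mulVf c0) -scalerA -scalerDr -ew scaler0.
  move=> x /BA[c [[w v] [/Ag/= e ->]]] /=.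
  by rewrite hg hf gz e.
have [h Ah] := choice Atot; exists h; split=> [a x y|u]; last exact: (Ag _ (Ah u)).
apply/eqP; rewrite -subr_eq0; apply/eqP/A0.
have -> : (0, h (a *: x + y) - (a *: h x + h y)) =
    -1 *: (a *: (x, h x) + (y, h y)) + (a *: x + y, h (a *: x + y)).
  by congr pair; rewrite /= scaleN1r addrC ?subrr.
by apply: (AL) => //; apply: AL.
Qed.

End LinearLifting.

(** * Graded representations *)

Section SymmetricDifference.
Variable T : finType.
Implicit Types I J L : {set T}.

(** Addition in (Z/2)^n, the group that grades the representations. *)
Definition sd I J := (I :\: J) :|: (J :\: I).

Lemma in_sd x I J : (x \in sd I J) = (x \in I) (+) (x \in J).
Proof. by rewrite !inE; case: (x \in I); case: (x \in J). Qed.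

Lemma sdC I J : sd I J = sd J I.
Proof. by apply/setP=> x; rewrite !in_sd addbC. Qed.

Lemma sdA I J L : sd I (sd J L) = sd (sd I J) L.
Proof. by apply/setP=> x; rewrite !in_sd addbA. Qed.

Lemma sdK J : involutive (sd^~ J).
Proof. by move=> I; apply/setP=> x; rewrite !in_sd -addbA addbb addbF. Qed.

Lemma sdAC I J L : sd (sd I J) L = sd (sd I L) J.
Proof. by rewrite -!sdA (sdC J). Qed.

Lemma sd0 I : sd I set0 = I.
Proof. by apply/setP=> x; rewrite in_sd inE addbF. Qed.

Lemma sdI I : sd I I = set0.
Proof. by apply/setP=> x; rewrite in_sd addbb inE. Qed.

End SymmetricDifference.

Section Representations.
Variables (k : fieldType) (n : nat).
Implicit Types (i j : 'I_n) (I J : {set 'I_n}).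

(* A module over k[a_1, ..., a_n] graded by the subsets of [n], where a_i
   (here [ra i]) has degree {i} and [re I] projects to the degree I part.
   The element x_i of the paper acts as a_i ^ 2. *)
Record rep := Rep {
  rcar :> lmodType k;
  ra : 'I_n -> rcar -> rcar;
  re : {set 'I_n} -> rcar -> rcar;
  ra_lin : forall i, islin (ra i);
  re_lin : forall I, islin (re I);
  raC : forall i j x, ra i (ra j x) = ra j (ra i x);
  rereE : forall I J x, re I (re J x) = if I == J then re J x else 0;
  re_sum : forall x, \sum_I re I x = x;
  ra_re : forall i I x, ra i (re I x) = re (sd I [set i]) (ra i x) }.

Implicit Types X Y Z : rep.

Lemma reK X I x : re I (re I x) = re I x :> X.
Proof. by rewrite rereE eqxx. Qed.

Lemma re_eq0 X (x : X) : (forall I, re I x = 0) -> x = 0.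
Proof. by move=> x0; rewrite -[x]re_sum big1. Qed.

Lemma re_ext X (x y : X) : (forall I, re I x = re I y) -> x = y.
Proof. by move=> xy; rewrite -[x]re_sum -[y]re_sum; apply: eq_bigr. Qed.

Lemma re_ra X i I x : re I (ra i x) = ra i (re (sd I [set i]) x) :> X.
Proof. by rewrite ra_re sdK. Qed.

(** Graded maps linear over the a_i with i outside D only: for the full D just graded k-linear maps,
    for D = set0 the morphisms of representations. *)
Record dhom (D : {set 'I_n}) X Y (f : X -> Y) : Prop := Dhom {
  dhom_lin : islin f;
  dhom_re : forall I x, f (re I x) = re I (f x);
  dhom_ra : forall i x, i \notin D -> f (ra i x) = ra i (f x) }.

Definition rhom X Y (f : X -> Y) := dhom set0 f.

Lemma rhom_ra X Y (f : X -> Y) : rhom f -> forall i x, f (ra i x) = ra i (f x).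
Proof. by move=> hf i x; rewrite (dhom_ra hf) ?inE. Qed.

Lemma dhom_sub (D E : {set 'I_n}) X Y (f : X -> Y) : D \subset E -> dhom D f -> dhom E f.
Proof.
move=> DE hf; split; [exact: dhom_lin hf|exact: dhom_re hf|].
by move=> i x iE; apply: (dhom_ra hf); apply: contra iE; apply/subsetP.
Qed.

Lemma rhom_dhom D X Y (f : X -> Y) : rhom f -> dhom D f.
Proof. exact/dhom_sub/sub0set. Qed.

Lemma dhom_id D X : @dhom D X X id.
Proof. by []. Qed.

Lemma dhom_comp D X Y Z (f : X -> Y) (g : Y -> Z) : dhom D f -> dhom D g -> dhom D (g \o f).
Proof.
move=> hf hg; split=> [|I x|i x iD] /=.
- exact: islin_comp (dhom_lin hf) (dhom_lin hg).
- by rewrite (dhom_re hf) (dhom_re hg).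
by rewrite (dhom_ra hf) // (dhom_ra hg).
Qed.

Lemma rhomD X Y (f : X -> Y) : rhom f -> forall x y, f (x + y) = f x + f y.
Proof. by move=> hf; apply: islinD (dhom_lin hf). Qed.

Lemma rhom_id X : @rhom X X id.
Proof. exact: dhom_id. Qed.

Lemma rhom_comp X Y Z (f : X -> Y) (g : Y -> Z) : rhom f -> rhom g -> rhom (g \o f).
Proof. exact: dhom_comp. Qed.

Lemma rhom_add X Y (f g : X -> Y) : rhom f -> rhom g -> rhom (fun x => f x + g x).
Proof.
move=> hf hg; split=> [|I x|i x _].
- exact: islin_add (dhom_lin hf) (dhom_lin hg).
- by rewrite (dhom_re hf) (dhom_re hg) (islinD (@re_lin _ _)).
by rewrite (rhom_ra hf) (rhom_ra hg) (islinD (@ra_lin _ _)).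
Qed.

Lemma rhom_opp X Y (f : X -> Y) : rhom f -> rhom (fun x => - f x).
Proof.
move=> hf; split=> [|I x|i x _]; first exact: islin_opp (dhom_lin hf).
- by rewrite (dhom_re hf) (islinN (@re_lin _ _)).
by rewrite (rhom_ra hf) (islinN (@ra_lin _ _)).
Qed.

Lemma rhom_cancel X Y Z (f : X -> Y) (g : Y -> Z) :
  rhom g -> injective g -> rhom (g \o f) -> rhom f.
Proof.
move=> hg gI hgf; split=> [|I x|i x _].
- exact: islin_cancel (dhom_lin hg) gI (dhom_lin hgf).
- by apply: gI; rewrite (dhom_re hg) -(dhom_re hgf).
by apply: gI; rewrite (rhom_ra hg) -(rhom_ra hgf).
Qed.

Lemma rhom_cancelr X Y Z (f : X -> Y) (g : Y -> Z) :
  rhom f -> (forall y, exists x, f x = y) -> rhom (g \o f) -> rhom g.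
Proof.
move=> hf fs hgf; split=> [|I y|i y _].
- exact: islin_cancelr (dhom_lin hf) fs (dhom_lin hgf).
- by have [x <-] := fs y; rewrite -(dhom_re hf) -(dhom_re hgf).
by have [x <-] := fs y; rewrite -(rhom_ra hf) -(rhom_ra hgf).
Qed.

Section Subrepresentation.
Variables (X : rep) (N : subm X).
Hypotheses (Na : forall i x, N x -> N (ra i x)) (Ne : forall I x, N x -> N (re I x)).

Definition subrep : rep.
Proof.
exists (smod N) (fun i z => smk (Na i (smval_mem z))) (fun I z => smk (Ne I (smval_mem z))).
- by move=> i a x y; apply: val_inj; apply: ra_lin.
- by move=> I a x y; apply: val_inj; apply: re_lin.
- by move=> i j x; apply: val_inj; apply: raC.
- by move=> I J x; apply: val_inj; rewrite /= rereE; case: eqP.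
- move=> x; apply: val_inj; rewrite /= -[RHS]re_sum.
  by rewrite (islin_sum (@smvalL _ _ N)).
by move=> i I x; apply: val_inj; apply: ra_re.
Defined.

Definition subrep_val : subrep -> X := @smval _ _ N.

Lemma subrep_val_hom : rhom subrep_val.
Proof. by []. Qed.

Lemma lpi_op (f : X -> X) : islin f -> (forall x, N x -> N (f x)) ->
  forall x, lpi N (f (repr (lpi N x))) = lpi N (f x).
Proof. by move=> hf Nf x; apply/lpiE; rewrite -(islinB hf); apply/Nf/lpiE/lpiK. Qed.

Lemma lpi_op_lin (f : X -> X) : islin f -> (forall x, N x -> N (f x)) ->
  islin (fun q : lquot N => lpi N (f (repr q))).
Proof.
move=> hf Nf a p q; rewrite -[p]lpiK -[q]lpiK -lpiZ -lpiD !lpi_op //.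
by rewrite -lpiZ -lpiD hf.
Qed.

Let lpi_ra i x : lpi N (ra i (repr (lpi N x))) = lpi N (ra i x).
Proof. exact: (lpi_op (@ra_lin X i) (@Na i)). Qed.

Let lpi_re I x : lpi N (re I (repr (lpi N x))) = lpi N (re I x).
Proof. exact: (lpi_op (@re_lin X I) (@Ne I)). Qed.

Let quotrep_surj q : exists x, lpi N x = q.
Proof. by exists (repr q); apply: lpiK. Qed.

Definition quotrep : rep.
Proof.
exists (lquot N) (fun i q => lpi N (ra i (repr q))) (fun I q => lpi N (re I (repr q))).
- by move=> i; apply: lpi_op_lin; [apply: ra_lin|apply: Na].
- by move=> I; apply: lpi_op_lin; [apply: re_lin|apply: Ne].
- move=> i j q; have [x <-] := quotrep_surj q; rewrite !(lpi_ra _ x) !lpi_ra.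
  by rewrite raC.
- move=> I J q; have [x <-] := quotrep_surj q; rewrite !(lpi_re _ x) lpi_re rereE.
  by case: eqP => // _; apply/lpi0/subm0.
- move=> q; have [x <-] := quotrep_surj q; under eq_bigr do rewrite lpi_re.
  by rewrite -(islin_sum (f := lpi N)) ?re_sum // => a y z; rewrite lpiD lpiZ.
move=> i I q; have [x <-] := quotrep_surj q.
by rewrite (lpi_re _ x) (lpi_ra _ x) lpi_ra lpi_re ra_re.
Defined.

Definition quotrep_pi : X -> quotrep := @lpi _ _ N.

Lemma quotrep_pi_hom : rhom quotrep_pi.
Proof.
split=> [a x y|I x|i x _]; first by rewrite /quotrep_pi lpiD lpiZ.
  by rewrite /= lpi_re.
by rewrite /= lpi_ra.
Qed.

Lemma quotrep_pi_surj : surj quotrep_pi.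
Proof. exact: quotrep_surj. Qed.

Lemma quotrep_pi0 x : quotrep_pi x = 0 <-> N x.
Proof. exact: lpi0. Qed.

End Subrepresentation.

Lemma rep_kernel X Y (f : X -> Y) : rhom f ->
  exists (K : rep) (i : K -> X),
    [/\ rhom i, injective i & forall x, f x = 0 <-> exists z, i z = x].
Proof.
move=> hf; pose N := lker (dhom_lin hf).
have Na i x : N x -> N (ra i x).
  by rewrite /N /= => fx; rewrite (rhom_ra hf) fx (islin0 (@ra_lin _ _)).
have Ne I x : N x -> N (re I x).
  by rewrite /N /= => fx; rewrite (dhom_re hf) fx (islin0 (@re_lin _ _)).
exists (subrep Na Ne), (@subrep_val _ _ Na Ne); split; first exact: subrep_val_hom.
  exact: smval_inj.
move=> x; split=> [fx|[z <-]]; last exact: (smval_mem z).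
by exists (@smk _ _ N x fx).
Qed.

Definition prodrep X Y : rep.
Proof.
exists (X * Y)%type (fun i u => (ra i u.1, ra i u.2)) (fun I u => (re I u.1, re I u.2)).
- by move=> i a [x y] [x' y']; congr pair; apply: ra_lin.
- by move=> I a [x y] [x' y']; congr pair; apply: re_lin.
- by move=> i j [x y]; congr pair; apply: raC.
- by move=> I J [x y]; rewrite /= !rereE; case: eqP.
- move=> [x y]; rewrite -[x in RHS]re_sum -[y in RHS]re_sum.
  by elim/big_rec3: _ => //= I u v _ _ -> .
by move=> i I [x y]; rewrite /= !ra_re.
Defined.

Lemma rep_biprod X Y : exists (S : rep)
    (i1 : X -> S) (i2 : Y -> S) (p1 : S -> X) (p2 : S -> Y),
    [/\ rhom i1, rhom i2, rhom p1 & rhom p2] /\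
    [/\ cancel i1 p1, cancel i2 p2, forall y, p1 (i2 y) = 0,
        forall x, p2 (i1 x) = 0 & forall s, i1 (p1 s) + i2 (p2 s) = s].
Proof.
exists (prodrep X Y), (fun x => (x, 0)), (fun y => (0, y)), fst, snd; split; split=> //.
- split=> [a x y|I x|i x _]; congr pair; rewrite /= ?scaler0 ?addr0 //.
    by rewrite (islin0 (@re_lin _ _)).
  by rewrite (islin0 (@ra_lin _ _)).
- split=> [a x y|I x|i x _]; congr pair; rewrite /= ?scaler0 ?addr0 //.
    by rewrite (islin0 (@re_lin _ _)).
  by rewrite (islin0 (@ra_lin _ _)).
by case=> x y; congr pair; rewrite ?addr0 ?add0r.
Qed.

Definition repcat : concat :=
  @Concat rep (fun X => X) rhom rhomD rhom_id rhom_comp rhom_add rhom_opp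
    rhom_cancel rhom_cancelr rep_kernel rep_biprod.

End Representations.

(** * Adjoining a variable and the Koszul sequence *)

Section FiniteSupport.
Variables (A : pzRingType) (X : lmodType A).

Definition finsupp (f : nat -> X) := exists N, forall m, (N <= m)%N -> f m = 0.

Definition finsupp_subm : subm (nat -> X).
Proof.
exists finsupp; first by exists 0%N.
move=> a f g [N fN] [M gM]; exists (maxn N M) => m; rewrite geq_max => /andP[Nm Mm].
by rewrite /= -[LHS]/(a *: f m + g m) fN // gM // scaler0 addr0.
Defined.

End FiniteSupport.

Section Polynomials.
Variables (k : fieldType) (n : nat).
Implicit Types (i j : 'I_n) (I J : {set 'I_n}) (X Y Z : rep k n).

(** Degree shift by {i}: it turns [ra i], which has degree {i}, into a morphism [tw i X] -> X. *)
Definition tw i X : rep k n.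
Proof.
exists X (@ra _ _ X) (fun I => re (sd I [set i])).
- exact: ra_lin.
- by move=> I; apply: re_lin.
- exact: raC.
- by move=> I J x; rewrite rereE (can_eq (@sdK _ _)).
- move=> x; rewrite -[RHS]re_sum [RHS](reindex (fun I => sd I [set i])) //.
  by exists (fun I => sd I [set i]) => I _; apply: sdK.
by move=> j I x; rewrite ra_re sdAC.
Defined.

Lemma tw_hom i X Y (f : X -> Y) D : dhom D f -> @dhom _ _ D (tw i X) (tw i Y) f.
Proof.
by move=> hf; split; [exact: dhom_lin hf|move=> I x; apply: (dhom_re hf)|exact: dhom_ra hf].
Qed.

(** The degree of t^m for t of degree {i}; in (Z/2)^n only the parity of m survives. *)
Definition par i m := if odd m then [set i] else set0 : {set 'I_n}.

Lemma parS i m : par i m.+1 = sd [set i] (par i m).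
Proof. by rewrite /par /=; case: (odd m); rewrite ?sdI ?sd0. Qed.

Lemma sd_parS I i m : sd (sd I (par i m.+1)) [set i] = sd I (par i m).
Proof. by rewrite parS sdA sdAC sdK. Qed.

Lemma iter_ra_re X i I m (x : X) :
  re I (iter m (ra i) x) = iter m (ra i) (re (sd I (par i m)) x).
Proof.
elim: m I => [|m IH] I /=; first by rewrite sd0.
by rewrite re_ra IH parS sdA.
Qed.

Lemma iter_raC X i j m (x : X) : ra j (iter m (ra i) x) = iter m (ra i) (ra j x).
Proof. by elim: m => //= m <-; rewrite raC. Qed.

Lemma iter_ra_lin X i m : islin (iter m (@ra _ _ X i)).
Proof. by elim: m => //= m IH; apply: islin_comp IH (@ra_lin _ _ X i). Qed.

Definition shift X (f : nat -> X) m := if m is m'.+1 then f m' else 0.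

(* k[t] (x) X with t of degree {i}; here a_i acts as t and the other a_j as on X. *)
Definition ext_ra i X j (f : nat -> X) : nat -> X :=
  if j == i then shift f else fun m => ra j (f m).
Definition ext_re i X I (f : nat -> X) m := re (sd I (par i m)) (f m).

Lemma shift_finsupp X (f : nat -> X) : finsupp f -> finsupp (shift f).
Proof. by case=> N fN; exists N.+1 => -[|m] //= Nm; apply: fN. Qed.

Lemma ext_ra_finsupp i X j (f : nat -> X) : finsupp f -> finsupp (ext_ra i j f).
Proof.
move=> hf; rewrite /ext_ra; case: eqP => _; first exact: shift_finsupp.
by case: hf => N fN; exists N => m Nm; rewrite fN // (islin0 (@ra_lin _ _ X j)).
Qed.

Lemma ext_re_finsupp i X I (f : nat -> X) : finsupp f -> finsupp (ext_re i I f).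
Proof.
case=> N fN; exists N => m Nm.
by rewrite /ext_re fN // (islin0 (@re_lin _ _ X _)).
Qed.

Definition extT X := smod (finsupp_subm X).

Lemma ext_eq X (z w : extT X) : (forall m, smval z m = smval w m) -> z = w.
Proof. by move=> zw; apply: smval_inj; apply/funext. Qed.

Definition ext i X : rep k n.
Proof.
exists (extT X)
  (fun j (z : extT X) =>
     @smk _ _ (finsupp_subm X) _ (@ext_ra_finsupp i X j (smval z) (smval_mem z)))
  (fun I (z : extT X) =>
     @smk _ _ (finsupp_subm X) _ (@ext_re_finsupp i X I (smval z) (smval_mem z))).
- move=> j a x y; apply: ext_eq => m /=; rewrite /ext_ra.
  case: eqP => _; last exact: ra_lin.
  by case: m => [|m] //=; rewrite -[RHS]/(a *: 0 + 0) scaler0 addr0.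
- by move=> I a x y; apply: ext_eq => m; apply: re_lin.
- move=> j l x; apply: ext_eq => m /=; rewrite /ext_ra.
  case: (j == i); case: (l == i) => //=; last exact: raC.
    by case: m => //=; rewrite (islin0 (@ra_lin _ _ X _)).
  by case: m => //=; rewrite (islin0 (@ra_lin _ _ X _)).
- move=> I J x; apply: ext_eq => m.
  transitivity (if I == J then ext_re i J (smval x) m else 0); last by case: eqP.
  by rewrite /= /ext_re rereE (can_eq (@sdK _ _)).
- move=> x; apply: ext_eq => m; rewrite (islin_sum (@smvalL _ _ (finsupp_subm X))) fct_sumE /=.
  rewrite -[RHS]re_sum [RHS](reindex (fun I => sd I (par i m))) //.
  by exists (fun I => sd I (par i m)) => I _; apply: sdK.
move=> j I x; apply: ext_eq => m /=; rewrite /ext_ra /ext_re.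
case: eqP => [->|_]; last by rewrite ra_re sdAC.
by case: m => [|m] /=; rewrite ?(islin0 (@re_lin _ _ X _)) // sdAC sd_parS.
Defined.

Definition ecoef i X (z : ext i X) : nat -> X := smval (z : extT X).

Definition mkext i X (f : nat -> X) (hf : finsupp f) : ext i X :=
  @smk _ _ (finsupp_subm X) f hf.

Lemma ext_coef i X (z w : ext i X) : (forall m, ecoef z m = ecoef w m) -> z = w.
Proof. exact: ext_eq. Qed.

Lemma ecoefL i X a (z w : ext i X) m : ecoef (a *: z + w) m = a *: ecoef z m + ecoef w m.
Proof. by []. Qed.

Lemma ecoef_finsupp i X (z : ext i X) : finsupp (ecoef z).
Proof. exact: (smval_mem (z : extT X)). Qed.

Lemma ext_raE i X j (z : ext i X) m :
  ecoef (ra j z) m = if j == i then shift (ecoef z) m else ra j (ecoef z m).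
Proof. by rewrite /= /ext_ra; case: eqP. Qed.

Lemma ext_reE i X I (z : ext i X) m :
  ecoef (re I z) m = re (sd I (par i m)) (ecoef z m).
Proof. by []. Qed.

Section Evaluation.
Variables (i : 'I_n) (D : {set 'I_n}) (X Z : rep k n) (g : X -> Z).
Hypothesis hg : dhom D g.

Definition ext_bound (z : ext i X) := projT1 (cid (ecoef_finsupp z)).

(** Extension of [g] by t |-> a_i. The bound comes from choice, and [evextE] shows that any other
    bound gives the same sum. *)
Definition evext (z : ext i X) : Z :=
  \sum_(m < ext_bound z) iter m (ra i) (g (ecoef z m)).

Let g0 : g 0 = 0. Proof. exact: islin0 (dhom_lin hg). Qed.

Lemma evextE (z : ext i X) N : (forall m, (N <= m)%N -> ecoef z m = 0) ->
  evext z = \sum_(m < N) iter m (ra i) (g (ecoef z m)).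
Proof.
have aux (M M' : nat) : (M <= M')%N -> (forall m, (M <= m)%N -> ecoef z m = 0) ->
    \sum_(m < M) iter m (ra i) (g (ecoef z m)) = \sum_(m < M') iter m (ra i) (g (ecoef z m)).
  move=> MM' zM; rewrite [RHS](bigID (fun m : 'I_M' => m < M)%N) /= [X in _ + X]big1.
    by rewrite addr0 (big_ord_widen _ (fun m => iter m (ra i) (g (ecoef z m))) MM').
  by move=> m; rewrite -leqNgt => /zM->; rewrite g0 (islin0 (@iter_ra_lin Z i m)).
rewrite /evext /ext_bound; case: cid => M /= zM zN.
by rewrite (aux _ (maxn M N)) ?leq_maxl // [RHS](aux _ (maxn M N)) ?leq_maxr.
Qed.

Lemma evext_lin : islin evext.
Proof.
move=> a z w; have [N zN] := ecoef_finsupp z; have [M wM] := ecoef_finsupp w.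
pose L := maxn N M.
have zL m : (L <= m)%N -> ecoef z m = 0 by rewrite geq_max => /andP[/zN].
have wL m : (L <= m)%N -> ecoef w m = 0 by rewrite geq_max => /andP[_ /wM].
rewrite (evextE zL) (evextE wL) (evextE (N := L)) => [|m Lm]; last first.
  by rewrite -[LHS]/(a *: ecoef z m + ecoef w m) zL // wL // scaler0 addr0.
rewrite scaler_sumr -big_split; apply: eq_bigr => m _.
rewrite -[ecoef _ _]/(a *: ecoef z m + ecoef w m).
by rewrite (dhom_lin hg) (iter_ra_lin _ _).
Qed.

Lemma evext_shift (z w : ext i X) : (forall m, ecoef w m.+1 = ecoef z m) ->
  evext w = g (ecoef w 0%N) + ra i (evext z).
Proof.
move=> zw; have [N zN] := ecoef_finsupp z.
rewrite (evextE zN) (evextE (N := N.+1)); last by case=> // m Nm; rewrite zw zN.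
rewrite big_ord_recl /= (islin_sum (@ra_lin _ _ Z i)); congr (_ + _).
by apply: eq_bigr => m _; rewrite zw.
Qed.

(** The gain is linearity over a_i, which acts on the source as t; this is how i leaves D. *)
Lemma evext_hom : dhom (D :\ i) evext.
Proof.
split=> [|I z|j z]; first exact: evext_lin.
  have [N zN] := ecoef_finsupp z; rewrite (evextE zN) (evextE (N := N)) => [|m Nm]; last first.
    by rewrite ext_reE zN // (islin0 (@re_lin _ _ X _)).
  rewrite (islin_sum (@re_lin _ _ Z I)); apply: eq_bigr => m _.
  by rewrite ext_reE (dhom_re hg) iter_ra_re.
rewrite !inE negb_and negbK; case: (eqVneq j i) => [-> _|ji /= jD].
  rewrite (evext_shift (z := z)) => [|m]; rewrite ext_raE eqxx //=.
  by rewrite g0 add0r.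
have [N zN] := ecoef_finsupp z; rewrite (evextE zN) (evextE (N := N)) => [|m Nm]; last first.
  by rewrite ext_raE (negbTE ji) zN // (islin0 (@ra_lin _ _ X _)).
rewrite (islin_sum (@ra_lin _ _ Z j)); apply: eq_bigr => m _.
by rewrite ext_raE (negbTE ji) (dhom_ra hg) // iter_raC.
Qed.

End Evaluation.

Section Constants.
Variables (i : 'I_n) (X : rep k n).

Definition extc_fun (x : X) m := if m is 0%N then x else 0.

Lemma extc_finsupp x : finsupp (extc_fun x).
Proof. by exists 1%N; case. Qed.

Definition extc (x : X) : ext i X := mkext i (extc_finsupp x).

Lemma extc_hom : dhom [set i] extc.
Proof.
split=> [a x y|I x|j x].
- by apply: ext_coef => -[|m] //=; rewrite -[RHS]/(a *: 0 + 0) scaler0 addr0.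
- by apply: ext_coef => -[|m] /=; rewrite /ext_re /= ?sd0 // (islin0 (@re_lin _ _ X _)).
rewrite inE => /negbTE ji; apply: ext_coef => m; rewrite ext_raE ji.
by case: m => //=; rewrite (islin0 (@ra_lin _ _ X _)).
Qed.

Lemma evextc D Z (g : X -> Z) (hg : dhom D g) x : evext g (extc x) = g x.
Proof.
rewrite (evextE hg (N := 1)); last by case.
by rewrite big_ord_recl big_ord0 addr0.
Qed.

End Constants.

(** Constants generate k[t] (x) X over t: write z = z_0 + t w and induct on the length. With
    [evextc] this gives the universal property of [ext]. *)
Lemma ext_dhom_unique (D : {set 'I_n}) i X Z (f g : ext i X -> Z) : i \notin D ->
  dhom D f -> dhom D g -> (forall x, f (extc i x) = g (extc i x)) -> forall z, f z = g z.
Proof.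
move=> iD hf hg fg z; have [N] := ecoef_finsupp z; elim: N z => [|N IH] z zN.
  have -> : z = 0 by apply: ext_coef => m; rewrite zN.
  by rewrite (islin0 (dhom_lin hf)) (islin0 (dhom_lin hg)).
have [w wz] : exists w : ext i X, forall m, ecoef w m = ecoef z m.+1.
  have hw : finsupp (fun m => ecoef z m.+1) by exists N => m Nm; apply: zN.
  by exists (mkext i hw).
have -> : z = extc i (ecoef z 0%N) + ra i w.
  apply: ext_coef => -[|m]; rewrite -[RHS]/(_ + ecoef (ra i w) _) ext_raE eqxx /=.
    by rewrite addr0.
  by rewrite wz add0r.
rewrite (islinD (dhom_lin hf)) (islinD (dhom_lin hg)) (dhom_ra hf) // (dhom_ra hg) //.
by rewrite fg IH // => m Nm; rewrite wz zN.
Qed.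

Section KoszulSequence.
Variables (i : 'I_n) (X : rep k n).

Definition koszul_fun (f : nat -> X) m := shift f m - ra i (f m).

Lemma koszul_finsupp f : finsupp f -> finsupp (koszul_fun f).
Proof.
move=> hf; apply: (submB (N := finsupp_subm X)); first exact: shift_finsupp.
by case: hf => N fN; exists N => m Nm; rewrite fN // (islin0 (@ra_lin _ _ X _)).
Qed.

Definition koszul (z : ext i (tw i X)) : ext i X :=
  mkext i (koszul_finsupp (ecoef_finsupp z)).

Lemma koszulE z m : ecoef (koszul z) m = shift (ecoef z : nat -> X) m - ra i (ecoef z m : X).
Proof. by []. Qed.

Lemma koszul_hom : rhom koszul.
Proof.
split=> [a x y|I x|j x _].
- apply: ext_coef => m; rewrite ecoefL !koszulE ecoefL (@ra_lin _ _ X i).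
  rewrite scalerBr opprD addrACA; congr (_ + _).
  by case: m => [|m] /=; rewrite ?ecoefL // scaler0 addr0.
- apply: ext_coef => m; rewrite ext_reE !koszulE (islinB (@re_lin _ _ X _)) ext_reE /=.
  rewrite ra_re sdK; congr (_ - _); case: m => [|m] /=.
    by rewrite (islin0 (@re_lin _ _ X _)).
  by rewrite /ext_re /= parS sdA sdAC.
apply: ext_coef => m; rewrite ext_raE !koszulE.
case: (eqVneq j i) => [->|/negbTE ji].
  rewrite ext_raE eqxx; case: m => [|m] //=.
    by rewrite (islin0 (@ra_lin _ _ X _)) subr0.
  by rewrite /ext_ra eqxx.
rewrite ext_raE ji (islinB (@ra_lin _ _ X _)) raC; congr (_ - _).
case: m => [|m] /=; first by rewrite (islin0 (@ra_lin _ _ X _)).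
by rewrite /ext_ra ji.
Qed.

(** A kernel element has z_l = a_i z_(l+1), so vanishing descends from the top coefficient. *)
Lemma koszul_inj : injective koszul.
Proof.
apply: (hom_inj (C := repcat k n) koszul_hom) => z z0.
have [N zN] := ecoef_finsupp z; apply: ext_coef => m; case: (leqP N m) => [/zN//|].
have {}z0 l : ecoef z l = ra i (ecoef z l.+1 : X).
  by apply/eqP; rewrite -subr_eq0 -(koszulE z l.+1) z0.
elim: N zN => // N IH zN; rewrite ltnS leq_eqVlt => /orP[/eqP->|]; last first.
  apply: IH => l; rewrite leq_eqVlt => /orP[/eqP<-|]; last exact: zN.
  by rewrite z0 zN // (islin0 (@ra_lin _ _ X _)).
by rewrite z0 zN // (islin0 (@ra_lin _ _ X _)).
Qed.

Let hid : dhom set0 (@id X). Proof. exact: rhom_id. Qed.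

(** Division by t - a_i in Horner's form: coefficient m of the quotient is the tail z_(m+1) +
    z_(m+2) t + ... evaluated at a_i. *)
Lemma koszul_exact (z : ext i X) : evext (@id X) z = 0 -> exists w, koszul w = z.
Proof.
move=> z0.
have [N zN] := ecoef_finsupp z.
have hd (m : nat) : finsupp (fun l => ecoef z (l + m)%N).
  by exists N => l Nl; apply: zN; rewrite (leq_trans Nl) // leq_addr.
pose d (m : nat) : ext i X := mkext i (hd m).
have dS (m : nat) : evext (@id X) (d m) = ecoef z m + ra i (evext (@id X) (d m.+1)).
  by rewrite (evext_shift hid (z := d m.+1)) // => l /=; rewrite addnS addSn.
have hw : finsupp (fun m => evext (@id X) (d m.+1)).
  exists N => m Nm; rewrite (evextE hid (N := 0)) ?big_ord0 // => l _.
  by apply: zN; rewrite addnS ltnW // ltnS (leq_trans Nm) // leq_addl.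
exists (mkext i (X := tw i X) hw); apply: ext_coef => m.
rewrite koszulE; case: m => [|m] /=; last by rewrite dS addrK.
have -> : ecoef z 0%N = evext (@id X) (d 0%N) - ra i (evext (@id X) (d 1%N)).
  by rewrite dS addrK.
congr (_ - _); rewrite -z0; congr evext; apply: ext_coef => l /=.
by rewrite addn0.
Qed.

Lemma koszul_ses : @ses (repcat k n) _ _ _ koszul (evext (i := i) (@id X)).
Proof.
have hev : rhom (evext (i := i) (@id X)).
  by apply: dhom_sub (evext_hom i hid); rewrite subsetDl.
split=> //=; first exact: koszul_hom.
- exact: koszul_inj.
- by move=> x; exists (extc i x); rewrite (evextc i hid).
move=> z; split=> [|[w <-]]; first exact: koszul_exact.
have h0 : @dhom _ _ set0 (ext i (tw i X)) X (fun=> 0).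
  exact: (@hom_zero (repcat k n)).
apply: (ext_dhom_unique (D := set0) (f := evext (@id X) \o koszul)) h0 _ _.
- by rewrite inE.
- exact: dhom_comp koszul_hom hev.
move=> x; rewrite /comp; have -> : koszul (@extc i (tw i X) x) = ra i (@extc i X x) - @extc i X (@ra _ _ X i x).
  apply: ext_coef => m; rewrite koszulE.
  rewrite -[RHS]/(ecoef (ra i (@extc i X x)) m - ecoef (@extc i X (@ra _ _ X i x)) m).
  rewrite ext_raE eqxx; congr (_ - _); case: m => //= m.
  by rewrite (islin0 (@ra_lin _ _ X _)).
by rewrite (islinB (dhom_lin hev)) (rhom_ra hev) !(evextc i hid) subrr.
Qed.

End KoszulSequence.

End Polynomials.

(** * Relative projectivity and the graded syzygy theorem *)

Section RelativeProjectives.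
Variables (k : fieldType) (n : nat).
Implicit Types (i j : 'I_n) (I J : {set 'I_n}) (X Y Z : rep k n) (D : {set 'I_n}).
Implicit Types JJ : {set 'I_n} -> Prop.

(* Syzygies are taken by induction on D: over a field every X is relatively
   projective for D the full set, while D = set0 is ordinary projectivity. *)
Definition relproj D JJ X := forall Y Z (g : Z -> Y) (f : X -> Y),
  rhom g -> dhom D f -> (forall J y, JJ J -> re J y = y -> exists z, g z = y) ->
  exists h : X -> Z, dhom D h /\ forall x, g (h x) = f x.

Lemma relproj_proj JJ X : relproj set0 JJ X -> proj (X : ob (repcat k n)).
Proof. by move=> pX Y Z g f hg hf sg; apply: pX => // J y _ _; apply: sg. Qed.

Lemma relproj_weaken D JJ JJ' X : (forall J, JJ J -> JJ' J) ->
  relproj D JJ X -> relproj D JJ' X.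
Proof. by move=> JJs pX Y Z g f hg hf sg; apply: pX => // J y /JJs; apply: sg. Qed.

(** By the universal property of [ext], lifting over the smaller set of variables reduces to lifting
    the restriction to constants, where the hypothesis on X applies. *)
Lemma relproj_ext i D JJ X : i \in D -> relproj D JJ X -> relproj (D :\ i) JJ (ext i X).
Proof.
move=> iD pX Y Z g f hg hf sg.
have hc : dhom D (f \o @extc _ _ i X).
  apply: dhom_comp; last by apply: dhom_sub hf; apply: subsetDl.
  by apply: dhom_sub (extc_hom i X); rewrite sub1set.
have [h [hh gh]] := pX _ _ g _ hg hc sg.
have hh' := evext_hom i hh; exists (evext h); split=> // z.
apply: (ext_dhom_unique (D := D :\ i) (f := g \o evext h)) hf _ z.
- by rewrite !inE eqxx.
- exact: dhom_comp hh' (rhom_dhom _ hg).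
by move=> x /=; rewrite (evextc i hh) gh.
Qed.

Lemma tw_homr i D X Y (f : X -> Y) : @dhom _ _ D (tw i X) Y f -> @dhom _ _ D X (tw i Y) f.
Proof.
move=> hf; split; [exact: dhom_lin hf|move=> I x|exact: dhom_ra hf].
by have := dhom_re hf (sd I [set i]) x; rewrite /= sdK.
Qed.

Lemma tw_homl i D X Y (f : X -> Y) : @dhom _ _ D X (tw i Y) f -> @dhom _ _ D (tw i X) Y f.
Proof.
move=> hf; split; [exact: dhom_lin hf|move=> I x|exact: dhom_ra hf].
by have := dhom_re hf (sd I [set i]) x; rewrite /= sdK.
Qed.

Lemma relproj_tw i D JJ X :
  relproj D JJ X -> relproj D (fun J => JJ (sd J [set i])) (tw i X).
Proof.
move=> pX Y Z g f hg /tw_homr hf sg.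
have [|h [hh gh]] := pX (tw i Y) (tw i Z) g f (tw_hom i hg) hf.
  by move=> J y JJJ; apply: (sg (sd J [set i])); rewrite sdK.
by exists h; split=> //; apply: tw_homl.
Qed.

(** Only graded linear algebra is left for the full D. [JJ] lists the degrees in which X lives, and
    [g] has to be onto only there. *)
Lemma relproj_setT JJ X : (forall I (x : X), ~ JJ I -> re I x = 0) -> relproj setT JJ X.
Proof.
move=> X0 Y Z g f hg hf sg.
have [u|h [hh gh]] := @linear_lifting k X Z Y f g (dhom_lin hf) (dhom_lin hg).
  have : forall I, exists z, g z = re I (f u).
    move=> I; rewrite -(dhom_re hf); have [JI|/X0->] := pselect (JJ I).
      by apply: (sg I) => //; rewrite -(dhom_re hf) reK.
    by exists 0; rewrite (islin0 (dhom_lin hg)) (islin0 (dhom_lin hf)).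
  move=> /choice[z gz]; exists (\sum_I z I).
  by rewrite (islin_sum (dhom_lin hg)) -[RHS]re_sum; apply: eq_bigr.
(* The degree preserving part of the linear lift, which is still a lift since f and g are graded. *)
pose h' x := \sum_I re I (h (re I x)).
have h're I x : re I (h' x) = re I (h (re I x)).
  rewrite /h' (islin_sum (@re_lin _ _ Z I)) (bigD1 I) //= reK big1 ?addr0 // => J JI.
  by rewrite rereE eq_sym (negbTE JI).
exists h'; split; first split.
- move=> a x y; rewrite /h' scaler_sumr -big_split; apply: eq_bigr => I _.
  by rewrite !(@re_lin _ _ X I, @re_lin _ _ Z I, hh).
- move=> I x; apply: re_ext => J; rewrite h're !rereE.
  case: eqP => [<-|_]; first by rewrite h're.
  by rewrite (islin0 hh) (islin0 (@re_lin _ _ Z _)).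
- by move=> i x; rewrite inE.
move=> x; apply: re_ext => I.
by rewrite -(dhom_re hg) h're (dhom_re hg) gh -!(dhom_re hf) reK.
Qed.

(** The Koszul sequence for some i in D presents X by two objects that are projective relative to D
    minus i; each variable therefore costs one dimension. *)
Lemma relproj_PD D X : relproj D (fun=> True) X -> PD #|D| (X : ob (repcat k n)).
Proof.
move Dd: #|D| => d; elim: d D X Dd => [|d IH] D X Dd pX.
  by apply: (@relproj_proj (fun=> True)); rewrite -(cards0_eq Dd).
have [i iD] : exists i, i \in D by apply/set0Pn; rewrite -cards_eq0 Dd.
have Did : #|D :\ i| = d by move: Dd; rewrite (cardsD1 i) iD => -[].
have pT : relproj D (fun=> True) (tw i X) := relproj_tw (i := i) pX.
have d1 := IH _ _ Did (relproj_ext iD pT).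
exact: PD_coker (koszul_ses i X) d1 (PD_S (IH _ _ Did (relproj_ext iD pX))).
Qed.

Lemma rep_PD X : PD n (X : ob (repcat k n)).
Proof.
have := @relproj_PD setT X; rewrite cardsT card_ord; apply.
exact: relproj_setT.
Qed.

(* The side condition makes n0 the last index to be adjoined. *)
Lemma ext_tower (n0 : 'I_n) (Q : {set 'I_n} -> rep k n -> Prop) :
  (forall D i X, i \in D -> i != n0 \/ D = [set n0] -> Q D X -> Q (D :\ i) (ext i X)) ->
  forall D X, Q D X -> exists X' (j : X -> X'), [/\ Q set0 X', dhom D j
    & forall Z (f : X -> Z), dhom D f -> exists f' : X' -> Z, rhom f' /\ forall x, f' (j x) = f x].
Proof.
move=> Qext D; have [d Dd] : exists d, #|D| = d by exists #|D|.
elim: d D Dd => [|d IH] D Dd X QX.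
  rewrite (cards0_eq Dd) in QX *; exists X, id; split=> // Z f hf.
  by exists f.
have [i [iD i0]] : exists i, i \in D /\ (i != n0 \/ D = [set n0]).
  have [D0|/set0Pn[i]] := eqVneq (D :\ n0) set0.
    have nD : n0 \in D.
      by move: Dd; rewrite (cardsD1 n0) D0 cards0; case: (n0 \in D).
    exists n0; split=> //; right; by rewrite -(setD1K nD) D0 setU0.
  by rewrite !inE => /andP[i0 iD]; exists i; split=> //; left.
have Did : #|D :\ i| = d by move: Dd; rewrite (cardsD1 i) iD => -[].
have [X' [j [QX' hj ej]]] := IH _ Did _ (Qext _ _ _ iD i0 QX).
exists X', (j \o @extc _ _ i X); split=> // [|Z f hf].
  apply: dhom_comp; last by apply: dhom_sub hj; apply: subsetDl.
  by apply: dhom_sub (extc_hom i X); rewrite sub1set.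
have [f' [hf' ff']] := ej _ _ (evext_hom i hf).
by exists f'; split=> // x; rewrite /= ff' (evextc i hf).
Qed.

(** X' is the free module k[a_1, ..., a_n] (x) X on the graded space X: adjoining the i-th variable
    replaces the given action of a_i. *)
Lemma free_cover (n0 : 'I_n) JJ X : (forall I (x : X), ~ JJ I -> re I x = 0) ->
  exists X' (j : X -> X'), [/\ relproj set0 JJ X', dhom setT j
    & forall Z (f : X -> Z), dhom setT f ->
        exists f' : X' -> Z, rhom f' /\ forall x, f' (j x) = f x].
Proof.
move=> /relproj_setT pX; apply: (ext_tower (n0 := n0) (Q := fun D X => relproj D JJ X)) pX.
by move=> D i Y iD _; apply: relproj_ext.
Qed.

Lemma ra_ext_inj i j X : j = i \/ injective (@ra _ _ X j) -> injective (@ra _ _ (ext i X) j).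
Proof.
move=> ji z w e; apply: ext_coef => m.
have em l : ecoef (ra j z) l = ecoef (ra j w) l by rewrite e.
case: ji => [ij|inj]; first by have := em m.+1; rewrite !ext_raE ij eqxx.
have := em m; rewrite !ext_raE; case: eqP => [ij _|_ /inj//].
by have := em m.+1; rewrite !ext_raE ij eqxx.
Qed.

(** A projective is a retract of the free module on its underlying graded space, where every a_i
    acts as a polynomial variable. *)
Lemma proj_ra_inj i X : proj (X : ob (repcat k n)) -> injective (@ra _ _ X i).
Proof.
move=> pX; pose Q D (Y : rep k n) := forall l, l \notin D -> injective (@ra _ _ Y l).
have [||X' [j [QX' hj ej]]] := @ext_tower i Q _ setT X.
- move=> D l Y lD _ QY l'; rewrite !inE negb_and negbK => h; apply: ra_ext_inj.
  by case/orP: h => [/eqP|/QY]; [left|right].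
- by move=> l; rewrite inE.
have [f [hf fj]] := ej X id (dhom_id _ _).
have [s [hs sK]] := proj_section pX hf (fun x => ex_intro _ (j x) (fj x)).
move=> x y e; apply: (can_inj sK); apply: (QX' i); first by rewrite inE.
by rewrite -!(rhom_ra hs) e.
Qed.

Lemma proj_relproj X : proj (X : ob (repcat k n)) -> relproj set0 (fun=> True) X.
Proof.
move=> pX Y Z g f hg hf sg; apply: pX => // y.
have /choice[z gz] : forall J, exists z, g z = re J y.
  by move=> J; apply: (sg J); rewrite ?reK.
exists (\sum_J z J); rewrite (islin_sum (dhom_lin hg)) -[RHS]re_sum.
exact: eq_bigr.
Qed.

End RelativeProjectives.

(** * Polynomial action and reduction *)

Section Evaluation.
Variables (k : fieldType) (n : nat).
Implicit Types (i j : 'I_n) (I J U : {set 'I_n}) (X Y Z : rep k n) (p q s : {mpoly k[n]}).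

Definition mon_seq X (r : seq 'I_n) (m : 'X_{1..n}) (x : X) : X :=
  foldr (fun i y => iter (m i) (ra i) y) x r.

Definition mon X m (x : X) := mon_seq (enum 'I_n) m x.

Lemma mon_seq_ra X r m i (x : X) : mon_seq r m (ra i x) = ra i (mon_seq r m x).
Proof. by elim: r => //= j r ->; rewrite iter_raC. Qed.

Lemma mon_seq_iter X r m i c (x : X) :
  mon_seq r m (iter c (ra i) x) = iter c (ra i) (mon_seq r m x).
Proof. by elim: c => //= c <-; rewrite mon_seq_ra. Qed.

Lemma monD X m m' (x : X) : mon (m + m')%MM x = mon m (mon m' x).
Proof.
rewrite /mon; elim: (enum _) x => //= i r IH x.
by rewrite mnmDE iterD IH mon_seq_iter.
Qed.

Lemma mon0 X (x : X) : mon 0%MM x = x.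
Proof. by rewrite /mon; elim: (enum _) => //= i r ->; rewrite mnm0E. Qed.

Lemma mon1 X i (x : X) : mon U_(i)%MM x = ra i x.
Proof.
rewrite /mon; have := enum_uniq 'I_n; have : i \in enum 'I_n by rewrite mem_enum.
elim: (enum _) => //= j r IH; rewrite inE => /orP[/eqP<-|ir] /andP[jr ur].
  rewrite mnm1E eqxx /=; congr ra; elim: r jr {IH ur} => //= l r IH.
  by rewrite inE negb_or mnm1E => /andP[/negbTE-> /IH->].
rewrite mnm1E IH //; case: eqP => // ij.
by rewrite -ij ir in jr.
Qed.

Lemma mon_lin X m : islin (@mon X m).
Proof.
rewrite /mon; elim: (enum _) => //= i r IH.
exact: islin_comp IH (@iter_ra_lin _ _ X i _).
Qed.

Lemma mon_hom X Y (f : X -> Y) m x : rhom f -> f (mon m x) = mon m (f x).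
Proof.
move=> hf; rewrite /mon; elim: (enum _) => //= i r <-.
by elim: (m i) => //= c <-; rewrite (rhom_ra hf).
Qed.

Definition pev X p (x : X) : X := \sum_(m <- msupp p) p@_m *: mon m x.

Lemma pevE X p (x : X) d : (msize p <= d)%N ->
  pev p x = \sum_(m : 'X_{1..n < d}) p@_m *: mon m x.
Proof.
move=> pd; pose G : subFinType _ := 'X_{1..n < d}.
rewrite /pev (big_mksub G) ?msupp_uniq //=; first last.
  by move=> m /msize_mdeg_lt /leq_trans; apply.
by rewrite big_rmcond //= => m /memN_msupp_eq0 ->; rewrite scale0r.
Qed.

Lemma pev_linl X (x : X) : islin (fun p => pev p x).
Proof.
move=> a p q /=; pose d := maxn (msize (a *: p + q)) (maxn (msize p) (msize q)).
rewrite !(@pevE X _ x d) ?leq_max ?leqnn ?orbT //.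
rewrite scaler_sumr -big_split; apply: eq_bigr => m _ /=.
by rewrite linearP /= scalerDl scalerA.
Qed.

Lemma mpoly_lin_ext (V : lmodType k) (F G : {mpoly k[n]} -> V) :
  islin F -> islin G -> (forall m, F 'X_[m] = G 'X_[m]) -> F =1 G.
Proof.
move=> hF hG FG p; rewrite [p]mpolyE (islin_sum hF) (islin_sum hG).
by apply: eq_bigr => m _; rewrite (islinZ hF) (islinZ hG) FG.
Qed.

Lemma pevXm X m (x : X) : pev 'X_[m] x = mon m x.
Proof. by rewrite /pev msuppX big_seq1 mcoeffX eqxx scale1r. Qed.

Lemma pev_lin X p : islin (@pev X p).
Proof.
move=> a x y; rewrite /pev scaler_sumr -big_split; apply: eq_bigr => m _ /=.
by rewrite (@mon_lin X m) scalerDr !scalerA mulrC.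
Qed.

Lemma pev_hom X Y (f : X -> Y) p x : rhom f -> f (pev p x) = pev p (f x).
Proof.
move=> hf; rewrite /pev (islin_sum (dhom_lin hf)); apply: eq_bigr => m _.
by rewrite (islinZ (dhom_lin hf)) mon_hom.
Qed.

Lemma pevM X p q (x : X) : pev (p * q) x = pev p (pev q x).
Proof.
move: p; apply: mpoly_lin_ext; [|exact: pev_linl|move=> m].
  by move=> a p p'; rewrite mulrDl -scalerAl; apply: (pev_linl x).
rewrite pevXm; move: q; apply: mpoly_lin_ext => [a q q'|a q q'|m'].
- by rewrite mulrDr -scalerAr; apply: (pev_linl x).
- by rewrite (pev_linl x) (@mon_lin X m).
by rewrite -mpolyXD !pevXm monD.
Qed.

Lemma pevD X p q (x : X) : pev (p + q) x = pev p x + pev q x.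
Proof. exact: (islinD (pev_linl x)). Qed.

Lemma pevB X p q (x : X) : pev (p - q) x = pev p x - pev q x.
Proof. exact: (islinB (pev_linl x)). Qed.

Lemma pev1 X (x : X) : pev 1 x = x.
Proof. by rewrite -mpolyX0 pevXm mon0. Qed.

Lemma pev0 X p : pev p (0 : X) = 0.
Proof. exact: islin0 (@pev_lin X p). Qed.

Lemma pevX X i (x : X) : pev 'X_i x = ra i x.
Proof. by rewrite pevXm mon1. Qed.

Lemma pevZ X c (x : X) : pev c%:MP x = c *: x.
Proof. by rewrite -[c%:MP]mulr1 mul_mpolyC (islinZ (pev_linl x)) pev1. Qed.

Definition xset U : {mpoly k[n]} := \prod_(i in U) 'X_i.

Lemma xset0 : xset set0 = 1.
Proof. exact: big_set0. Qed.

Lemma xsetD1 i U : i \in U -> xset U = 'X_i * xset (U :\ i).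
Proof. exact: big_setD1. Qed.

Lemma xsetI U V : xset U = xset (U :&: V) * xset (U :\: V).
Proof. exact: big_setID. Qed.

(** This governs composition in the graded ring: variables occurring twice leave degree set0
    squares, which are elements of R. *)
Lemma xset_sd U V : xset U * xset V = xset (U :&: V) ^+ 2 * xset (sd U V).
Proof.
have -> : xset (sd U V) = xset (U :\: V) * xset (V :\: U).
  rewrite (xsetI _ U); congr (xset _ * xset _).
    by apply/setP=> x; rewrite !inE; case: (x \in U); case: (x \in V).
  by apply/setP=> x; rewrite !inE; case: (x \in U); case: (x \in V).
rewrite (xsetI U V) (xsetI V U) setIC expr2 -!mulrA; congr (_ * _).
by rewrite mulrCA.
Qed.

Lemma re_pev_xset X U I (x : X) : re I (pev (xset U) x) = pev (xset U) (re (sd I U) x).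
Proof.
have [d Ud] : exists d, #|U| = d by exists #|U|.
elim: d U Ud I => [|d IH] U Ud I; first by rewrite (cards0_eq Ud) sd0 xset0 !pev1.
have [i iU] : exists i, i \in U by apply/set0Pn; rewrite -cards_eq0 Ud.
have Uid : #|U :\ i| = d by move: Ud; rewrite (cardsD1 i) iU => -[].
rewrite (xsetD1 iU) !pevM !pevX re_ra IH //; congr (ra i (pev _ (re _ x))).
apply/setP=> j; rewrite !in_sd !inE; case: (eqVneq j i) => [->|_]; rewrite ?iU //=.
  by rewrite addbF.
by rewrite addbF.
Qed.

(** The same polynomial ring serves for the x_i and for the a_i; [sq] rewrites x_i as a_i^2 and
    identifies k[x] with the degree set0 part of k[a]. *)
Definition sq s : {mpoly k[n]} := s \mPo [tuple 'X_i ^+ 2 | i < n].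

Lemma sqM s t : sq (s * t) = sq s * sq t.
Proof. exact: rmorphM. Qed.

Lemma sqD s t : sq (s + t) = sq s + sq t.
Proof. exact: raddfD. Qed.

Lemma sqX i : sq 'X_i = 'X_i ^+ 2.
Proof. by rewrite /sq comp_mpolyXU -tnth_nth tnth_mktuple. Qed.

Lemma sqC c : sq c%:MP = c%:MP.
Proof. exact: comp_mpolyC. Qed.

Lemma sq_xset U : sq (xset U) = xset U ^+ 2.
Proof.
rewrite /sq /xset rmorph_prod -prodrXl /=.
by apply: eq_bigr => i _; apply: sqX.
Qed.

Lemma re_pev_sq X s I (x : X) : re I (pev (sq s) x) = pev (sq s) (re I x).
Proof.
move: s; apply: mpoly_lin_ext => [a s t|a s t|m].
- by rewrite /sq linearP /= (pev_linl x) (@re_lin _ _ X I).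
- by rewrite /sq linearP /= (pev_linl _).
rewrite /sq comp_mpolyX; move: x I; elim/big_rec: _ => [|i p _ IH] x I; first by rewrite !pev1.
rewrite !pevM -IH tnth_mktuple; elim: (m i) (pev p x) => [|c IHc] y; first by rewrite !pev1.
by rewrite [_ ^+ c.+1]exprS !pevM !pevX !re_ra sdK IHc.
Qed.

End Evaluation.

(** * Killing what degree set0 generates *)

Section Reduction.
Variables (k : fieldType) (n : nat).
Implicit Types (i j : 'I_n) (I J U : {set 'I_n}) (X Y Z : rep k n).

Definition reduced X := forall x : X, re set0 x = 0.

(* The subrepresentation generated by the part of degree set0 *)
Definition gen0 X : subm X.
Proof.
exists (fun x => forall I, exists y, re set0 y = y /\ re I x = pev (xset k I) y).
  by move=> I; exists 0; rewrite pev0 !(islin0 (@re_lin _ _ X _)).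
move=> a x y Nx Ny I; have [u [u0 xu]] := Nx I; have [v [v0 yv]] := Ny I.
by exists (a *: u + v); rewrite (@pev_lin _ _ X) !(@re_lin _ _ X) u0 v0 xu yv.
Defined.

(** A monomial of degree I is [xset k I] times a product of squares. A square preserves degree set0
    and is absorbed into the witness [y]. *)
Lemma gen0_ra X i (x : X) : gen0 X x -> gen0 X (ra i x).
Proof.
move=> Nx I; have [y [y0 xy]] := Nx (sd I [set i]); rewrite re_ra xy -pevX -pevM.
have [iI|iI] := boolP (i \in I).
  exists y; split=> //; rewrite (xsetD1 k iI); congr (pev (_ * xset _ _) _).
  by apply/setP=> j; rewrite in_sd !inE; case: eqP => [->|]; rewrite ?iI ?addbF.
exists (ra i (ra i y)); split; first by rewrite !re_ra sdK y0.
have -> : sd I [set i] = i |: I.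
  by apply/setP=> j; rewrite in_sd !inE; case: eqP => [->|]; rewrite ?(negbTE iI) ?addbF.
rewrite (xsetD1 k (setU11 i I)) -!pevX -!pevM setU1K //; congr pev.
by rewrite mulrA [LHS]mulrC ?mulrA.
Qed.

Lemma gen0_re X J (x : X) : gen0 X x -> gen0 X (re J x).
Proof.
move=> Nx I; have [y [y0 xy]] := Nx I; rewrite rereE; case: eqP => [<-|_]; first by exists y.
by exists 0; rewrite pev0 (islin0 (@re_lin _ _ X _)).
Qed.

Lemma gen0_xset X I (y : X) : re set0 y = y -> gen0 X (pev (xset k I) y).
Proof.
move=> y0 J; rewrite re_pev_xset.
have -> : re (sd J I) y = if sd J I == set0 then y else 0 by rewrite -[in LHS]y0 rereE y0.
case: eqP => [e|_]; last by exists 0; rewrite !pev0 (islin0 (@re_lin _ _ X _)).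
by exists y; rewrite -(sdK I J) e sdC sd0.
Qed.

Lemma gen0_hom X Y (f : X -> Y) x : rhom f -> gen0 X x -> gen0 Y (f x).
Proof.
move=> hf Nx I; have [y [y0 xy]] := Nx I; exists (f y).
by rewrite -!(dhom_re hf) y0 xy pev_hom.
Qed.

(** The largest reduced quotient; by [red_desc] it is left adjoint to the inclusion of the reduced
    representations. *)
Definition red X : rep k n := quotrep (@gen0_ra X) (@gen0_re X).
Definition red_pi X : X -> red X := @quotrep_pi _ _ _ _ (@gen0_ra X) (@gen0_re X).

Lemma red_pi_hom X : rhom (@red_pi X). Proof. exact: quotrep_pi_hom. Qed.
Lemma red_pi_surj X : surj (@red_pi X). Proof. exact: quotrep_pi_surj. Qed.
Lemma red_pi0 X (x : X) : red_pi x = 0 <-> gen0 X x. Proof. exact: quotrep_pi0. Qed.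

Lemma reduced_red X : reduced (red X).
Proof.
move=> q; have [x <-] := red_pi_surj q; rewrite -(dhom_re (red_pi_hom X)); apply/red_pi0.
by rewrite -[re _ x]pev1 -xset0; apply: gen0_xset; rewrite reK.
Qed.

Lemma gen0_reduced X Y (f : X -> Y) x : rhom f -> reduced Y -> gen0 X x -> f x = 0.
Proof.
move=> hf Y0 /(gen0_hom hf) Nx; apply: re_eq0 => I.
by have [y [<- ->]] := Nx I; rewrite Y0 pev0.
Qed.

Lemma red_ex X Y (f : X -> Y) : rhom f ->
  exists g : red X -> red Y, rhom g /\ forall x, g (red_pi x) = red_pi (f x).
Proof.
move=> hf; pose g q := red_pi (f (sval (cid (red_pi_surj q)))).
have gE x : g (red_pi x) = red_pi (f x).
  rewrite /g; case: cid => y /= e; apply/eqP; rewrite -subr_eq0; apply/eqP.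
  rewrite -(islinB (dhom_lin (red_pi_hom Y))) -(islinB (dhom_lin hf)).
  apply/red_pi0/(gen0_hom hf)/red_pi0.
  by rewrite (islinB (dhom_lin (red_pi_hom X))) e subrr.
exists g; split=> //; apply: (rhom_cancelr (red_pi_hom X) (@red_pi_surj X)).
by have -> : g \o @red_pi X = @red_pi Y \o f by [apply/funext]; apply: rhom_comp (red_pi_hom Y).
Qed.

Lemma red_desc X Y (f : X -> Y) : rhom f -> reduced Y ->
  exists g : red X -> Y, rhom g /\ forall x, g (red_pi x) = f x.
Proof.
move=> hf Y0; pose g q := f (sval (cid (red_pi_surj q))).
have gE x : g (red_pi x) = f x.
  rewrite /g; case: cid => y /= e; apply/eqP; rewrite -subr_eq0; apply/eqP.
  rewrite -(islinB (dhom_lin hf)); apply: gen0_reduced hf Y0 _; apply/red_pi0.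
  by rewrite (islinB (dhom_lin (red_pi_hom X))) e subrr.
exists g; split=> //; apply: (rhom_cancelr (red_pi_hom X) (@red_pi_surj X)).
by have -> : g \o @red_pi X = f by apply/funext.
Qed.

(** The condition on the last term of a short exact sequence under which [red] keeps it exact on the
    left. *)
Definition good X := forall I (y : X), re set0 y = y -> pev (xset k I) y = 0 -> y = 0.

Lemma reduced_good X : reduced X -> good X.
Proof. by move=> X0 I y <-. Qed.

Lemma good_sub X Y (f : X -> Y) : rhom f -> injective f -> good Y -> good X.
Proof.
move=> hf fI gY I y y0 e; apply: fI; rewrite (islin0 (dhom_lin hf)); apply: (gY I).
  by rewrite -(dhom_re hf) y0.
by rewrite -pev_hom // e (islin0 (dhom_lin hf)).
Qed.

Lemma inj_good X : (forall i, injective (@ra _ _ X i)) -> good X.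
Proof.
move=> inj I y _; have [d Id] : exists d, #|I| = d by exists #|I|.
elim: d I Id => [|d IH] I Id; first by rewrite (cards0_eq Id) xset0 pev1.
have [i iI] : exists i, i \in I by apply/set0Pn; rewrite -cards_eq0 Id.
have Iid : #|I :\ i| = d by move: Id; rewrite (cardsD1 i) iI => -[].
rewrite (xsetD1 k iI) pevM pevX => e; apply: (IH _ Iid); apply: (inj i).
by rewrite e (islin0 (@ra_lin _ _ X i)).
Qed.

Lemma proj_good X : proj (X : ob (repcat k n)) -> good X.
Proof. by move=> pX; apply: inj_good => i; apply: proj_ra_inj. Qed.

(** Goodness of X is used for injectivity: what becomes zero in [red P] must already be generated by
    the degree set0 part of K. *)
Lemma red_ses (K P X : rep k n) (i : K -> P) (p : P -> X) (i' : red K -> red P) (p' : red P -> red X) :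
  @ses (repcat k n) K P X i p -> good X ->
  rhom i' -> (forall x, i' (red_pi x) = red_pi (i x)) ->
  rhom p' -> (forall x, p' (red_pi x) = red_pi (p x)) ->
  @ses (repcat k n) (red K) (red P) (red X) i' p'.
Proof.
move=> s gX hi' i'E hp' p'E.
have hi : rhom i := ses_homl s; have hp : rhom p := ses_homr s.
split=> //.
- apply: (hom_inj (C := repcat k n) hi') => q; have [z <-] := red_pi_surj q.
  rewrite i'E => /red_pi0 Nz; apply/red_pi0 => I.
  have [y [y0 zy]] := Nz I.
  (* The image of [xset k I] times y in X is zero, and X is good. *)
  have py : p y = 0.
    apply: (gX I); first by rewrite -(dhom_re hp) y0.
    by rewrite -pev_hom // -zy -(dhom_re hi) (ses0 s).
  have /(ses_ker s)[w ew] := py; exists (re set0 w); rewrite reK; split=> //.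
  by apply: (ses_inj s); rewrite (dhom_re hi) pev_hom // (dhom_re hi) ew y0.
- move=> q; have [x <-] := red_pi_surj q; have [y <-] := ses_surj s x.
  by exists (red_pi y).
move=> q; split=> [|[w <-]]; last first.
  have [z <-] := red_pi_surj w; rewrite i'E p'E (ses0 s).
  exact: islin0 (dhom_lin (red_pi_hom X)).
have [x <-] := red_pi_surj q; rewrite p'E => /red_pi0 Nx.
have /choice[y yE] : forall I, exists y, re set0 y = y /\ re I (p x) = pev (xset k I) (p y).
  move=> I; have [y [y0 xy]] := Nx I; have [y' ey] := ses_surj s y.
  by exists (re set0 y'); rewrite reK (dhom_re hp) ey y0.
(* Lifts the degree set0 generators of [p x] to P, so that x - u lies in the kernel while u dies in
   [red P]. *)
pose u := \sum_I pev (xset k I) (y I).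
have Nu : gen0 P u by apply: subm_sum => I _; apply: gen0_xset; have [] := yE I.
have : p (x - u) = 0.
  rewrite (islinB (dhom_lin hp)) (islin_sum (dhom_lin hp)) -[p x]re_sum -sumrB big1 // => I _.
  by have [_ ->] := yE I; rewrite pev_hom // subrr.
move=> /(ses_ker s)[z ez]; exists (red_pi z); rewrite i'E ez.
rewrite (islinB (dhom_lin (red_pi_hom P))); have /red_pi0 -> := Nu.
by rewrite subr0.
Qed.

End Reduction.

(** * The endomorphism ring of the module M *)

Section MonomialDivisibility.
Variables (k : fieldType) (n : nat).
Implicit Types (i j : 'I_n) (U V : {set 'I_n}) (p q r s v : {mpoly k[n]}).

Lemma mpolyXU_neq0 i : 'X_i != 0 :> {mpoly k[n]}.
Proof. by rewrite -msupp_eq0 msuppX. Qed.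

Lemma xset_neq0 U : xset k U != 0.
Proof. by apply/prodf_neq0 => i _; apply: mpolyXU_neq0. Qed.

Definition setzero i p : {mpoly k[n]} :=
  p \mPo [tuple if j == i then 0 else 'X_j | j < n].

Lemma setzeroX i j : setzero i 'X_j = if j == i then 0 else 'X_j.
Proof. by rewrite /setzero comp_mpolyXU -tnth_nth tnth_mktuple. Qed.

Lemma setzeroM i p q : setzero i (p * q) = setzero i p * setzero i q.
Proof. exact: rmorphM. Qed.

(** On products by a b - a' b' = (a - a') b + a' (b - b'), then linearly from monomials. *)
Lemma setzero_dvd i p : exists q, p - setzero i p = 'X_i * q.
Proof.
have mon m : exists q, 'X_[m] - setzero i 'X_[m] = 'X_i * q.
  rewrite mpolyXE_id; apply: (big_ind (fun p => exists q, p - setzero i p = 'X_i * q)).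
  - by exists 0; rewrite /setzero rmorph1 subrr mulr0.
  - move=> a b [q eq] [r er]; exists (q * b + setzero i a * r); rewrite setzeroM mulrDr.
    rewrite mulrA -eq mulrCA -er mulrBl mulrBr addrA.
    by rewrite subrK.
  move=> j _; elim: (m j) => [|c [q eq]].
    by exists 0; rewrite /setzero rmorph1 subrr mulr0.
  have [r er] : exists r, 'X_j - setzero i 'X_j = 'X_i * r.
    rewrite setzeroX; case: eqP => [->|_]; first by exists 1; rewrite subr0 mulr1.
    by exists 0; rewrite subrr mulr0.
  exists (r * 'X_j ^+ c + setzero i 'X_j * q); rewrite exprS setzeroM mulrDr.
  by rewrite mulrA -er mulrCA -eq mulrBl mulrBr addrA subrK.
have hz : islin (setzero i) by move=> a q r; rewrite /setzero linearP.
rewrite [p]mpolyE (islin_sum hz) -sumrB.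
apply: (big_ind (fun p => exists q, p = 'X_i * q)).
- by exists 0; rewrite mulr0.
- by move=> _ _ [q ->] [r ->]; exists (q + r); rewrite mulrDr.
move=> m _; have [q eq] := mon m; exists (p@_m *: q).
by rewrite (islinZ hz) -scalerAr -eq scalerBr.
Qed.

(** Put x_i = 0: since x_j survives and polynomials form a domain, v vanishes there, and
    [setzero_dvd] makes it a multiple of x_i. *)
Lemma mpolyX_prime i j r v : i != j -> 'X_j * v = 'X_i * r -> exists v', v = 'X_i * v'.
Proof.
move=> ij /(congr1 (setzero i)); rewrite !setzeroM !setzeroX eqxx mul0r.
rewrite eq_sym (negbTE ij) => /eqP; rewrite mulf_eq0 (negbTE (mpolyXU_neq0 _)) /= => /eqP v0.
by have [q] := setzero_dvd i v; rewrite v0 subr0; exists q.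
Qed.

Lemma xset_coprime1 i V r v : i \notin V -> xset k V * v = 'X_i * r -> exists v', v = 'X_i * v'.
Proof.
have [d Vd] : exists d, #|V| = d by exists #|V|.
elim: d V Vd r => [|d IH] V Vd r.
  by rewrite (cards0_eq Vd) xset0 mul1r; exists r.
have [j jV] : exists j, j \in V by apply/set0Pn; rewrite -cards_eq0 Vd.
have Vjd : #|V :\ j| = d by move: Vd; rewrite (cardsD1 j) jV => -[].
move=> iV; rewrite (xsetD1 k jV) -mulrA => e.
have [|r' er'] := mpolyX_prime _ e; first by apply: contraNneq iV => ->.
by apply: IH Vjd _ _ er'; apply: contra iV; rewrite !inE => /andP[].
Qed.

Lemma xset_coprime U V r v :
  [disjoint U & V] -> xset k V * v = xset k U * r -> exists s, v = xset k U * s.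
Proof.
have [d Ud] : exists d, #|U| = d by exists #|U|.
elim: d U Ud r v => [|d IH] U Ud r v.
  by rewrite (cards0_eq Ud) xset0 => _ _; exists v; rewrite mul1r.
have [j jU] : exists j, j \in U by apply/set0Pn; rewrite -cards_eq0 Ud.
have Ujd : #|U :\ j| = d by move: Ud; rewrite (cardsD1 j) jU => -[].
move=> dUV; rewrite (xsetD1 k jU) -mulrA => e.
have jV : j \notin V by rewrite (disjointFr dUV jU).
have [v' ev'] := xset_coprime1 jV e.
move: e; rewrite ev' mulrCA => /(mulfI (mpolyXU_neq0 j)) /(IH _ Ujd)[|s ->].
  by apply: disjointWl dUV; apply: subsetDl.
by exists s; rewrite mulrA.
Qed.

End MonomialDivisibility.

(** * Elements of M as families of polynomials *)

Section ConcreteModule.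
Variables (k : fieldType) (n : nat).
Implicit Types (i j : 'I_n) (I J L U V : {set 'I_n}) (r : {mpoly k[n]}) (s t : {set 'I_n} -> {mpoly k[n]}).

Local Notation S := {mpoly k[n]}.
Local Notation R := (ncR k n).
Local Notation M := (ncM k n).
Local Notation G := (End M).

Definition Rpi (s : S) : R := pquot_pi _ s.

Lemma RpiD (s t : S) : Rpi (s + t) = Rpi s + Rpi t. Proof. exact: pquot_piD. Qed.
Lemma RpiM (s t : S) : Rpi (s * t) = Rpi s * Rpi t. Proof. by rewrite [RHS]pquot_mulE. Qed.
Lemma Rpi0 : Rpi 0 = 0.
Proof. by apply: (addrI (Rpi 0)); rewrite -RpiD !addr0. Qed.
Lemma RpiB (s t : S) : Rpi (s - t) = Rpi s - Rpi t.
Proof. by apply/eqP; rewrite eq_sym subr_eq -RpiD subrK. Qed.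
Lemma Rpi1 : Rpi 1 = 1. Proof. by []. Qed.

Lemma Rpi_prod (T : Type) (rr : seq T) (P : pred T) (F : T -> S) :
  Rpi (\prod_(x <- rr | P x) F x) = \prod_(x <- rr | P x) Rpi (F x).
Proof. by apply: (big_morph _ RpiM Rpi1). Qed.

Lemma Rpi_surj (a : R) : exists s : S, Rpi s = a.
Proof. by exists (repr a); apply: pquot_piK. Qed.

Lemma ncx_prod I : \prod_(i in I) ncx k i = Rpi (xset k I).
Proof. by rewrite /xset Rpi_prod. Qed.

Definition Npi I (s : S) : ncN k I := pquot_pi _ (Rpi s).

Lemma Npi_surj I (y : ncN k I) : exists s : S, Npi I s = y.
Proof.
have [s es] := Rpi_surj (repr (y : pquot _)); exists s.
by rewrite /Npi es; apply: pquot_piK.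
Qed.

(** The relation x_1 ... x_n = 0 of R adds nothing modulo x_I, because the full product is x_I times
    the product over the complement. *)
Lemma Npi_eq I (s t : S) : Npi I s = Npi I t <-> exists r, s - t = xset k I * r.
Proof.
rewrite /Npi pquot_piE ncx_prod; split=> [/principalP[a]|[r e]].
  have [b <-] := Rpi_surj a; rewrite -RpiB -RpiM => /pquot_piE/principalP[c ec].
  exists (b + xset k (~: I) * c); rewrite mulrDr mulrA mulrC -{1}[s - t](subrK (b * xset k I)).
  rewrite ec [LHS]addrC; congr (_ + _); rewrite mulrC; congr (_ * _).
  rewrite -[LHS](_ : xset k setT = _); last by apply: eq_bigl => i; rewrite inE.
  by rewrite (xsetI k _ I) setTI setTD.
by apply/principalP; exists (Rpi r); rewrite -RpiB e RpiM mulrC.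
Qed.

Lemma NpiD I (s t : S) : Npi I (s + t) = Npi I s + Npi I t.
Proof. by rewrite /Npi RpiD pquot_piD. Qed.

Lemma NpiZ I (s t : S) : Npi I (s * t) = Rpi s *: Npi I t.
Proof. by rewrite /Npi RpiM [RHS]pquot_scaleE. Qed.

Definition mk s : M := [ffun I => Npi I (s I)].

Lemma mkE s I : mk s I = Npi I (s I). Proof. by rewrite ffunE. Qed.

Lemma mk_surj (u : M) : exists s, mk s = u.
Proof.
have /choice[s es] : forall I, exists s : S, Npi I s = u I by move=> I; apply: Npi_surj.
by exists s; apply/ffunP => I; rewrite mkE.
Qed.

Lemma mk_eq s t : mk s = mk t <-> forall I, exists r, s I - t I = xset k I * r.
Proof.
split=> [e I|e]; first by apply/Npi_eq; rewrite -!mkE e.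
by apply/ffunP => I; rewrite !mkE; apply/Npi_eq.
Qed.

Lemma mkD s t : mk (fun I => s I + t I) = mk s + mk t.
Proof. by apply/ffunP => I; rewrite !ffunE NpiD. Qed.

Lemma mkZ r s : mk (fun I => r * s I) = Rpi r *: mk s.
Proof. by apply/ffunP => I; rewrite !ffunE NpiZ. Qed.

End ConcreteModule.

(* Only these properties of ncM are used; abstracting from the construction
   keeps the unifier from unfolding the quotients. *)
Record gmod (k : fieldType) (n : nat) := GMod {
  gR : comPzRingType;
  gpi : {rmorphism {mpoly k[n]} -> gR};
  gM : lmodType gR;
  gmk : ({set 'I_n} -> {mpoly k[n]}) -> gM;
  gpi_surj : forall a, exists r, gpi r = a;
  gmk_surj : forall u, exists s, gmk s = u;
  gmk_eq : forall s t,
    gmk s = gmk t <-> forall I, exists r, s I - t I = xset k I * r;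
  gmkD : forall s t, gmk (fun I => s I + t I) = gmk s + gmk t;
  gmkZ : forall r s, gmk (fun I => r * s I) = gpi r *: gmk s }.

Section GradedModule.
Variables (k : fieldType) (n : nat) (T : gmod k n).
Implicit Types (i j : 'I_n) (I J L U V : {set 'I_n}) (r : {mpoly k[n]}) (s t : {set 'I_n} -> {mpoly k[n]}).

Local Notation S := {mpoly k[n]}.
Local Notation R := (gR T).
Local Notation M := (gM T).
Local Notation Rpi := (gpi T).
Local Notation mk := (@gmk k n T).
Local Notation Rpi_surj := (@gpi_surj k n T).
Local Notation mk_surj := (@gmk_surj k n T).
Local Notation mk_eq := (@gmk_eq k n T).
Local Notation mkD := (@gmkD k n T).
Local Notation mkZ := (@gmkZ k n T).
Local Notation G := (End M).

Lemma mk_lift (F : ({set 'I_n} -> S) -> {set 'I_n} -> S) :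
  (forall r s t, F (fun I => r * s I + t I) = fun I => r * F s I + F t I) ->
  (forall s t, mk s = mk t -> mk (F s) = mk (F t)) ->
  exists f : G, forall s, f (mk s) = mk (F s).
Proof.
move=> FL Feq; have [l lE] := choice mk_surj.
pose f u := mk (F (l u)).
have fE s : f (mk s) = mk (F s) by apply: Feq; rewrite lE.
have hf : islin f.
  move=> a u v; have [r <-] := Rpi_surj a; have [s <-] := mk_surj u; have [t <-] := mk_surj v.
  rewrite -mkZ -mkD !fE -mkZ -mkD; congr mk; exact: FL.
by exists (lin_of hf : G).
Qed.

(** The entry of a_i into the summand I: multiplication by x_i if it comes from I minus i, the
    projection if it comes from I plus i. *)
Definition achar i I : S := if i \in I then 'X_i else 1.

Lemma alpha_ex i :
  exists f : G, forall s, f (mk s) = mk (fun I => achar i I * s (sd I [set i])).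
Proof.
apply: mk_lift => [r s t|s t /mk_eq e].
  by apply/funext=> I; rewrite mulrDr mulrCA.
apply/mk_eq => I; have [r er] := e (sd I [set i]); rewrite -mulrBr er mulrA /achar.
case: (boolP (i \in I)) => iI.
  exists r; rewrite (xsetD1 k iI); congr (_ * xset k _ * _).
  by apply/setP=> j; rewrite in_sd !inE; case: eqP => [->|]; rewrite ?iI ?addbF.
have -> : sd I [set i] = i |: I.
  by apply/setP=> j; rewrite in_sd !inE; case: eqP => [->|]; rewrite ?(negbTE iI) ?addbF.
by exists ('X_i * r); rewrite (xsetD1 k (setU11 i I)) setU1K // mul1r mulrA [_ * 'X_i]mulrC.
Qed.

Lemma idem_ex I :
  exists f : G, forall s, f (mk s) = mk (fun J => if J == I then s J else 0).
Proof.
apply: mk_lift => [r s t|s t /mk_eq e].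
  by apply/funext=> J; case: eqP => // _; rewrite mulr0 addr0.
apply/mk_eq => J; case: eqP => _; first exact: e.
by exists 0; rewrite subrr mulr0.
Qed.

Definition alpha i : G := sval (cid (alpha_ex i)).
Definition idem I : G := sval (cid (idem_ex I)).

Lemma alphaE i s : alpha i (mk s) = mk (fun I => achar i I * s (sd I [set i])).
Proof. by rewrite /alpha; case: cid. Qed.

Lemma idemE I s : idem I (mk s) = mk (fun J => if J == I then s J else 0).
Proof. by rewrite /idem; case: cid. Qed.

Lemma kscal_ex (c : k) : exists f : G, forall u, f u = Rpi c%:MP *: u.
Proof.
have hf : islin (fun u : M => Rpi c%:MP *: u).
  by move=> a u v; rewrite scalerDr !scalerA mulrC.
by exists (lin_of hf : G).
Qed.

Definition kscal (c : k) : G := sval (cid (kscal_ex c)).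

Lemma kscalE c u : kscal c u = Rpi c%:MP *: u.
Proof. by rewrite /kscal; case: cid. Qed.

Lemma End_mulE (f g : G) u : (f * g) u = f (g u). Proof. by []. Qed.
Lemma End_addE (f g : G) u : (f + g) u = f u + g u. Proof. by []. Qed.
Lemma End_oppE (f : G) u : (- f) u = - f u. Proof. by []. Qed.
Lemma kscal_is_additive : {morph kscal : c d / c - d}.
Proof.
move=> c d; apply: EndP => u; rewrite End_addE End_oppE !kscalE -scalerBl.
by rewrite mpolyCB rmorphB.
Qed.

Lemma kscal_is_multiplicative : multiplicative kscal.
Proof.
split=> [c d|]; apply: EndP => u; last by rewrite kscalE mpolyC1 rmorph1 scale1r.
by rewrite End_mulE !kscalE scalerA -rmorphM mpolyCM.
Qed.

Definition kscal_rmorph : {rmorphism k -> G} :=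
  HB.pack kscal (GRing.isAdditive.Build k G kscal kscal_is_additive)
    (GRing.isMultiplicative.Build k G kscal kscal_is_multiplicative).

Definition kR : {rmorphism k -> R} := Rpi \o @mpolyC n k.

(** Going to the neighbouring summand and back is multiplication by x_i from either side: the
    relation a_i^2 = x_i. *)
Lemma achar2 i I : achar i I * achar i (sd I [set i]) = 'X_i.
Proof. by rewrite /achar in_sd !inE eqxx addbT; case: (i \in I); rewrite ?mulr1 ?mul1r. Qed.

Lemma achar_sd i j I : i != j -> achar i (sd I [set j]) = achar i I.
Proof. by rewrite /achar in_sd inE => /negbTE->; rewrite addbF. Qed.

Lemma alphaC i j u : alpha i (alpha j u) = alpha j (alpha i u).
Proof.
have [s <-] := mk_surj u; rewrite !alphaE; congr mk; apply/funext=> I.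
have [->//|ij] := eqVneq i j.
by rewrite sdAC !achar_sd // 1?eq_sym // mulrCA.
Qed.

Lemma idem_idem I J u : idem I (idem J u) = if I == J then idem J u else 0.
Proof.
have [s <-] := mk_surj u; rewrite !idemE; case: eqP => [->|IJ].
  by congr mk; apply/funext=> L; case: eqP.
have -> : 0 = mk (fun=> 0) by apply: (addrI (mk (fun=> 0))); rewrite addr0 -mkD addr0.
by congr mk; apply/funext=> L; case: eqP => // ->; case: eqP.
Qed.

Lemma mk0 : mk (fun=> 0) = 0.
Proof. by apply: (addrI (mk (fun=> 0))); rewrite addr0 -mkD addr0. Qed.

Lemma mk_sum (X : Type) (rr : seq X) (F : X -> {set 'I_n} -> S) :
  mk (fun I => \sum_(x <- rr) F x I) = \sum_(x <- rr) mk (F x).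
Proof.
elim: rr => [|x rr IH]; first by rewrite big_nil -mk0; congr mk; apply/funext=> I; rewrite big_nil.
by rewrite big_cons -IH -mkD; congr mk; apply/funext=> I; rewrite big_cons.
Qed.

Lemma idem_sum u : \sum_I idem I u = u.
Proof.
have [s <-] := mk_surj u.
under eq_bigr do rewrite idemE.
rewrite -mk_sum; congr mk; apply/funext=> J.
by rewrite (bigD1 J) //= eqxx big1 ?addr0 // => I; rewrite eq_sym => /negbTE->.
Qed.

Lemma alpha_idem i I u : alpha i (idem I u) = idem (sd I [set i]) (alpha i u).
Proof.
have [s <-] := mk_surj u; rewrite !(alphaE, idemE); congr mk; apply/funext=> J.
by rewrite (can2_eq (@sdK _ _) (@sdK _ _)); case: eqP; rewrite ?mulr0.
Qed.

(** M is a faithful module over its endomorphism ring, so identities in End(M) are tested in this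
    representation. *)
Definition Mrep : rep k n.
Proof.
exists (restr kR M) (fun i u => alpha i u) (fun I u => idem I u).
- by move=> i c u v; apply: linearP.
- by move=> I c u v; apply: linearP.
- exact: alphaC.
- exact: idem_idem.
- exact: idem_sum.
exact: alpha_idem.
Defined.

(** Only the flips that add an index to the annihilator, those in I :&: U, contribute a factor. *)
Lemma Mrep_xset U s :
  pev (xset k U) (mk s : Mrep) = mk (fun I => xset k (I :&: U) * s (sd I U)).
Proof.
have [d Ud] : exists d, #|U| = d by exists #|U|.
elim: d U Ud s => [|d IH] U Ud s.
  rewrite (cards0_eq Ud) xset0 pev1; congr mk; apply/funext=> I.
  by rewrite setI0 sd0 xset0 mul1r.
have [i iU] : exists i, i \in U by apply/set0Pn; rewrite -cards_eq0 Ud.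
have Uid : #|U :\ i| = d by move: Ud; rewrite (cardsD1 i) iU => -[].
rewrite (xsetD1 k iU) pevM IH // pevX /= alphaE; congr mk; apply/funext=> I.
rewrite mulrA /achar; congr (_ * s _); last first.
  by apply/setP=> j; rewrite !in_sd !inE; case: (eqVneq j i) => [->|_]; rewrite ?iU ?addbF.
have -> : sd I [set i] :&: (U :\ i) = (I :&: U) :\ i.
  by apply/setP=> j; rewrite !inE; case: (j == i); case: (j \in I); case: (j \in U).
case: (boolP (i \in I)) => iI; first by rewrite -xsetD1 // inE iI.
rewrite mul1r; congr xset; apply/setP=> j; rewrite !inE.
by case: (eqVneq j i) => [->|] //=; rewrite (negbTE iI).
Qed.

Lemma Mrep_sq r s : pev (sq r) (mk s : Mrep) = mk (fun I => r * s I).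
Proof.
move: r; apply: (mpoly_lin_ext (V := Mrep)) => [c p q|c p q|m].
- by rewrite /sq linearP /= (pev_linl _).
- transitivity (mk (fun I => c%:MP * (p * s I) + q * s I)).
    by congr mk; apply/funext=> I; rewrite mulrDl -scalerAl -mul_mpolyC.
  by rewrite mkD (mkZ c%:MP).
rewrite /sq comp_mpolyX mpolyXE_id; move: s; elim/big_rec2: _ => [|i p q _ IH] s.
  by rewrite pev1; congr mk; apply/funext=> I; rewrite mul1r.
rewrite pevM IH tnth_mktuple; elim: (m i) (p) => [|c IHc] p'.
  by rewrite !expr0 pev1 mul1r.
rewrite [_ ^+ c.+1]exprS pevM IHc [_ ^+ c.+1]exprS pevM !pevX /= !alphaE.
by congr mk; apply/funext=> I; rewrite sdK mulrA achar2 !mulrA.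
Qed.

(** * Homogeneous operators and the action of End(M) *)

Section Operators.
Variables (X : rep k n).
Implicit Types (x : X) (p q : S).

(** The general homogeneous operator from degree J to degree I: the part of k[a] of degree [sd I J]
    is k[a^2] times [xset k (sd I J)]. *)
Definition op I J p x : X := pev (sq p * xset k (sd I J)) (re J x).

Lemma re_op I' I J p x : re I' (op I J p x) = if I' == I then op I J p x else 0.
Proof.
rewrite /op !pevM re_pev_sq re_pev_xset rereE (sdC I J) (sdC I') -sdA.
have -> : (sd J (sd I I') == J) = (I' == I).
  apply/eqP/eqP => [e|->]; last by rewrite sdI sd0.
  apply/setP=> j; move/setP/(_ j): e; rewrite !in_sd.
  by case: (j \in I); case: (j \in I'); case: (j \in J).
by case: eqP => // _; rewrite !pev0.
Qed.

Lemma opB I J p q x : op I J (p - q) x = op I J p x - op I J q x.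
Proof. by rewrite /op /sq linearB mulrBl pevB. Qed.

Lemma opD I J p q x : op I J (p + q) x = op I J p x + op I J q x.
Proof. by rewrite /op sqD mulrDl pevD. Qed.

Lemma op0 I J x : op I J 0 x = 0.
Proof. by have := opB I J 0 0 x; rewrite !subrr. Qed.

Lemma op_sum I J (E : Type) (rr : seq E) (F : E -> S) x :
  op I J (\sum_(t <- rr) F t) x = \sum_(t <- rr) op I J (F t) x.
Proof.
by elim: rr => [|t rr IH]; rewrite !(big_nil, big_cons) ?op0 // opD IH.
Qed.

Lemma op_lin I J p : islin (op I J p).
Proof. by move=> c x y; rewrite /op (@re_lin _ _ X J) (@pev_lin _ _ X). Qed.

(** The extra factor collects the variables flipped on both legs, each giving a_i^2 = x_i. *)
Lemma op_comp I J L p q x :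
  op I J p (op J L q x) = op I L (p * q * xset k (sd I J :&: sd J L)) x.
Proof.
rewrite {1}/op re_op eqxx /op -pevM; congr (pev _ _).
have e : sd (sd I J) (sd J L) = sd I L by rewrite sdA [sd (sd I J) J]sdK.
by rewrite !sqM sq_xset mulrACA xset_sd e mulrA.
Qed.

Lemma op1 J x : op J J 1 x = re J x.
Proof. by rewrite /op sdI xset0 mulr1 /sq rmorph1 pev1. Qed.

End Operators.

Lemma op_hom (X Y : rep k n) (f : X -> Y) I J p x : rhom f -> f (op I J p x) = op I J p (f x).
Proof. by move=> hf; rewrite /op pev_hom // (dhom_re hf). Qed.

Lemma sd_setI I J : I :&: sd I J = I :\: J.
Proof. by apply/setP=> j; rewrite !inE; case: (j \in I); case: (j \in J). Qed.

Lemma Mrep_op I J r s :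
  op I J r (mk s : Mrep) = mk (fun L => if L == I then r * (xset k (I :\: J) * s J) else 0).
Proof.
have := @re_op Mrep I I J r (mk s); rewrite eqxx => <-.
rewrite /op (pevM (sq r)) [re J _]idemE Mrep_xset Mrep_sq [LHS]idemE; congr mk; apply/funext=> L.
by case: eqP => // ->; rewrite sd_setI sdA sdI sdC sd0 eqxx.
Qed.

(** The image v of 1 under R/(x_J) -> R/(x_I) satisfies x_I | x_J v. Cancelling the common factor
    leaves coprime monomials, so x_(I minus J) divides v. *)
Lemma Mrep_coef (g : G) I J : exists r, forall u, op I J r (u : Mrep) = idem I (g (idem J u)).
Proof.
pose one := mk (fun L => (L == J)%:R).
have [v ev] := mk_surj (g one).
have idemJ s : idem J (mk s) = Rpi (s J) *: one.
  rewrite idemE -mkZ; congr mk; apply/funext=> L.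
  by case: eqP => [->|]; rewrite ?mulr1 ?mulr0.
have [q eq] : exists q, xset k J * v I = xset k I * q.
  have : mk (fun L => xset k J * v L) = mk (fun=> 0).
    rewrite mkZ ev -linearZ -mkZ mk0 -[RHS](linear0 g) -mk0; congr (g _).
    apply/mk_eq => L; case: eqP => [->|_]; first by exists 1; rewrite subr0.
    by exists 0; rewrite mulr0 subr0 mulr0.
  by move=> /mk_eq/(_ I)[q]; rewrite subr0; exists q.
have [r er] : exists r, v I = xset k (I :\: J) * r.
  apply: (@xset_coprime _ _ (I :\: J) (J :\: I) q).
    rewrite -setI_eq0; apply/eqP/setP=> j; rewrite !inE.
    by case: (j \in I); case: (j \in J).
  apply: (mulfI (xset_neq0 k (I :&: J))); rewrite !mulrA -(xsetI k I J) setIC.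
  by rewrite -(xsetI k J I).
exists r => u; have [s <-] := mk_surj u.
rewrite Mrep_op idemJ linearZ_LR -ev -mkZ idemE; congr mk; apply/funext=> L.
by case: eqP => // ->; rewrite er [RHS]mulrC mulrCA mulrA.
Qed.

Lemma Mrep_coef0 I J r :
  (forall u, op I J r (u : Mrep) = 0) -> exists q, r = xset k (I :&: J) * q.
Proof.
move=> /(_ (mk (fun=> 1))); rewrite Mrep_op -mk0 => /mk_eq/(_ I)[q].
rewrite eqxx subr0 mulr1 (xsetI k I J) mulrAC => /(mulIf (xset_neq0 k _)) ->.
by exists q.
Qed.

(** An operator zero on M has a coefficient divisible by x_(I :&: J). Then it contains the factor
    x_I x_J in the a_i, so it passes through degree set0, which is zero in X. *)
Lemma op_reduced (X : rep k n) I J r (x : X) : reduced X ->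
  (forall u, op I J r (u : Mrep) = 0) -> op I J r x = 0.
Proof.
move=> X0 /Mrep_coef0[q ->]; rewrite /op sqM sq_xset.
rewrite -mulrA mulrCA -xset_sd mulrCA mulrA pevM.
have -> : pev (xset k J) (re J x) = re set0 (pev (xset k J) x).
  by rewrite re_pev_xset sdC sd0.
by rewrite X0 pev0.
Qed.

Definition coef (g : G) I J : S := sval (cid (Mrep_coef g I J)).

Lemma coefE g I J u : op I J (coef g I J) (u : Mrep) = idem I (g (idem J u)).
Proof. by rewrite /coef; case: cid. Qed.

Section Action.
Variables (X : rep k n).
Hypothesis X0 : reduced X.
Implicit Types (x : X) (g h : G).

Definition act g x : X := \sum_I \sum_J op I J (coef g I J) x.

(** [coef] is a choice, determined only up to operators that vanish on M; on reduced X any other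
    choice acts in the same way. *)
Lemma act_spec g (c : {set 'I_n} -> {set 'I_n} -> S) :
  (forall I J u, op I J (c I J) (u : Mrep) = idem I (g (idem J u))) ->
  forall x, act g x = \sum_I \sum_J op I J (c I J) x.
Proof.
move=> hc x; apply: eq_bigr => I _; apply: eq_bigr => J _.
apply/eqP; rewrite -subr_eq0 -opB; apply/eqP; apply: op_reduced => // u.
by rewrite opB coefE hc subrr.
Qed.

Lemma re_act I g x : re I (act g x) = \sum_J op I J (coef g I J) x.
Proof.
rewrite (islin_sum (@re_lin _ _ X I)) (bigD1 I) //= [X in _ + X]big1 => [|L LI].
  rewrite addr0 (islin_sum (@re_lin _ _ X I)); apply: eq_bigr => J _.
  by rewrite re_op eqxx.
rewrite (islin_sum (@re_lin _ _ X I)) big1 // => J _.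
by rewrite re_op eq_sym (negbTE LI).
Qed.

Lemma op_re I J p x : op I J p (re J x) = op I J p x.
Proof. by rewrite /op reK. Qed.

Lemma act_lin g : islin (act g).
Proof.
move=> c x y; rewrite /act scaler_sumr -big_split; apply: eq_bigr => I _ /=.
by rewrite scaler_sumr -big_split; apply: eq_bigr => J _; rewrite (@op_lin X).
Qed.

Lemma idem_lin I : islin (fun u : M => idem I u).
Proof. exact: islinP. Qed.

Lemma actM g h x : act (g * h) x = act g (act h x).
Proof.
pose c I L := \sum_J coef g I J * coef h J L * xset k (sd I J :&: sd J L).
have cE (Y : rep k n) I L (y : Y) :
    op I L (c I L) y = \sum_J op I J (coef g I J) (op J L (coef h J L) y).
  by rewrite /c op_sum; apply: eq_bigr => J _; rewrite op_comp.
rewrite (act_spec (c := c)) => [|I L u].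
  rewrite {2}/act; apply: eq_bigr => I _.
  under [LHS]eq_bigr do rewrite cE.
  rewrite exchange_big; apply: eq_bigr => J _ /=.
  by rewrite -[RHS]op_re re_act (islin_sum (@op_lin X I J _)).
rewrite cE End_mulE -[h (idem L u)]idem_sum.
rewrite linear_sum (islin_sum (@idem_lin I)); apply: eq_bigr => J _.
by rewrite (coefE h) (coefE g) idem_idem eqxx.
Qed.

Lemma actD g h x : act (g + h) x = act g x + act h x.
Proof.
rewrite (act_spec (c := fun I J => coef g I J + coef h I J)) => [|I J u].
  rewrite /act -big_split; apply: eq_bigr => I _; rewrite -big_split.
  by apply: eq_bigr => J _; rewrite opD.
by rewrite opD !coefE -(islinD (@idem_lin I)).
Qed.

Lemma act_pev g p U : (forall u, g u = pev (sq p * xset k U) (u : Mrep)) ->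
  forall x, act g x = pev (sq p * xset k U) x.
Proof.
move=> gE x; pose c I J := if sd I J == U then p else 0.
have cE (Y : rep k n) I J (y : Y) :
    op I J (c I J) y = re I (pev (sq p * xset k U) (re J y)).
  rewrite /c pevM re_pev_sq re_pev_xset rereE; case: eqP => [<-|IJU].
    by rewrite sdA sdI (sdC set0) sd0 eqxx /op pevM.
  rewrite op0; case: eqP => [e|_]; last by rewrite !pev0.
  by case: IJU; apply/setP=> j; rewrite -e !in_sd addbA addbb.
rewrite (act_spec (c := c)) => [|I J u]; last by rewrite cE gE.
rewrite -[RHS]re_sum; apply: eq_bigr => I _; rewrite -[in RHS](re_sum x).
rewrite (islin_sum (@pev_lin _ _ X _)) (islin_sum (@re_lin _ _ X I)).
by apply: eq_bigr => J _; rewrite cE.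
Qed.

Lemma act1 x : act 1 x = x.
Proof.
rewrite (act_pev (p := 1) (U := set0)) /sq rmorph1 xset0 mulr1 ?pev1 // => u.
by rewrite pev1.
Qed.

Lemma act_alpha i x : act (alpha i) x = ra i x.
Proof.
have e : sq 1 * xset k [set i] = 'X_i by rewrite /sq rmorph1 mul1r /xset big_set1.
by rewrite (act_pev (p := 1) (U := [set i])) => [|u]; rewrite e pevX.
Qed.

Lemma act_kscal c x : act (kscal c) x = c *: x.
Proof.
have e : sq c%:MP * xset k set0 = c%:MP :> S by rewrite sqC xset0 mulr1.
rewrite (act_pev (p := c%:MP) (U := set0)) => [|u]; rewrite e pevZ //.
exact: kscalE.
Qed.

Lemma act_idem J x : act (idem J) x = re J x.
Proof.
pose c I L : S := ((I == J) && (L == J))%:R.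
have cE (Y : rep k n) I L (y : Y) :
    op I L (c I L) y = if I == J then if L == J then re J y else 0 else 0.
  by rewrite /c; case: eqP => [->|_]; case: eqP => [->|_]; rewrite ?op0 ?op1.
rewrite (act_spec (c := c)) => [|I L u].
  rewrite (bigD1 J) //= [X in _ + X]big1 => [|I IJ]; last first.
    by rewrite big1 // => L _; rewrite cE (negbTE IJ).
  rewrite addr0 (bigD1 J) //= big1 => [|L LJ]; last by rewrite cE (negbTE LJ) if_same.
  by rewrite addr0 cE eqxx.
rewrite cE idem_idem; case: (I == J) => //.
by rewrite idem_idem eq_sym; case: eqP => [->|].
Qed.

End Action.

Section GammaModule.
Variables (X : rep k n) (X0 : reduced X).

(** The proof stays in the type because the module axioms depend on it and the structure has to be
    found from the type. *)
Definition gam : Type := (fun _ : reduced X => rcar X : Type) X0.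
HB.instance Definition _ := GRing.Zmodule.copy gam (rcar X).

Let gscale (g : G) (x : gam) : gam := act g (x : X).

Let gscaleA g h x : gscale g (gscale h x) = gscale (g * h) x.
Proof. by rewrite /gscale actM. Qed.

Let gscale1 : left_id 1 gscale.
Proof. by move=> x; apply: act1. Qed.

Let gscaleDr : right_distributive gscale +%R.
Proof. by move=> g x y; apply: (islinD (@act_lin X g)). Qed.

Let gscaleDl x : {morph gscale^~ x : g h / g + h}.
Proof. by move=> g h; apply: actD. Qed.

HB.instance Definition _ := GRing.Zmodule_isLmodule.Build G gam
  gscaleA gscale1 gscaleDr gscaleDl.

Lemma gamE (g : G) (x : gam) : g *: x = act g (x : X). Proof. by []. Qed.

End GammaModule.

(** * From End(M)-modules back to representations *)

Section FromModule.
Variable V : lmodType G.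

Let EndE (f g : G) : (forall u, f u = g u) -> f = g.
Proof. exact: EndP. Qed.

Let kscal_islin (g : G) c (u v : restr kscal_rmorph V) :
  (g *: (c *: u + v : V) : restr kscal_rmorph V) = c *: (g *: (u : V) : restr kscal_rmorph V) + g *: (v : V).
Proof.
have e : g * kscal c = kscal c * g.
  by apply: EndE => w; rewrite !End_mulE (kscalE _ w) kscalE linearZ_LR.
rewrite -[LHS]/(g *: (kscal c *: (u : V) + (v : V))) scalerDr scalerA e -scalerA.
by [].
Qed.

Definition toRep : rep k n.
Proof.
exists (restr kscal_rmorph V) (fun i v => (alpha i *: (v : V) : V))
  (fun I v => (idem I *: (v : V) : V)).
- by move=> i c; apply: kscal_islin.
- by move=> I c; apply: kscal_islin.
- move=> i j v; rewrite !scalerA.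
  by have -> : alpha i * alpha j = alpha j * alpha i by apply: EndE => u; apply: alphaC.
- move=> I J v; rewrite scalerA.
  have -> : idem I * idem J = if I == J then idem J else 0.
    by apply: EndE => u; rewrite End_mulE idem_idem; case: eqP.
  by case: eqP => // _; rewrite scale0r.
- move=> v; transitivity ((\sum_I idem I : G) *: (v : V)); first by rewrite scaler_suml.
  have -> : \sum_I idem I = 1 :> G; last by rewrite scale1r.
  apply: EndE => u; rewrite -[RHS]idem_sum.
  by elim/big_rec2: _ => //= I f y _ ->.
move=> i I v; rewrite !scalerA.
have -> // : alpha i * idem I = idem (sd I [set i]) * alpha i.
by apply: EndE => u; rewrite !End_mulE alpha_idem.
Defined.

(** The summand for the empty set is R/(1) = 0, so its idempotent is zero in End(M). *)
Lemma toRep_reduced : reduced toRep.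
Proof.
move=> v; rewrite -[LHS]/(idem set0 *: (v : V)).
have -> : idem set0 = 0 :> G; last by rewrite scale0r.
apply: EndE => u; have [s <-] := mk_surj u; rewrite idemE -[RHS]mk0.
apply/mk_eq => I; case: eqP => [->|_]; last by exists 0; rewrite subr0 mulr0.
by exists (s set0); rewrite subr0 xset0 mul1r.
Qed.

End FromModule.

Let eval_module (V : lmodType G) (v : V) : rhom (fun g : toRep G^o => (g : G) *: v : toRep V).
Proof.
split=> [c g h|I g|i g _].
- rewrite -[LHS]/((kscal c * (g : G) + (h : G)) *: v) scalerDl -scalerA.
  by [].
- by rewrite -[LHS]/((idem I * (g : G)) *: v) -scalerA.
by rewrite -[LHS]/((alpha i * (g : G)) *: v) -scalerA.
Qed.

Let eval_point (u : M) : rhom (fun g : toRep G^o => (g : G) u : Mrep).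
Proof.
split=> // c g h.
rewrite -[LHS]/(kscal c ((g : G) u) + (h : G) u) kscalE.
by [].
Qed.

(** The operators are applied to 1 in the regular module. Evaluation at points of M shows that they
    add up to g, and evaluation at v carries this sum to V. *)
Lemma act_toRep (V : lmodType G) (g : G) (v : toRep V) : act g v = g *: (v : V).
Proof.
pose ga I J : G := op I J (coef g I J) ((1 : G) : toRep G^o).
have opV I J : op I J (coef g I J) v = ga I J *: (v : V).
  have := op_hom I J (coef g I J) ((1 : G) : toRep G^o) (eval_module v).
  by rewrite scale1r => <-.
have opM I J u : op I J (coef g I J) (u : Mrep) = ga I J u.
  exact: esym (op_hom I J (coef g I J) ((1 : G) : toRep G^o) (eval_point u)).
have eg : g = \sum_I \sum_J ga I J.
  apply: EndP => u; transitivity (\sum_I \sum_J ga I J u).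
    under eq_bigr do under eq_bigr do rewrite -opM coefE.
    under eq_bigr do rewrite -(islin_sum (@idem_lin _)) -linear_sum idem_sum.
    by rewrite idem_sum.
  by elim/big_rec2: _ => //= I f y _ ->; congr (_ + _); elim/big_rec2: _ => //= J f' y' _ ->.
transitivity (\sum_I \sum_J ga I J *: (v : V)).
  by apply: eq_bigr => I _; apply: eq_bigr => J _; apply: opV.
rewrite [in RHS]eg scaler_suml; apply: eq_bigr => I _.
by rewrite scaler_suml.
Qed.

Lemma act_hom (X Y : rep k n) (f : X -> Y) g x : rhom f -> f (act g x) = act g (f x).
Proof.
move=> hf; rewrite /act (islin_sum (dhom_lin hf)); apply: eq_bigr => I _.
by rewrite (islin_sum (dhom_lin hf)); apply: eq_bigr => J _; apply: op_hom.
Qed.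

Lemma gam_hom (X Y : rep k n) (X0 : reduced X) (Y0 : reduced Y) (f : X -> Y) :
  rhom f -> @islin G (gam X0) (gam Y0) f.
Proof.
move=> hf g x y; rewrite !gamE -(act_hom _ _ hf).
exact: (islinD (dhom_lin hf)).
Qed.

(** With [act_toRep] this identifies reduced representations and left End(M)-modules, on morphisms
    as well. *)
Lemma rhom_toRep (X : rep k n) (X0 : reduced X) (V : lmodType G) (f : X -> V) :
  rhom (f : X -> toRep V) <-> @islin G (gam X0) V f.
Proof.
split=> [hf g x y|hf].
  rewrite gamE -act_toRep -(act_hom _ _ hf).
  exact: (islinD (dhom_lin hf)).
have fE g x : f (act g x) = g *: f x.
  exact: (islinZ hf g x).
split=> [c x y|I x|i x _].
- rewrite -(act_kscal X0) (islinD hf (act _ x)) fE.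
  by [].
- by rewrite -(act_idem X0) fE.
by rewrite -(act_alpha X0) fE.
Qed.

End GradedModule.

(** * Corner rings *)

Section SubZmodule.
Variable V : zmodType.

Record subz := Subz {
  subz_mem :> V -> Prop;
  subz0 : subz_mem 0;
  subzB : forall x y, subz_mem x -> subz_mem y -> subz_mem (x - y) }.

Variable N : subz.

Definition szmem : {pred V} := fun x => `[< N x >].

Lemma szmem_closed : zmod_closed szmem.
Proof.
split; first by apply/asboolP/subz0.
by move=> x y /asboolP Nx /asboolP Ny; apply/asboolP/subzB.
Qed.

HB.instance Definition _ := GRing.isZmodClosed.Build V szmem szmem_closed.

Record szmod := SzMod { szval : V; szvalP : szval \in szmem }.
HB.instance Definition _ := [isSub for szval].
HB.instance Definition _ := [Choice of szmod by <:].
HB.instance Definition _ := [SubChoice_isSubZmodule of szmod by <:].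

Definition szk x (Nx : N x) : szmod := SzMod (introT (asboolP (N x)) Nx).

Lemma szval_mem (z : szmod) : N (szval z).
Proof. exact/asboolP/szvalP. Qed.

Lemma szval_inj : injective szval.
Proof. exact: val_inj. Qed.

Lemma szvalD (x y : szmod) : szval (x + y) = szval x + szval y.
Proof. by []. Qed.

End SubZmodule.

(* G' is the corner e G e with e = c 1; c is the (non-unital) inclusion and
   d u stands for the element e u e of the corner. *)
Record corner (G G' : pzRingType) := Corner {
  cin : G' -> G;
  cout : G -> G';
  cinD : forall g h, cin (g + h) = cin g + cin h;
  cinM : forall g h, cin (g * h) = cin g * cin h;
  coutK : forall g, cout (cin g) = g;
  cinK : forall u, cin (cout u) = cin 1 * u * cin 1 }.

Section CornerModules.
Variables (G G' : pzRingType) (T : corner G G').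

Local Notation c := (cin T).
Local Notation d := (cout T).
Local Notation e := (c 1).

Lemma cin_inj : injective c. Proof. exact: can_inj (@coutK _ _ T). Qed.
Lemma cin1l g : e * c g = c g. Proof. by rewrite -cinM mul1r. Qed.
Lemma cin1r g : c g * e = c g. Proof. by rewrite -cinM mulr1. Qed.
Lemma cin11 : e * e = e. Proof. exact: cin1l. Qed.

Lemma coutM g u : d (c g * u) = g * d u.
Proof. by apply: cin_inj; rewrite cinM !cinK !mulrA cin1l cin1r. Qed.

Lemma coutD u v : d (u + v) = d u + d v.
Proof. by apply: cin_inj; rewrite cinD !cinK mulrDr mulrDl. Qed.

Section Restriction.
Variable V : lmodType G.

Definition fix_subz : subz V.
Proof.
exists (fun v => e *: v = v); first by rewrite scaler0.
by move=> x y ex ey; rewrite scalerBr ex ey.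
Defined.

Definition res := szmod fix_subz.
HB.instance Definition _ := GRing.Zmodule.on res.

Lemma res_fix g (z : res) : e *: (c g *: szval z) = c g *: szval z.
Proof. by rewrite scalerA cin1l. Qed.

Definition res_scale (g : G') (z : res) : res := @szk _ fix_subz _ (res_fix g z).

Lemma res_scaleA g h z : res_scale g (res_scale h z) = res_scale (g * h) z.
Proof. by apply: szval_inj; rewrite /= scalerA cinM. Qed.

Lemma res_scale1 : left_id 1 res_scale.
Proof. by move=> z; apply: szval_inj; apply: (szval_mem z). Qed.

Lemma res_scaleDr : right_distributive res_scale +%R.
Proof. by move=> g x y; apply: szval_inj; apply: scalerDr. Qed.

Lemma res_scaleDl z : {morph res_scale^~ z : g h / g + h}.
Proof. by move=> g h; apply: szval_inj; rewrite /= cinD scalerDl. Qed.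

HB.instance Definition _ := GRing.Zmodule_isLmodule.Build G' res
  res_scaleA res_scale1 res_scaleDr res_scaleDl.

Lemma res_valL g (x y : res) : szval (g *: x + y) = c g *: szval x + szval y.
Proof. by []. Qed.

Lemma res_e (v : V) : e *: (e *: v) = e *: v.
Proof. by rewrite scalerA cin11. Qed.

Definition resk (v : V) : res := @szk _ fix_subz _ (res_e v).

Lemma reskK (z : res) : resk (szval z) = z.
Proof. by apply: szval_inj; apply: (szval_mem z). Qed.

End Restriction.

Lemma res_map (V W : lmodType G) (f : V -> W) : islin f ->
  exists f' : res V -> res W, islin f' /\ forall z, szval (f' z) = f (szval z).
Proof.
move=> hf; have fz (z : res V) : fix_subz W (f (szval z)).
  by rewrite /= -(islinZ hf) (szval_mem z).
exists (fun z => szk (fz z)); split=> // g x y; apply: szval_inj.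
exact: (hf (c g) (szval x) (szval y)).
Qed.

Lemma res_ses (K P X : lmodType G) (i : K -> P) (p : P -> X)
    (i' : res K -> res P) (p' : res P -> res X) :
  @ses (lmodcat G) K P X i p ->
  islin i' -> (forall z, szval (i' z) = i (szval z)) ->
  islin p' -> (forall z, szval (p' z) = p (szval z)) ->
  @ses (lmodcat G') (res K) (res P) (res X) i' p'.
Proof.
move=> s hi' i'E hp' p'E; have hi : islin i := ses_homl s; have hp : islin p := ses_homr s.
split=> // [x y /(congr1 (@szval _ _))|z|z].
- by rewrite !i'E => /(ses_inj s)/szval_inj.
- have [y ey] := ses_surj s (szval z); exists (resk y); apply: szval_inj.
  by rewrite p'E /= (islinZ hp) ey (szval_mem z).
split=> [/(congr1 (@szval _ _))|[w <-]]; last first.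
  by apply: szval_inj; rewrite p'E i'E (ses0 s).
rewrite p'E => /(ses_ker s)[w ew]; exists (resk w); apply: szval_inj.
by rewrite i'E /= (islinZ hi) ew (szval_mem z).
Qed.

Section Coinduction.
Variable Y : lmodType G'.

(** This is Hom over eGe from eG to Y, written on all of G: the case g = 1 forces phi (e u) = phi
    u. *)
Definition coind_subz : subz (G -> Y).
Proof.
exists (fun phi => (forall u v, phi (u + v) = phi u + phi v) /\
                   forall g u, phi (c g * u) = g *: phi u).
- by split=> [u v|g u]; rewrite ?addr0 ?scaler0.
move=> f h [fD fZ] [hD hZ]; split=> [u v|g u].
  by rewrite -[LHS]/(f (u + v) - h (u + v)) fD hD opprD addrACA.
by rewrite -[LHS]/(f (c g * u) - h (c g * u)) fZ hZ -scalerBr.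
Defined.

Definition coind := szmod coind_subz.
HB.instance Definition _ := GRing.Zmodule.on coind.

Definition coev (x : coind) : G -> Y := szval x.

Lemma coevD (x : coind) u v : coev x (u + v) = coev x u + coev x v.
Proof. by have [fD _] := szval_mem x; apply: fD. Qed.

Lemma coevZ (x : coind) g u : coev x (c g * u) = g *: coev x u.
Proof. by have [_ fZ] := szval_mem x; apply: fZ. Qed.

Lemma coev_e (x : coind) u : coev x (e * u) = coev x u.
Proof. by rewrite coevZ scale1r. Qed.

Lemma coev_ext (x y : coind) : (forall u, coev x u = coev y u) -> x = y.
Proof. by move=> xy; apply: szval_inj; apply/funext. Qed.

Lemma coind_mulr g (x : coind) : coind_subz (fun u => coev x (u * g)).
Proof. by split=> [u v|h u]; rewrite ?mulrDl ?coevD // -mulrA coevZ. Qed.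

Definition coind_scale (g : G) (x : coind) : coind := szk (coind_mulr g x).

Lemma coind_scaleA g h x : coind_scale g (coind_scale h x) = coind_scale (g * h) x.
Proof. by apply: coev_ext => u; rewrite /coev /= /coev /= mulrA. Qed.

Lemma coind_scale1 : left_id 1 coind_scale.
Proof. by move=> x; apply: coev_ext => u; rewrite {1}/coev /= mulr1. Qed.

Lemma coind_scaleDr : right_distributive coind_scale +%R.
Proof. by move=> g x y; apply: coev_ext. Qed.

Lemma coind_scaleDl x : {morph coind_scale^~ x : g h / g + h}.
Proof. by move=> g h; apply: coev_ext => u; rewrite {1}/coev /= mulrDr coevD. Qed.

HB.instance Definition _ := GRing.Zmodule_isLmodule.Build G coind
  coind_scaleA coind_scale1 coind_scaleDr coind_scaleDl.

Lemma coevS g (x : coind) u : coev (g *: x) u = coev x (u * g).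
Proof. by []. Qed.

Lemma coevDl (x y : coind) u : coev (x + y) u = coev x u + coev y u.
Proof. by []. Qed.

(** With [eps] = 1 this inverts evaluation at 1 on the corner part; with [eps] = [idem J] it yields
    elements of degree J. *)
Lemma coind_of_subz (eps : G) (y : Y) : coind_subz (fun u => d (u * eps) *: y).
Proof.
split=> [u v|g u]; first by rewrite mulrDl coutD scalerDl.
by rewrite -mulrA coutM scalerA.
Qed.

Definition coind_of eps y : coind := szk (coind_of_subz eps y).

Lemma coind_ofE eps y u : coev (coind_of eps y) u = d (u * eps) *: y.
Proof. by []. Qed.

Lemma res_coind_lin : islin (fun z : res coind => coev (szval z) 1).
Proof.
move=> g x y; rewrite res_valL coevDl coevS mul1r; congr (_ + _).
by rewrite -[c g]mulr1 coevZ.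
Qed.

Lemma coev_res (z : res coind) u : coev (szval z) u = d u *: coev (szval z) 1.
Proof.
have ez : e *: szval z = szval z := szval_mem z.
by rewrite -coevZ mulr1 cinK -mulrA coev_e -coevS ez.
Qed.

(** Coinducing and cutting down by e returns Y, so every module over the corner is a restriction. *)
Lemma res_coindK : exists f : Y -> res coind,
  [/\ islin f, cancel f (fun z => coev (szval z) 1)
    & cancel (fun z => coev (szval z) 1) f].
Proof.
have fixed y : fix_subz coind (coind_of 1 y).
  apply: coev_ext => u; rewrite coevS !coind_ofE !mulr1; congr (_ *: _).
  by apply: cin_inj; rewrite !cinK -!mulrA cin11.
have d1 : d 1 = 1 by apply: cin_inj; rewrite cinK mulr1 cin11.
pose f y : res coind := szk (fixed y).
have fK : cancel f (fun z => coev (szval z) 1).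
  by move=> y; rewrite -[LHS]/(coev (coind_of 1 y) 1) coind_ofE mulr1 d1 scale1r.
have fK' : cancel (fun z => coev (szval z) 1) f.
  move=> z; apply: szval_inj; apply: coev_ext => u.
  by rewrite -[LHS]/(coev (coind_of 1 _) u) coind_ofE mulr1 -coev_res.
exists f; split=> // g x y; apply: (can_inj fK').
by rewrite res_coind_lin !fK.
Qed.

Lemma coind_adj (V : lmodType G) (f : res V -> Y) : islin f ->
  exists h : V -> coind, islin h /\ forall v u, coev (h v) u = f (resk (u *: v)).
Proof.
move=> hf; have hv (v : V) : coind_subz (fun u => f (resk (u *: v))).
  split=> [u w|g u].
    rewrite -(islinD hf); congr f; apply: szval_inj.
    by rewrite szvalD /= scalerDl scalerDr.
  rewrite -(islinZ hf); congr f; apply: szval_inj.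
  by rewrite /= !scalerA mulrA cin1l cin1r.
exists (fun v => szk (hv v)); split=> // g v w; apply: coev_ext => u.
rewrite coevDl coevS.
rewrite -(islinD hf); congr f; apply: szval_inj.
by rewrite szvalD /= !scalerDr !scalerA !mulrA.
Qed.

Lemma coind_adj' (V : lmodType G) (h : V -> coind) : islin h ->
  islin (fun z : res V => coev (h (szval z)) 1).
Proof.
move=> hh g x y; rewrite res_valL hh coevDl coevS mul1r; congr (_ + _).
by rewrite -[c g]mulr1 coevZ.
Qed.

End Coinduction.

Lemma coind_map (Y Z : lmodType G') (f : Y -> Z) : islin f ->
  exists h : coind Y -> coind Z, islin h /\ forall x u, coev (h x) u = f (coev x u).
Proof.
move=> hf; have hx (x : coind Y) : coind_subz Z (fun u => f (coev x u)).
  by split=> [u v|g u]; rewrite ?coevD ?coevZ ?(islinD hf) ?(islinZ hf).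
exists (fun x => szk (hx x)); split=> // g x y; apply: coev_ext => u.
exact: (islinD hf).
Qed.

End CornerModules.

(** * Upper bounds for the global dimension *)

Section DegreePart.
Variables (k : fieldType) (n : nat) (X : rep k n) (A : {set {set 'I_n}}).

Definition degpart_subm : subm X.
Proof.
exists (fun x => forall I, I \notin A -> re I x = 0).
  by move=> I _; apply: islin0 (@re_lin _ _ X I).
move=> a x y x0 y0 I IA; rewrite (@re_lin _ _ X I).
by rewrite x0 // y0 // scaler0 addr0.
Defined.

Lemma degpart_re J (z : smod degpart_subm) : degpart_subm (re J (smval z)).
Proof.
move=> I IA; rewrite rereE; case: eqP => // <-.
exact: (smval_mem z I IA).
Qed.

(* The degrees in A of X, with the a_i made to act by 0. *)
Definition degpart : rep k n.
Proof.
exists (smod degpart_subm) (fun i _ => 0) (fun J z => smk (degpart_re J z)) => //.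
- by move=> i a x y; rewrite scaler0 addr0.
- by move=> I a x y; apply: smval_inj; apply: re_lin.
- by move=> I J z; apply: smval_inj; rewrite /= rereE; case: eqP.
- move=> z; apply: smval_inj; rewrite (islin_sum (@smvalL _ _ degpart_subm)) /=.
  exact: re_sum.
by move=> i I z; apply/esym/smval_inj; apply: islin0 (@re_lin _ _ X _).
Defined.

Definition degpart_val (z : degpart) : X := @smval _ _ degpart_subm z.

Lemma degpart_val_hom : dhom setT degpart_val.
Proof. by split=> // i x; rewrite inE. Qed.

Lemma degpart_out I (z : degpart) : I \notin A -> re I z = 0.
Proof. by move=> IA; apply: smval_inj; apply: (smval_mem z I IA). Qed.

Lemma degpart_ex J (x : X) : J \in A -> exists z, degpart_val z = re J x.
Proof.
move=> JA; have N : degpart_subm (re J x).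
  by move=> I IA; rewrite rereE; case: eqP IA => // ->; rewrite JA.
by exists (smk N).
Qed.

End DegreePart.

Section Phi.
Variables (k : fieldType) (n : nat) (T : gmod k n) (G' : pzRingType).
Variable C : corner (End (gM T)) G'.
(* gd: the degrees of the summands of M that the corner keeps *)
Variable gd : {set {set 'I_n}}.
Local Notation G := (End (gM T)).
Local Notation e := (cin C 1).
Hypothesis e_idem : forall J, e * idem T J = if J \in gd then idem T J else 0.
Hypothesis idem_e : forall J, idem T J * e = if J \in gd then idem T J else 0.

Implicit Types (X Y Z P Q : rep k n) (I J D : {set 'I_n}) (i j : 'I_n).

Definition Gam X : lmodType G := gam (@reduced_red _ _ X).
Definition Phi X : lmodType G' := res C (Gam X).

Lemma GamE (g : G) X (x : Gam X) : g *: x = act g (x : red X).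
Proof. by []. Qed.

Lemma sum_idem : \sum_J idem T J = 1 :> G.
Proof.
by apply: EndP => u; rewrite -[RHS](idem_sum (T := T)); elim/big_rec2: _ => //= J f y _ ->.
Qed.

Lemma e_red X (x : X) : e *: (red_pi x : Gam X) = red_pi (\sum_(J in gd) re J x).
Proof.
have -> : e = \sum_(J in gd) idem T J :> G.
  rewrite -[e]mulr1 -sum_idem mulr_sumr big_mkcond /=.
  by rewrite [RHS]big_mkcond; apply: eq_bigr => J _; rewrite e_idem.
rewrite (islin_sum (dhom_lin (red_pi_hom X))) scaler_suml; apply: eq_bigr => J _.
rewrite GamE (act_idem _ (@reduced_red _ _ X)).
by rewrite (dhom_re (red_pi_hom X)).
Qed.

Lemma Phi_val X (z : Phi X) : exists x : X, szval z = red_pi (\sum_(J in gd) re J x).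
Proof.
have [x ex] := red_pi_surj (szval z : red X); exists x.
by rewrite -e_red ex; apply/esym; apply: (szval_mem z).
Qed.

Lemma Gam_map X Y (f : X -> Y) : rhom f -> exists g : Gam X -> Gam Y,
  islin g /\ forall x, g (red_pi x) = red_pi (f x).
Proof.
move=> /red_ex[g [hg gE]]; exists g; split=> //.
exact: gam_hom.
Qed.

Lemma Phi_map X Y (f : X -> Y) : rhom f -> exists g : Phi X -> Phi Y,
  islin g /\ forall z x, szval z = red_pi x -> szval (g z) = red_pi (f x).
Proof.
move=> /Gam_map[g [hg gE]]; have [h [hh hE]] := res_map C hg.
by exists h; split=> // z x ez; rewrite hE ez gE.
Qed.

Lemma Phi_ses_val (K P X : rep k n) (i : K -> P) (p : P -> X) :
  @ses (repcat k n) K P X i p -> good X ->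
  exists (i' : Phi K -> Phi P) (p' : Phi P -> Phi X),
    @ses (lmodcat G') (Phi K) (Phi P) (Phi X) i' p' /\
    forall z x, szval z = red_pi x -> szval (i' z) = red_pi (i x).
Proof.
move=> s gX; have [i1 [hi1 i1E]] := red_ex (ses_homl s).
have [p1 [hp1 p1E]] := red_ex (ses_homr s).
have s1 := red_ses s gX hi1 i1E hp1 p1E.
have s2 : @ses (lmodcat G) (Gam K) (Gam P) (Gam X) i1 p1.
  split; [exact: gam_hom|exact: gam_hom|exact: ses_inj s1|exact: ses_surj s1|].
  exact: ses_ker s1.
have [i' [hi' i'E]] := res_map C (ses_homl s2).
have [p' [hp' p'E]] := res_map C (ses_homr s2).
exists i', p'; split; first exact: (res_ses s2).
by move=> z x ez; rewrite i'E ez i1E.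
Qed.

Lemma Phi_ses (K P X : rep k n) (i : K -> P) (p : P -> X) :
  @ses (repcat k n) K P X i p -> good X ->
  exists (i' : Phi K -> Phi P) (p' : Phi P -> Phi X),
    @ses (lmodcat G') (Phi K) (Phi P) (Phi X) i' p'.
Proof. by move=> s /(Phi_ses_val s)[i' [p' [s' _]]]; exists i', p'. Qed.

Lemma Phi_retract X Y (i : X -> Y) (r : Y -> X) : rhom i -> rhom r -> cancel i r ->
  exists (i' : Phi X -> Phi Y) (r' : Phi Y -> Phi X), [/\ islin i', islin r' & cancel i' r'].
Proof.
move=> /Phi_map[i' [hi' i'E]] /Phi_map[r' [hr' r'E]] ri; exists i', r'; split=> // z.
apply: szval_inj; have [x ex] := Phi_val z.
by rewrite (r'E _ _ (i'E _ _ ex)) ri.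
Qed.

Lemma Phi_biprod (X Y S : rep k n) (i1 : X -> S) (i2 : Y -> S) (p1 : S -> X) (p2 : S -> Y) (d : nat) :
  rhom i1 -> rhom i2 -> rhom p1 -> rhom p2 -> cancel i1 p1 -> cancel i2 p2 ->
  (forall x, p2 (i1 x) = 0) -> (forall s, i1 (p1 s) + i2 (p2 s) = s) ->
  PD d (Phi X : ob (lmodcat G')) -> PD d (Phi Y : ob (lmodcat G')) ->
  PD d (Phi S : ob (lmodcat G')).
Proof.
move=> /Phi_map[j1 [hj1 j1E]] /Phi_map[j2 [hj2 j2E]] /Phi_map[q1 [hq1 q1E]] /Phi_map[q2 [hq2 q2E]].
move=> c1 c2 c12 cs; apply: (PD_ext (C := lmodcat G') (i := j1) (p := q2)); split=> //.
- apply: (can_inj (g := q1)) => z; apply: szval_inj; have [x ex] := Phi_val z.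
  by rewrite (q1E _ _ (j1E _ _ ex)) c1.
- move=> z; exists (j2 z); apply: szval_inj; have [x ex] := Phi_val z.
  by rewrite (q2E _ _ (j2E _ _ ex)) c2.
move=> z; split=> [z0|[w <-]].
  exists (q1 z); apply: szval_inj; have [x ex] := Phi_val z.
  have := q2E _ _ ex; rewrite z0 => /esym e0; rewrite (j1E _ _ (q1E _ _ ex)) ex.
  rewrite -[in RHS](cs (\sum_(J in gd) _)) (islinD (dhom_lin (red_pi_hom S))).
  by rewrite -(j2E 0 _ (esym e0)) (islin0 hj2) addr0.
apply: szval_inj; have [x ex] := Phi_val w.
by rewrite (q2E _ _ (j1E _ _ ex)) c12 (islin0 (dhom_lin (red_pi_hom Y))).
Qed.

Lemma toRep_map (V W : lmodType G) (f : V -> W) : islin f -> rhom (f : toRep V -> toRep W).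
Proof.
move=> hf; split=> [c x y|I x|i x _].
- by rewrite -[LHS]/(f (kscal T c *: (x : V) + y)) hf.
- exact: (islinZ hf).
exact: (islinZ hf).
Qed.

(** By adjunction the lifting problem moves to coinduced modules. Coinducing need not preserve
    surjections, but it does so in the degrees of [gd]; degree set0 is zero anyway. *)
Lemma Phi_proj (JJ : {set 'I_n} -> Prop) X : relproj set0 JJ X ->
  (forall J, JJ J -> J \in gd \/ J = set0) -> proj (Phi X : ob (lmodcat G')).
Proof.
move=> pX JJgd Z Y g f hg hf sg.
have [f1 [hf1 f1E]] := coind_adj hf.
have hf2 : rhom ((f1 : red X -> toRep (coind C Y)) \o @red_pi _ _ X).
  by apply: rhom_comp (red_pi_hom X) _; apply/(rhom_toRep (@reduced_red _ _ X)).
have [g1 [hg1 g1E]] := coind_map C hg.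
have [|h [hh gh]] := pX (toRep (coind C Y)) (toRep (coind C Z)) g1 _ (toRep_map hg1) hf2.
  move=> J y /JJgd[Jgd|->] ey; last first.
    exists 0; rewrite (islin0 hg1) -ey.
    exact: esym (toRep_reduced _).
  have [z ez] := sg (coev (y : coind C Y) 1).
  (* For J in [gd] an element of degree J is determined by its value at 1, so a preimage of that
     value suffices. *)
  exists (coind_of C (idem T J) z); apply: coev_ext => u.
  rewrite g1E coind_ofE (islinZ hg) ez -coevZ mulr1 cinK -mulrA coev_e.
  rewrite -mulrA idem_e Jgd -[in RHS]ey.
  by [].
have [h1 [hh1 h1E]] := red_desc hh (@toRep_reduced _ _ _ (coind C Z)).
have hh1' : @islin G (Gam X) (coind C Z) h1 by apply/(rhom_toRep (@reduced_red _ _ X)).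
exists (fun z => coev (h1 (szval z) : coind C Z) 1); split; first exact: coind_adj'.
move=> z; have [x ex] := Phi_val z; rewrite ex h1E -g1E gh /= f1E -ex scale1r.
by rewrite reskK.
Qed.

(** Take the representation of the coinduced module: it is already reduced, and cutting it down
    gives Y back. *)
Lemma Phi_coind (Y : lmodType G') : exists (X : rep k n) (f : Phi X -> Y) (g : Y -> Phi X),
  reduced X /\ [/\ islin f, islin g, cancel f g & cancel g f].
Proof.
pose X := toRep (coind C Y); have X0 : reduced X := @toRep_reduced _ _ _ (coind C Y).
exists X; have [f1 [hf1 f1E]] := red_desc (@rhom_id _ _ X) X0.
have hf1' : @islin G (Gam X) (coind C Y) f1 by apply/(rhom_toRep (@reduced_red _ _ X)).
have hpi : @islin G (coind C Y) (Gam X) (@red_pi _ _ X).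
  apply: (@islin_cancelr G (Gam X) (coind C Y) (Gam X) f1) => //.
    by move=> x; exists (red_pi (x : X)); apply: f1E.
  have -> : @red_pi _ _ X \o f1 = id; last exact: islin_id.
  by apply/funext=> q /=; have [x <-] := red_pi_surj q; rewrite f1E.
have [f2 [hf2 f2E]] := res_map C hf1'; have [g2 [hg2 g2E]] := res_map C hpi.
have [r [hr rK Kr]] := res_coindK C Y.
have fg2 : cancel f2 g2.
  move=> z; apply: szval_inj; rewrite g2E f2E.
  by have [x ->] := Phi_val z; rewrite f1E.
have gf2 : cancel g2 f2 by move=> z; apply: szval_inj; rewrite f2E g2E f1E.
exists ((fun z => coev (szval z) 1) \o f2), (g2 \o r); split=> //; split.
- exact: islin_comp hf2 (@res_coind_lin _ _ C Y).
- exact: islin_comp hr hg2.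
- exact: can_comp Kr fg2.
exact: can_comp gf2 rK.
Qed.

(** Exactness persists along the resolution because each syzygy lies in a projective, hence is good.
    Each of the d steps then adds one to the m allowed for projectives. *)
Lemma Phi_PD_le (d m : nat) X : (forall P, proj (P : ob (repcat k n)) -> PD m (Phi P : ob (lmodcat G'))) ->
  good X -> PD d (X : ob (repcat k n)) -> PD (d + m) (Phi X : ob (lmodcat G')).
Proof.
move=> pm; elim: d X => [|d IH] X gX; first exact: pm.
move=> [K [P [i [p [s pP dK]]]]]; have [i' [p' s']] := Phi_ses s gX.
have gK : good K := good_sub (ses_homl s) (ses_inj s) (proj_good pP).
apply: (PD_coker s'); first exact: IH.
by apply: PD_leq (pm _ pP); rewrite -addSn leq_addl.
Qed.

Lemma Phi_surj X Y (f : X -> Y) (g : Phi X -> Phi Y) : rhom f -> islin g ->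
  (forall z x, szval z = red_pi x -> szval (g z) = red_pi (f x)) ->
  (forall J y, J \in gd -> re J y = y -> exists x, f x = y) -> surj g.
Proof.
move=> hf hg gE sf z; have [y ey] := Phi_val z.
have /choice[x xE] : forall J, exists x, J \in gd -> f x = re J y.
  move=> J; have [Jgd|Jgd] := boolP (J \in gd); last by exists 0.
  by have [x ex] := sf J (re J y) Jgd (reK _ _); exists x.
pose x0 : X := \sum_(J in gd) re J (x J).
have fx0 : f x0 = \sum_(J in gd) re J y.
  rewrite (islin_sum (dhom_lin hf)); apply: eq_bigr => J Jgd.
  by rewrite (dhom_re hf) xE // reK.
exists (resk C (red_pi x0 : Gam X)); apply: szval_inj.
rewrite (gE _ (\sum_(J in gd) re J x0)); last exact: e_red.
rewrite ey; congr red_pi; rewrite (islin_sum (dhom_lin hf)); apply: eq_bigr => J Jgd.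
rewrite (dhom_re hf) fx0 (islin_sum (@re_lin _ _ Y J)) (bigD1 J) //= reK big1 ?addr0 // => L.
by case/andP=> _ LJ; rewrite rereE eq_sym (negbTE LJ).
Qed.

(** Generators are needed only in the degrees kept by the corner; the free representation on that
    part of X has a projective image. *)
Lemma enough_proj (n0 : 'I_n) (Y : ob (lmodcat G')) :
  exists (P : ob (lmodcat G')) (p : lmodcat G' P -> lmodcat G' Y), [/\ proj P, hom p & surj p].
Proof.
have [X [f [g [_ [hf hg fg gf]]]]] := Phi_coind Y.
have [|X' [j [pX' hj ej]]] := @free_cover _ _ n0 (fun J => J \in gd) (degpart X gd).
  by move=> I x /negP; apply: degpart_out.
have [h [hh hE]] := ej _ _ (@degpart_val_hom _ _ X gd).
have [p [hp pE]] := Phi_map hh.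
exists (Phi X'), (f \o p); split.
- by apply: Phi_proj pX' _ => J ->; left.
- exact: islin_comp hp hf.
have sp : surj p.
  apply: Phi_surj hh hp pE _ => J y Jgd ey.
  by have [z ez] := degpart_ex y Jgd; exists (j z); rewrite hE ez.
by move=> y; have [z ez] := sp (g y); exists z; rewrite /= ez gf.
Qed.

Lemma Phi_gldim m (Y : ob (lmodcat G')) :
  (forall P, proj (P : ob (repcat k n)) -> PD m (Phi P : ob (lmodcat G'))) -> PD (n + m) Y.
Proof.
move=> pm; have [X [f [g [X0 [hf hg fg gf]]]]] := Phi_coind Y.
apply: (@PD_iso (lmodcat G') (n + m) (Phi X) Y f g hf hg fg gf).
by apply: Phi_PD_le pm (reduced_good X0) _; apply: rep_PD.
Qed.

Lemma Phi_proj_all : (forall J, J \in gd \/ J = set0) ->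
  forall P, proj (P : ob (repcat k n)) -> proj (Phi P : ob (lmodcat G')).
Proof. by move=> gdT P /proj_relproj pP; apply: Phi_proj pP _ => J _; apply: gdT. Qed.

(** * Projectives after removing a nonempty degree K *)

Section OneDegreeRemoved.
Variables (K : {set 'I_n}) (n0 : 'I_n).
Hypotheses (n0K : n0 \in K) (gdK : gd = ~: [set K]).

Let mem_gd J : J <> K -> J \in gd.
Proof. by move=> JK; rewrite gdK !inE; apply/eqP. Qed.

(** A representation in degrees containing n0 has nothing in degree set0, so it is good and its
    Koszul sequences stay exact under [Phi]. *)
Let above X := forall I (x : X), n0 \notin I -> re I x = 0.

Let above_good X : above X -> good X.
Proof. by move=> aX; apply: reduced_good => x; apply: aX; rewrite inE. Qed.

Let above_ext i X : i != n0 -> above X -> above (ext i X).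
Proof.
move=> i0 aX I z n0I; apply: ext_coef => m; rewrite ext_reE; apply: aX.
rewrite in_sd (negbTE n0I) /par; case: (odd m); rewrite inE //.
by rewrite eq_sym.
Qed.

Let above_tw i X : i != n0 -> above X -> above (tw i X).
Proof.
by move=> i0 aX I z n0I; apply: aX; rewrite in_sd (negbTE n0I) inE eq_sym.
Qed.

Let relproj_tw1 i D J X : relproj D (eq J) X -> relproj D (eq (sd J [set i])) (tw i X).
Proof.
move=> /(relproj_tw (i := i)) pX; apply: relproj_weaken pX => J' ->.
by rewrite sdK.
Qed.

(* Flipping coordinates of J inside D never reaches the removed degree K. *)
Let PD_off_K D J X : n0 \in D -> relproj D (eq J) X -> above X ->
  (exists2 j, j \notin D & (j \in J) != (j \in K)) -> PD #|D| (Phi X : ob (lmodcat G')).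
Proof.
have [d Dd] : exists d, #|D| = d by exists #|D|.
elim: d D J X Dd => [|d IH] D J X Dd n0D pX aX [j jD jJK].
  by rewrite (cards0_eq Dd) inE in n0D.
have gX := above_good aX; rewrite Dd.
have [i iD i0] : exists2 i, i \in D & i != n0 \/ D = [set n0].
  have [D0|/set0Pn[i]] := eqVneq (D :\ n0) set0.
    by exists n0 => //; right; rewrite -(setD1K n0D) D0 setU0.
  by rewrite !inE => /andP[i0 iD]; exists i => //; left.
have Did : #|D :\ i| = d by move: Dd; rewrite (cardsD1 i) iD => -[].
have [i' [p' s']] := Phi_ses (koszul_ses i X) gX.
have pA := relproj_ext iD (relproj_tw1 (i := i) pX); have pB := relproj_ext iD pX.
have ij : i != j by apply: contraNneq jD => <-.
have jJK' : (j \in sd J [set i]) != (j \in K) by rewrite in_sd inE [j == i]eq_sym (negbTE ij) addbF.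
have jDi : j \notin D :\ i by rewrite !inE (negbTE jD) andbF.
suff [dA dB] : PD d (Phi (ext i (tw i X)) : ob (lmodcat G')) /\
               PD d (Phi (ext i X) : ob (lmodcat G')).
  by apply: (PD_coker s') => //; apply: PD_S.
case: i0 => [i0|D0].
  have n0Di : n0 \in D :\ i by rewrite !inE eq_sym i0.
  split; rewrite -Did.
    apply: IH Did n0Di pA _ _; last by exists j.
    by apply: above_ext => //; apply: above_tw.
  by apply: IH Did n0Di pB _ _; [apply: above_ext|exists j].
(* Adjoining n0 may create degree set0, but both objects are then free in a kept degree; no further
   sequence has to stay exact. *)
have i0 : i = n0 by apply/set1P; rewrite -D0.
have Di0 : D :\ i = set0 by rewrite D0 i0 setDv.
rewrite Di0 in pA pB; split; apply: PD_leq (leq0n d) _.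
  by apply: Phi_proj pA _ => J' <-; left; apply: mem_gd => e; rewrite e eqxx in jJK'.
by apply: Phi_proj pB _ => J' <-; left; apply: mem_gd => e; rewrite e eqxx in jJK.
Qed.

Let PD_removed X : (forall I (x : X), I != K -> re I x = 0) ->
  exists X' (j : X -> X'), [/\ PD n.-1 (Phi X' : ob (lmodcat G')), dhom setT j
    & forall Z (f : X -> Z), dhom setT f ->
        exists f' : X' -> Z, rhom f' /\ forall x, f' (j x) = f x].
Proof.
move=> XK.
(* The second clause records that n0 is adjoined last, so that [above] holds as long as a variable
   remains. *)
pose Q D Y := [/\ relproj D (eq K) Y, n0 \in D \/ D = set0, n0 \in D -> above Y
                & PD n.-1 (Phi Y : ob (lmodcat G'))].
have [||X' [j [[_ _ _ dX'] hj ej]]] := @ext_tower _ _ n0 Q _ setT X; last by exists X', j.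
- move=> D i Y iD i0 [pY [n0D|D0] aY dY]; last by rewrite D0 inE in iD.
  have {}aY := aY n0D; have gY := above_good aY.
  have [i' [p' s']] := Phi_ses (koszul_ses i Y) gY.
  have pA := relproj_ext iD (relproj_tw1 (i := i) pY); have pB := relproj_ext iD pY.
  (* The twisted copy is generated in degree [sd K [set i]], which differs from K at i; since i has
     left D, [PD_off_K] applies with j = i. *)
  have iK : (i \in sd K [set i]) != (i \in K).
    by rewrite in_sd inE eqxx addbT; case: (i \in K).
  have iDi : i \notin D :\ i by rewrite !inE eqxx.
  case: i0 => [i0|D0].
    have n0Di : n0 \in D :\ i by rewrite !inE eq_sym i0.
    split=> //; [by left|by move=> _; apply: above_ext|].
    (* An extension needs only the larger of the two dimensions, so the bound n - 1 does not grow
       along the tower. *)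
    apply: (PD_ext s') dY; apply: (@PD_leq _ #|D :\ i|).
      have Dn : (#|D :\ i| < n)%N.
        by have := max_card (mem D); rewrite card_ord (cardsD1 i) iD.
      by rewrite -ltnS (leq_trans Dn) // leqSpred.
    apply: PD_off_K n0Di pA _ _; last by exists i.
    by apply: above_ext => //; apply: above_tw.
  have ei : i = n0 by apply/set1P; rewrite -D0.
  have Di0 : D :\ i = set0 by rewrite D0 ei setDv.
  split=> //; [by right|by rewrite Di0 inE|].
  apply: (PD_ext s') dY; apply: PD_leq (leq0n _) _; rewrite Di0 in pA.
  by apply: Phi_proj pA _ => J' <-; left; apply: mem_gd => e; rewrite e eqxx in iK.
split.
- by apply: relproj_setT => I x KI; apply: XK; apply/eqP => e; apply: KI.
- by left; rewrite inE.
- by move=> _ I x n0I; apply: XK; apply: contraNneq n0I => ->.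
(* The tower starts from zero: X lives in degree K, which e kills. *)
apply: PD_leq (leq0n _) _; apply: proj_zero => z; apply: szval_inj.
have [x ->] := Phi_val z; rewrite big1 ?(islin0 (dhom_lin (red_pi_hom X))) // => J.
by rewrite gdK !inE; apply: XK.
Qed.

(** P is a retract of a sum of two free objects, one on its degree K part and one on the kept
    degrees; only the first has positive dimension after [Phi]. *)
Lemma Phi_proj_removed P : proj (P : ob (repcat k n)) -> PD n.-1 (Phi P : ob (lmodcat G')).
Proof.
move=> pP.
have [|X1 [j1 [d1 _ e1]]] := @PD_removed (degpart P [set K]).
  by move=> I x IK; apply: degpart_out; rewrite inE.
have [|X2 [j2 [p2 _ e2]]] := @free_cover _ _ n0 (fun J => J \in gd) (degpart P gd).
  by move=> I x /negP; apply: degpart_out.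
have [f1 [hf1 f1E]] := e1 _ _ (@degpart_val_hom _ _ P [set K]).
have [f2 [hf2 f2E]] := e2 _ _ (@degpart_val_hom _ _ P gd).
have [S [i1 [i2 [q1 [q2 [[h1 h2 h3 h4] [c1 c2 z1 z2 cs]]]]]]] := rep_biprod X1 X2.
have dS : PD n.-1 (Phi S : ob (lmodcat G')).
  apply: Phi_biprod h1 h2 h3 h4 c1 c2 z2 cs d1 _.
  by apply: PD_leq (leq0n _) _; apply: Phi_proj p2 _ => J; left.
pose f s := f1 (q1 s) + f2 (q2 s).
have hf : rhom f by apply: rhom_add; [apply: rhom_comp h3 hf1|apply: rhom_comp h4 hf2].
have sf : surj f.
  move=> y; pose y1 := re K y; pose y2 := \sum_(J in gd) re J y.
  have [w1 ew1] := degpart_ex y (set11 K).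
  have /choice[w wE] : forall J, exists z : degpart P gd, J \in gd -> degpart_val z = re J y.
    move=> J; have [Jgd|Jgd] := boolP (J \in gd); last by exists 0.
    by have [z ez] := degpart_ex y Jgd; exists z.
  exists (i1 (j1 w1) + i2 (\sum_(J in gd) j2 (w J))).
  rewrite /f (rhomD h3) (rhomD h4) c1 c2 z1 z2 addr0 add0r f1E ew1.
  rewrite (islin_sum (dhom_lin hf2)) -[RHS]re_sum [RHS](bigD1 K) //=; congr (_ + _).
  rewrite gdK; apply: eq_big => [J|J]; first by rewrite !inE.
  by rewrite -gdK => Jgd; rewrite f2E wE.
have [s [hs sK]] := proj_section pP hf sf.
have [i' [r' [hi' hr' ri']]] := Phi_retract hs hf sK.
exact: (PD_retract (enough_proj n0) hi' hr' ri' dS).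
Qed.

End OneDegreeRemoved.

End Phi.

(** * The lower bound *)

Section MinimalResolutions.
Variables (k : fieldType) (n : nat).
Implicit Types (X Y Z K P E : rep k n) (I J D : {set 'I_n}) (i j : 'I_n).

Definition srep J : rep k n.
Proof.
exists (k^o : lmodType k) (fun _ _ => 0) (fun I x => if I == J then x else 0).
- by move=> i a x y; rewrite scaler0 addr0.
- by move=> I a x y; case: eqP; rewrite ?scaler0 ?addr0.
- by [].
- move=> I I' x; case: (eqVneq I I') => [->|II']; first by case: (I' == J).
  by case: eqP => // IJ; case: eqP => // I'J; rewrite IJ I'J eqxx in II'.
- move=> x; rewrite (bigD1 J) //= eqxx big1 ?addr0 // => I /negbTE->.
  by [].
by move=> i I x; case: eqP.
Defined.

Lemma srep_tw i X J (f : X -> k^o) :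
  rhom (f : tw i X -> srep J) <-> rhom (f : X -> srep (sd J [set i])).
Proof.
have e I : (sd I [set i] == J) = (I == sd J [set i]).
  exact: (can2_eq (@sdK _ _) (@sdK _ _)).
split=> hf; split; [exact: dhom_lin hf| |exact: dhom_ra hf
                   |exact: dhom_lin hf| |exact: dhom_ra hf].
  by move=> I x; have := dhom_re hf (sd I [set i]) x; rewrite /= sdK e.
by move=> I x; have := dhom_re hf (sd I [set i]) x; rewrite /= (can_eq (@sdK _ _)).
Qed.

Lemma proj_tw i X : proj (X : ob (repcat k n)) -> proj (tw i X : ob (repcat k n)).
Proof. by move=> /proj_relproj/(relproj_tw (i := i))/relproj_proj. Qed.

Lemma ra_hom i X : @rhom _ _ (tw i X) X (ra i).
Proof.
split=> [|I x|j x _]; [exact: ra_lin|by rewrite /= ra_re sdK|exact: raC].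
Qed.

(** The image lies in the graded radical, phrased as vanishing under all maps to the simples
    [srep J]. *)
Definition minimal K P (i : K -> P) :=
  forall J (g : P -> srep J), rhom g -> forall z, g (i z) = 0.

(* A minimal projective resolution of length d whose last term maps onto the
   simple object of degree J. *)
Fixpoint minres d X J : Prop :=
  if d is d'.+1 then
    exists K P (i : K -> P) (p : P -> X),
      [/\ @ses (repcat k n) K P X i p, proj (P : ob (repcat k n)), minimal i & minres d' K J]
  else proj (X : ob (repcat k n)) /\ exists g : X -> srep J, rhom g /\ exists x, g x <> 0.

(** One step of the mapping cone of a_i on a resolution of Y. E is the preimage in P of a_i Y,
    covered by P' + [tw i P]. As a_i is injective on Y, projection to P' identifies the next syzygy
    with the preimage of a_i K: the same situation one step further. *)
Lemma cone_step i K P P' Y E (a : K -> P) (p : P -> Y) (b : P' -> K) (eps : E -> P) :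
  @ses (repcat k n) K P Y a p -> proj (P : ob (repcat k n)) -> minimal a ->
  injective (@ra _ _ Y i) -> rhom eps -> injective eps ->
  (forall x, (exists y, p x = ra i y) <-> exists z, eps z = x) ->
  proj (P' : ob (repcat k n)) -> rhom b -> surj b ->
  (forall J (g : P' -> srep J) q z, rhom g -> b q = ra i z -> g q = 0) ->
  exists (E' : rep k n) (eps' : E' -> P'), [/\ rhom eps', injective eps',
    forall x, (exists y, b x = ra i y) <-> exists z, eps' z = x
    & forall d J, minres d E' J -> minres d.+1 E J].
Proof.
move=> s pP min_a injY heps inj_eps imE pP' hb sb min_b.
have ha : rhom a := ses_homl s; have hp : rhom p := ses_homr s.
have [S [i1 [i2 [p1 [p2 [[h1 h2 h3 h4] [c1 c2 e1 e2 es] pS]]]]]] := proj_biprod pP' (proj_tw (i := i) pP).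
have {}h1 : rhom i1 := h1; have {}h2 : rhom i2 := h2.
have {}h3 : rhom p1 := h3; have {}h4 : rhom p2 := h4.
pose q x : P := a (b (p1 x)) + ra i (p2 x : P).
have hq : rhom q.
  apply: rhom_add; first exact: rhom_comp h3 (rhom_comp hb ha).
  exact: rhom_comp h4 (ra_hom i P).
have pq x : p (q x) = ra i (p (p2 x)).
  by rewrite (rhomD hp) (ses0 s) add0r (rhom_ra hp).
have [t [ht tE]] : exists t : S -> E, rhom t /\ forall x, eps (t x) = q x.
  apply: (hom_factor (C := repcat k n) hq heps inj_eps) => x.
  by apply/imE; exists (p (p2 x)).
have st : surj t.
  move=> z; have [y ey] : exists y, p (eps z) = ra i y by apply/imE; exists z.
  have [x ex] := ses_surj s y.
  have : p (eps z - ra i x) = 0.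
    by rewrite (islinB (dhom_lin hp)) (rhom_ra hp) ey -ex subrr.
  move=> /(ses_ker s)[w ew]; have [q' eq'] := sb w.
  exists (i1 q' + i2 x); apply: inj_eps; rewrite tE /q (rhomD h3) (rhomD h4).
  by rewrite c1 c2 e1 e2 addr0 add0r eq' ew subrK.
have [E' [j sE']] := kernel_ses (C := repcat k n) ht st.
have hj : rhom j := ses_homl sE'.
have q0 z : q (j z) = 0 by rewrite -tE (ses0 sE') (islin0 (dhom_lin heps)).
have injP := proj_ra_inj (i := i) pP.
exists E', (p1 \o j); split.
- exact: rhom_comp hj h3.
- apply: (hom_inj (C := repcat k n) (rhom_comp hj h3)) => z /= z0.
  apply: (ses_inj sE'); rewrite (islin0 (dhom_lin hj)) -[LHS]es z0.
  have p20 : p2 (j z) = 0.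
    apply: injP; have := q0 z; rewrite /q z0 (islin0 (dhom_lin hb)) (islin0 (dhom_lin ha)).
    by rewrite add0r (islin0 (@ra_lin _ _ P i)).
  by rewrite p20 (islin0 (dhom_lin h1)) (islin0 (dhom_lin h2)) addr0.
- move=> x; split=> [[y ey]|[z <-]].
    have /(ses_ker sE')[z ez] : t (i1 x - i2 (a y)) = 0.
      apply: inj_eps; rewrite tE (islin0 (dhom_lin heps)) /q.
      rewrite (islinB (dhom_lin h3)) (islinB (dhom_lin h4)) c1 c2 e1 e2 subr0 sub0r.
      by rewrite ey (rhom_ra ha) (islinN (@ra_lin _ _ P i)) subrr.
    by exists z; rewrite /= ez (islinB (dhom_lin h3)) c1 e1 subr0.
  have /(ses_ker s)[w ew] : p (p2 (j z)) = 0.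
    apply: injY; rewrite -pq q0 (islin0 (dhom_lin hp)).
    by rewrite (islin0 (@ra_lin _ _ Y i)).
  exists (- w); apply: (ses_inj s); rewrite (islinN (@ra_lin _ _ K i)) (islinN (dhom_lin ha)).
  rewrite (rhom_ra ha) ew; apply/eqP; rewrite -addr_eq0; apply/eqP.
  exact: q0.
move=> d J dE'; exists E', S, j, t; split=> // J' g hg z.
have /(ses_ker s)[w ew] : p (p2 (j z)) = 0.
  apply: injY; rewrite -pq q0 (islin0 (dhom_lin hp)).
  by rewrite (islin0 (@ra_lin _ _ Y i)).
rewrite -[j z]es (rhomD hg) [X in _ + X](_ : _ = 0) ?addr0; last first.
  have hg2 : rhom (g \o i2 : P -> srep (sd J' [set i])).
    by apply/srep_tw; apply: rhom_comp h2 hg.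
  by rewrite -ew; apply: (min_a _ _ hg2).
apply: (min_b _ (g \o i1) (p1 (j z)) (- w)); first exact: rhom_comp h1 hg.
apply: (ses_inj s); rewrite (islinN (@ra_lin _ _ K i)) (islinN (dhom_lin ha)).
rewrite (rhom_ra ha) ew; apply/eqP; rewrite -addr_eq0; apply/eqP.
exact: q0.
Qed.

(** Iterates [cone_step] down the resolution; the last term is a twist by i, which moves the degree
    of the simple quotient to [sd J [set i]]. *)
Lemma minres_cone i d J K P Y E (a : K -> P) (p : P -> Y) (eps : E -> P) :
  @ses (repcat k n) K P Y a p -> proj (P : ob (repcat k n)) -> minimal a ->
  injective (@ra _ _ Y i) -> rhom eps -> injective eps ->
  (forall x, (exists y, p x = ra i y) <-> exists z, eps z = x) ->
  minres d K J -> minres d.+1 E (sd J [set i]).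
Proof.
elim: d K P Y E a p eps => [|d IH] K P Y E a p eps s pP min_a injY heps inj_eps imE dK.
  have [pK [g [hg [x gx]]]] := dK.
  have [|E' [eps' [heps' inj_eps' imE' step]]] :=
    cone_step s pP min_a injY heps inj_eps imE pK (@rhom_id _ _ K) (fun y => ex_intro _ y erefl).
    by move=> J' g' q z hg' ->; rewrite (rhom_ra hg').
  apply: step.
  (* Here K is projective and covered by the identity, so E' is the image of a_i, isomorphic to
     [tw i K]. *)
  have [f [hf fE]] : exists f : tw i K -> E', rhom f /\ forall z, eps' (f z) = ra i z.
    apply: (hom_factor (C := repcat k n) (ra_hom i K) heps' inj_eps') => z.
    by apply/imE'; exists z.
  have injK := proj_ra_inj (i := i) pK.
  have /choice[f' f'E] : forall z, exists y : K, eps' z = ra i y.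
    by move=> z; apply/imE'; exists z.
  have ff' : cancel f' f by move=> z; apply: inj_eps'; rewrite fE f'E.
  have f'f : cancel f f' by move=> z; apply: injK; rewrite -f'E fE.
  have hf' : @rhom _ _ E' (tw i K) f'.
    apply: (rhom_cancel hf (can_inj f'f)).
    by have -> : f \o f' = id by [apply/funext]; apply: rhom_id.
  split; first exact: (proj_retract (C := repcat k n) (proj_tw (i := i) pK) hf' hf ff').
  exists (g \o f'); split.
    by apply: rhom_comp hf' _; apply/srep_tw; rewrite sdK.
  by exists (f x); rewrite /= f'f.
have [K' [P' [a' [b [s' pP' min_a' dK']]]]] := dK.
have hb : rhom b := ses_homr s'.
have [|E' [eps' [heps' inj_eps' imE' step]]] :=
    cone_step s pP min_a injY heps inj_eps imE pP' hb (ses_surj s').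
  move=> J' g q z hg; have [q' <-] := ses_surj s' z; rewrite -(rhom_ra hb) => e.
  have : b (q - ra i q') = 0 by rewrite (islinB (dhom_lin hb)) e subrr.
  move=> /(ses_ker s')[w ew]; rewrite -(subrK (ra i q') q) -ew (rhomD hg) (min_a' _ _ hg).
  by rewrite (rhom_ra hg) add0r.
apply: step; apply: IH s' pP' min_a' _ heps' inj_eps' imE' dK'.
move=> x y e; apply: (ses_inj s); apply: (proj_ra_inj (i := i) pP).
by rewrite -!(rhom_ra (ses_homl s)) e.
Qed.

(** X is Y / a_i Y with a_i regular on Y, so the cone of a_i on a minimal resolution of Y resolves X
    minimally, one step longer. *)
Lemma minres_quot i d J Y X (p : Y -> X) : rhom p -> surj p ->
  (forall y, p y = 0 <-> exists z, ra i z = y) -> injective (@ra _ _ Y i) ->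
  minres d Y J -> minres d.+1 X (sd J [set i]).
Proof.
move=> hp sp kp injY; case: d => [|d] dY.
  have [pY [g [hg [x gx]]]] := dY.
  exists (tw i Y), Y, (@ra _ _ Y i), p; split=> //.
  - by split=> //; apply: ra_hom.
  - by move=> J' g' hg' z; rewrite (rhom_ra hg').
  split; first exact: proj_tw.
  by exists g; split; [apply/srep_tw; rewrite sdK|exists x].
have [K [P [a [q [s pP min_a dK]]]]] := dY; have hq : rhom q := ses_homr s.
have hpq : rhom (p \o q) := rhom_comp hq hp.
have spq : surj (p \o q).
  by move=> x; have [y <-] := sp x; have [z <-] := ses_surj s y; exists z.
have [E [eps sE]] := kernel_ses (C := repcat k n) hpq spq.
have imE x : (exists y, q x = ra i y) <-> exists z, eps z = x.
  rewrite -(ses_ker sE) /= kp; split=> [[y ->]|[z ez]]; first by exists y.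
  by exists z.
exists E, P, eps, (p \o q); split=> //; last first.
  exact: (minres_cone s pP min_a injY (ses_homl sE) (ses_inj sE) imE dK).
move=> J' g hg z; have /imE[y ey] : exists z', eps z' = eps z by exists z.
have [x ex] := ses_surj s y.
have : q (eps z - ra i x) = 0.
  by rewrite (islinB (dhom_lin hq)) (rhom_ra hq) ex ey subrr.
move=> /(ses_ker s)[w ew]; rewrite -(subrK (ra i x) (eps z)) -ew (rhomD hg) (min_a _ _ hg).
by rewrite (rhom_ra hg) add0r.
Qed.

(** For i in D the module X is [ext i X] modulo its regular variable, and [ext i X] has one variable
    fewer acting by zero. *)
Lemma minres_tower D J X : relproj D (fun=> True) X ->
  (forall i, i \notin D -> injective (@ra _ _ X i)) ->
  (forall i (x : X), i \in D -> ra i x = 0) ->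
  (exists g : X -> srep J, rhom g /\ exists x, g x <> 0) -> minres #|D| X (sd J D).
Proof.
have [d Dd] : exists d, #|D| = d by exists #|D|.
elim: d D X Dd => [|d IH] D X Dd pX injX zX [g [hg [x gx]]].
  rewrite (cards0_eq Dd) cards0 sd0 in pX *; split; first exact: relproj_proj pX.
  by exists g; split=> //; exists x.
have [i iD] : exists i, i \in D by apply/set0Pn; rewrite -cards_eq0 Dd.
have Did : #|D :\ i| = d by move: Dd; rewrite (cardsD1 i) iD => -[].
have s := koszul_ses i X; rewrite Dd.
have -> : sd J D = sd (sd J (D :\ i)) [set i].
  apply/setP=> j; rewrite !in_sd !inE -addbA; congr (_ (+) _).
  by case: eqP => [->|]; rewrite ?iD ?addbF.
apply: (minres_quot (p := evext (@id X))).
- exact: ses_homr s.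
- exact: ses_surj s.
(* Since a_i is zero on X, the Koszul map t - a_i is t itself. *)
- have kE (z : ext i X) : koszul (z : ext i (tw i X)) = ra i z.
    apply: ext_coef => m; rewrite koszulE ext_raE eqxx zX // subr0.
    by [].
  by move=> y; rewrite (ses_ker s); split=> -[z <-]; exists z; rewrite kE.
- by apply: ra_ext_inj; left.
rewrite -Did; apply: IH => //.
- exact: relproj_ext.
- move=> l; rewrite !inE negb_and negbK => h; apply: ra_ext_inj.
  by case/orP: h => [/eqP|/injX]; [left|right].
- move=> l z; rewrite !inE => /andP[/negbTE li lD]; apply: ext_coef => m.
  by rewrite ext_raE li zX.
exists (g \o evext (@id X)); split; first exact: rhom_comp (ses_homr s) hg.
by have [z ez] := ses_surj s x; exists z; rewrite /= ez.
Qed.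

Lemma minres_srep J : minres n (srep J) (~: J).
Proof.
have -> : ~: J = sd J setT by apply/setP=> j; rewrite in_sd !inE addbT.
have := @minres_tower setT J (srep J); rewrite cardsT card_ord; apply=> //.
- exact: relproj_setT.
- by move=> i; rewrite inE.
exists id; split; first exact: rhom_id.
by exists 1; apply/eqP/oner_neq0.
Qed.

End MinimalResolutions.

(** * Minimal resolutions bound projective dimension from below *)

Section LowerBound.
Variables (k : fieldType) (n : nat) (T : gmod k n) (G' : pzRingType).
Variable C : corner (End (gM T)) G'.
Variable gd : {set {set 'I_n}}.
Local Notation G := (End (gM T)).
Local Notation e := (cin C 1).
Hypothesis e_idem : forall J, e * idem T J = if J \in gd then idem T J else 0.
Hypothesis idem_e : forall J, idem T J * e = if J \in gd then idem T J else 0.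
Hypothesis e1 : e = 1.
Hypothesis gdT : forall J, J \in gd \/ J = set0.
Variable n0 : 'I_n.
Local Notation Phi := (Phi C).
Implicit Types (X P K : rep k n).

Let projPhi P : proj (P : ob (repcat k n)) -> proj (Phi P : ob (lmodcat G')).
Proof. exact: Phi_proj_all. Qed.

(** Fullness of [Phi] when e = 1: a module map on the reductions comes from a map of representations
    out of P. *)
Let fromPhi P K (r : Phi P -> Phi K) : islin r ->
  exists f : P -> red K, rhom f /\ forall x, f x = szval (r (resk C (red_pi x : Gam T P))).
Proof.
move=> hr; pose f y : Gam T K := szval (r (resk C (y : Gam T P))).
have hf : islin f.
  move=> g x y; rewrite /f.
  have -> : resk C (g *: x + y) = cout C g *: resk C x + resk C y.
    by apply: szval_inj; rewrite res_valL /= cinK e1 mul1r mulr1 !scale1r.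
  by rewrite hr res_valL cinK e1 mul1r mulr1.
exists (fun x => f (red_pi x)); split=> //.
have hf' : rhom (f : red P -> toRep (Gam T K)) by apply/(rhom_toRep (@reduced_red _ _ P)).
apply: (rhom_comp (red_pi_hom P)); split=> [c x y|I x|i x _].
- rewrite (dhom_lin hf'); congr (_ + _).
  by rewrite -(act_kscal T (@reduced_red _ _ K)).
- by rewrite (dhom_re hf') -(act_idem T (@reduced_red _ _ K)).
by rewrite (rhom_ra hf') -(act_alpha T (@reduced_red _ _ K)).
Qed.

(** Both lengths are shifted down together by [PD_syzygy]. The condition on J makes [srep J]
    reduced, so the final map to the simple factors through [red K]. *)
Lemma minres_PD d m X J : J <> set0 -> good X -> minres d X J ->
  PD m (Phi X : ob (lmodcat G')) -> (d <= m)%N.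
Proof.
move=> J0; elim: d m X => [//|d IH] m X gX [K [P [i [p [s pP min_i dK]]]]] dX.
have gK : good K := good_sub (ses_homl s) (ses_inj s) (proj_good pP).
have [i' [p' [s' i'E]]] := Phi_ses_val C s gX.
have syz m' : PD m'.+1 (Phi X : ob (lmodcat G')) -> PD m' (Phi K : ob (lmodcat G')).
  exact: (PD_syzygy (enough_proj e_idem idem_e n0) s' (projPhi pP)).
case: m dX => [|m] dX; last by rewrite ltnS; apply: IH dK (syz _ dX).
(* Now [Phi X] is projective, hence so is [Phi K], and only a resolution of length one is left. *)
have := IH 0%N K gK dK (syz _ (PD_S dX)); rewrite leqn0 => /eqP d0.
move: dK; rewrite d0 => -[_ [g [hg [x gx]]]]; case: gx.
have [t [ht pt]] := proj_section dX (ses_homr s') (ses_surj s').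
have [r [hr ir]] : exists r : Phi P -> Phi K, islin r /\ forall z, i' (r z) = z - t (p' z).
  apply: (hom_factor (C := lmodcat G') _ (ses_homl s') (ses_inj s')) => [|z].
    apply: islin_add; first exact: islin_id.
    by apply: islin_opp; apply: islin_comp (ses_homr s') ht.
  by apply/(ses_ker s'); rewrite (islinB (ses_homr s')) pt subrr.
have ri z : r (i' z) = z.
  by apply: (ses_inj s'); rewrite ir (ses0 s') (islin0 ht) subr0.
(* The retraction extends the nonzero map K -> [srep J] to P, against minimality of [i]. *)
have S0 : reduced (srep k J) by move=> y /=; case: eqP => // /esym.
have [f [hf fE]] := fromPhi hr; have [h [hh hE]] := red_desc hg S0.
have := min_i _ _ (rhom_comp hf hh) x; rewrite /= fE.
have -> : resk C (red_pi (i x) : Gam T P) = i' (resk C (red_pi x : Gam T K)).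
  apply: szval_inj; rewrite (i'E _ x) /= ?e1 ?scale1r //.
by rewrite ri /= e1 scale1r hE.
Qed.

End LowerBound.

(** * The modules M and M' *)

Section FinitelyGenerated.
Variables (A : comPzRingType) (E : finType) (N : E -> lmodType A).

Lemma dirsum_sumE (T : Type) (r : seq T) (F : T -> dirsum N) t :
  (\sum_(x <- r) F x : dirsum N) t = \sum_(x <- r) F x t.
Proof. by elim/big_rec2: _ => [|x u v _ <-]; rewrite ffunE. Qed.

Lemma dirsum_fin_gen (g : forall t, N t) :
  (forall t y, exists a, y = a *: g t) -> fin_gen (dirsum N).
Proof.
move=> gE; pose gen t : dirsum N := [ffun t' => if t' == t then g t' else 0].
exists #|E|, (fun i => gen (enum_val i)) => x.
have /choice[c ec] : forall t, exists a : A, x t = a *: g t by move=> t; apply: gE.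
exists (fun i => c (enum_val i)); apply/ffunP => t; rewrite dirsum_sumE.
rewrite (bigD1 (enum_rank t)) //= big1 => [|i it].
  by rewrite addr0 !ffunE enum_rankK eqxx.
rewrite !ffunE; case: eqP => [e|_]; last by rewrite scaler0.
by rewrite e enum_valK eqxx in it.
Qed.

End FinitelyGenerated.

Section Instances.
Variables (k : fieldType) (n : nat).
Implicit Types (I J K : {set 'I_n}).

Lemma Rpi_is_additive : {morph @Rpi k n : s t / s - t}.
Proof. exact: RpiB. Qed.

Lemma Rpi_is_multiplicative : multiplicative (@Rpi k n).
Proof. by split=> [s t|]; [apply: RpiM|apply: Rpi1]. Qed.

Definition Rpi_rmorph : {rmorphism {mpoly k[n]} -> ncR k n} :=
  HB.pack (@Rpi k n) (GRing.isAdditive.Build _ _ (@Rpi k n) Rpi_is_additive)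
    (GRing.isMultiplicative.Build _ _ (@Rpi k n) Rpi_is_multiplicative).

Definition ncM_gmod : gmod k n :=
  @GMod k n (ncR k n) Rpi_rmorph (ncM k n) (@mk k n)
    (@Rpi_surj k n) (@mk_surj k n) (@mk_eq k n) (@mkD k n) (@mkZ k n).

Section DirectSummand.
Variables (A : comPzRingType) (M N : lmodType A) (io : N -> M) (pr : M -> N).
Hypotheses (hio : islin io) (hpr : islin pr) (iopr : cancel io pr).

Let cin_fun (g : End N) : End M := lin_of (islin_comp hpr (islin_comp (islinP g) hio)).
Let cout_fun (u : End M) : End N := lin_of (islin_comp hio (islin_comp (islinP u) hpr)).

Definition summand_corner : corner (End M) (End N).
Proof.
exists cin_fun cout_fun.
- by move=> g h; apply: EndP => u; apply: (islinD hio).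
- by move=> g h; apply: EndP => u; rewrite /= /lin_fun /= iopr.
- by move=> g; apply: EndP => u; rewrite /= /lin_fun /= !iopr.
by move=> u; apply: EndP.
Defined.

End DirectSummand.

Section RemoveOne.
Variable K : {set 'I_n}.

(** Matching on the reflection supplies the proof of [I != K] that an index of M' carries; the
    removed summand is filled with 0. *)
Definition incl_fun (u : ncM' k K) (I : {set 'I_n}) : ncN k I :=
  match @idP (I != K) with
  | ReflectT h => u (exist _ I h)
  | ReflectF _ => 0
  end.

Definition incl (u : ncM' k K) : ncM k n := [ffun I => incl_fun u I].
Definition proj_fun (v : ncM k n) : ncM' k K :=
  [ffun t : {I : {set 'I_n} | I != K} => v (val t)].

Lemma incl_lin : islin incl.
Proof.
move=> a u v; apply/ffunP => I; rewrite !ffunE /incl_fun.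
by case: {-}_ / idP => h; rewrite ?ffunE ?scaler0 ?addr0.
Qed.

Lemma proj_lin : islin proj_fun.
Proof. by move=> a u v; apply/ffunP => t; rewrite !ffunE. Qed.

Lemma inclK : cancel incl proj_fun.
Proof.
move=> u; apply/ffunP => -[I h]; rewrite !ffunE /= /incl_fun.
by case: {-}_ / idP => // h'; rewrite (bool_irrelevance h' h).
Qed.

Lemma incl_mk s : incl (proj_fun (mk s)) = mk (fun I => if I == K then 0 else s I).
Proof.
apply/ffunP => I; rewrite !ffunE /incl_fun.
case: {-}_ / idP => [h|/negP]; first by rewrite !ffunE /= (negbTE h).
rewrite negbK => /eqP->; rewrite eqxx; apply: (addrI (Npi K 0)).
by rewrite -NpiD !addr0.
Qed.

Definition ncM'_corner : corner (End (ncM k n)) (End (ncM' k K)) :=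
  summand_corner incl_lin proj_lin inclK.

Lemma ncM'_e J :
  cin ncM'_corner 1 * idem ncM_gmod J = if J \in ~: [set K] then idem ncM_gmod J else 0.
Proof.
apply: EndP => u; have [s <-] := @mk_surj k n u.
rewrite -[LHS]/(incl (proj_fun (idem ncM_gmod J (mk s)))) (idemE ncM_gmod) incl_mk.
rewrite !inE; have [->|JK] := eqVneq J K; last first.
  rewrite (idemE ncM_gmod); congr mk; apply/funext=> I.
  by case: eqP => // ->; rewrite eq_sym (negbTE JK).
rewrite -[RHS](mk0 ncM_gmod); congr mk; apply/funext=> I.
by case: eqP.
Qed.

Lemma ncM'_e' J :
  idem ncM_gmod J * cin ncM'_corner 1 = if J \in ~: [set K] then idem ncM_gmod J else 0.
Proof.
apply: EndP => u; have [s <-] := @mk_surj k n u.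
rewrite -[LHS]/(idem ncM_gmod J (incl (proj_fun (mk s)))) incl_mk (idemE ncM_gmod).
rewrite !inE; have [->|JK] := eqVneq J K; last first.
  rewrite (idemE ncM_gmod); congr mk; apply/funext=> I.
  by case: (eqVneq I J) => // ->; rewrite (negbTE JK).
rewrite -[RHS](mk0 ncM_gmod); congr mk; apply/funext=> I.
by case: eqP.
Qed.

End RemoveOne.

(** The whole ring as its own corner, so that M is covered by the same functor with every degree
    kept. *)
Definition ncM_corner : corner (End (ncM k n)) (End (ncM k n)).
Proof.
exists id id => //.
by move=> u; rewrite mul1r mulr1.
Defined.

Section Generators.
Variables (E : finType) (nu : E -> {set 'I_n}).
Local Notation D := (dirsum (fun t => ncN k (nu t))).

Definition gen (t : E) : D := [ffun t' => if t' == t then pquot_pi _ 1 else 0].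

Lemma ncN_dirsum_fin_gen : fin_gen D.
Proof.
apply: (dirsum_fin_gen (g := fun t => pquot_pi _ 1)) => t y; exists (repr (y : pquot _)).
by rewrite [RHS]pquot_scaleE mulr1 pquot_piK.
Qed.

Lemma prime_prod (p : ncR k n -> Prop) (r : seq 'I_n) (F : 'I_n -> ncR k n) :
  prime_ideal p -> p (\prod_(i <- r) F i) -> exists i, p (F i).
Proof.
case=> _ _ _ p1 pM; elim: r => [|i r IH]; first by rewrite big_nil.
by rewrite big_cons => /pM[|/IH//]; exists i.
Qed.

Lemma ncx_prod0 : \prod_(i < n) ncx k i = 0.
Proof.
rewrite -[LHS]Rpi_prod -Rpi0; apply/pquot_piE/principalP; exists 1.
by rewrite subr0 mul1r.
Qed.

(** A prime contains some x_i, because their product is 0. Choose a summand with i in [nu t]: the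
    annihilator of its generator is (x_(nu t)), contained in p, so the generator survives
    localization. *)
Lemma dirsum_supp p : (forall i, exists t, i \in nu t) -> supp D p <-> supp (ncR k n)^o p.
Proof.
move=> hnu; split=> -[pp _]; split=> //; have [p0 _ pM p1 _] := pp.
  exists 1, 1; split=> // -[u [pu]] /=; rewrite !scale1r subr0 => u0.
  by apply: pu; rewrite -[u]mulr1 -[u * 1]/(u *: (1 : (ncR k n)^o)) u0.
have [i pi] : exists i, p (ncx k i) by apply: (@prime_prod p (index_enum _) (@ncx k n) pp); rewrite ncx_prod0.
have [t it] := hnu i; exists (gen t), 1; split=> // -[u [pu]] /=.
rewrite !scale1r subr0 => /ffunP/(_ t); rewrite !ffunE eqxx => e.
have /pquot_piE/principalP[a] : pquot_pi (\prod_(j in nu t) ncx k j) (u * 1) = pquot_pi _ 0.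
  have pi0 : pquot_pi (\prod_(j in nu t) ncx k j) 0 = 0.
    by apply: (addrI (pquot_pi _ 0)); rewrite -pquot_piD !addr0.
  by rewrite pi0 -[LHS]pquot_scaleE; apply: etrans e _.
by rewrite subr0 mulr1 => ea; apply: pu; rewrite ea (bigD1 i) //= mulrCA mulrC; apply: pM.
Qed.

End Generators.

End Instances.

Theorem theorem5p5 (k : fieldType) (n : nat) (hn : (1 < n)%N) :
  (is_NCR (ncM k n) /\ gldim_eq (End (ncM k n)) n) /\
  (forall K : {set 'I_n},
     is_NCR (ncM' k K) /\ gldim_le (End (ncM' k K)) (2 * n - 1)).
Proof.
pose n0 := Ordinal (ltnW hn).
pose C := ncM_corner k n; pose T := ncM_gmod k n.
have eC J : cin C 1 * idem T J = if J \in setT then idem T J else 0 by rewrite inE mul1r.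
have eC' J : idem T J * cin C 1 = if J \in setT then idem T J else 0 by rewrite inE mulr1.
have gdT (J : {set 'I_n}) : J \in setT \/ J = set0 by left; rewrite inE.
have leM : gldim_le (End (ncM k n)) n.
  move=> V; suff h : PD (n + 0) (V : ob (lmodcat _)) by rewrite addn0 in h; apply: PD_pd_le.
  apply: (Phi_gldim (T := T) (C := C) eC) => P pP.
  exact: (Phi_proj_all (T := T) (C := C) eC eC' gdT).
split; first split.
- split; last by exists n.
    exact: (@ncN_dirsum_fin_gen k n _ id).
  by move=> p; apply: (@dirsum_supp k n _ id) => i; exists [set i]; rewrite inE.
- split=> // e /(_ (Phi (T := T) C (srep k [set n0])))/pd_le_PD.
  apply: (minres_PD (T := T) (C := C) eC eC' _ gdT n0 _ _ (minres_srep k [set n0])) => //.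
    (* The last degree [~: [set n0]] is nonempty: by 1 < n the index 1 exists, and n0 is the index
       0. *)
    move=> /setP/(_ (Ordinal hn)); rewrite !inE; case: eqP => // /(congr1 val) //.
  by apply: reduced_good => y /=; case: eqP => // /setP/(_ n0); rewrite !inE eqxx.
move=> K; have leK : gldim_le (End (ncM' k K)) (2 * n - 1).
  have e2 : (n + n.-1 = 2 * n - 1)%N by rewrite mul2n -addnn -addnBA ?subn1 // ltnW.
  move=> V; suff h : PD (n + n.-1) (V : ob (lmodcat _)) by rewrite e2 in h; apply: PD_pd_le.
  apply: (@Phi_gldim k n T _ (ncM'_corner k K) _ (ncM'_e k K) n.-1 V) => P pP.
  (* For K = set0 the omitted summand is zero and all nonempty degrees remain, so projectives stay
     projective. *)
  have [K0|/set0Pn[i iK]] := eqVneq K set0; last first.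
    exact: (Phi_proj_removed (T := T) (ncM'_e k K) (ncM'_e' k K) iK).
  apply: PD_leq (leq0n _) _; apply: (Phi_proj_all (T := T) (ncM'_e k K) (ncM'_e' k K)) => //.
  by move=> J; rewrite !inE K0; case: eqP; [right|left].
split=> //; split; last by exists (2 * n - 1)%N.
  exact: (@ncN_dirsum_fin_gen k n _ (fun t : {I : {set 'I_n} | I != K} => val t)).
move=> p; apply: (@dirsum_supp k n _ (fun t : {I : {set 'I_n} | I != K} => val t)) => i.
(* A remaining summand whose index contains i: [set i], or the full set if [set i] was removed;
   these differ because 1 < n. *)
have [eK|nK] := eqVneq [set i] K; last by exists (exist _ [set i] nK); rewrite /= inE.
have nT : [set: 'I_n] != K.
  rewrite -eK; apply/eqP => /(congr1 (fun A : {set 'I_n} => #|A|)).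
  by rewrite cardsT card_ord cards1 => n1; have := hn; rewrite n1.
by exists (exist _ setT nT); rewrite /= inE.
Qed.
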